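(* The dynamical determinant of a smooth diffeomorphism with smooth weight on a hyperbolic basic set may be of any (finite or infinite) genus: for every $\gamma\in\mathbb{N}\cup\{\infty\}$ there are a smooth manifold $M$, a smooth diffeomorphism $T:M\to M$, a hyperbolic basic set $K$ for $T$ and a smooth function $g:M\to\mathbb{C}$ such that the dynamical determinant $d_{T,g}$ has genus $\gamma$.
   Context: Conventions: $\mathbb{N}=\{0,1,2,\dots\}$; smooth means $C^\infty$; $\log_+x=\log\max(1,x)$. Hyperbolic basic set: for a smooth diffeomorphism $T:M\to M$, a $T$-invariant compact set $K\subset M$ is a hyperbolic basic set for $T$ if (1) there is a Riemannian metric on a neighbourhood of $K$, for each $x\in K$ a splitting $T_xM=E^u_x\oplus E^s_x$ with $D_xT(E^i_x)=E^i_{Tx}$ ($i\in\{u,s\}$), and constants $\lambda>1$, $c>0$ with $\|D_xT^n|_{E^s_x}\|\le c\lambda^{-n}$ and $\|D_xT^{-n}|_{E^u_x}\|\le c\lambda^{-n}$ for all $n\in\mathbb{N}$, $x\in K$; (2) there is a neighbourhood $V$ of $K$ with $K=\bigcap_{n\in\mathbb{Z}}T^n(V)$ (such a $V$ is called isolating); (3) $T|_K$ is transitive. The weight $g$ is always assumed supported in a small enough compact isolating neighbourhood of $K$ (the determinant only depends on the values of $g$ on $K$). Dynamical determinant: $d_{T,g}(z)=\exp\left(-\sum_{n\ge1}\frac1n\sum_{x\in K,\ T^nx=x}\frac{\prod_{k=0}^{n-1}g(T^kx)}{|\det(I-D_xT^n)|}z^n\right)$, which is known to extend to an entire function when $T$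 and $g$ are smooth. Order and genus: the order of an entire function $f$ is $\limsup_{r\to+\infty}\frac{\log_+\log_+(\sup_{|z|\le r}|f(z)|)}{\log r}$. If $f$ has finite order and $f(0)\neq0$, with zeros $(z_m)$ counted with multiplicity, let $p$ be the smallest natural integer with $\sum_m|z_m|^{-(p+1)}<\infty$; by Hadamard's theorem $f(z)=e^{Q(z)}\prod_mE(z/z_m,p)$ with $Q$ a polynomial and $E(u,p)=(1-u)\exp(\sum_{k=1}^pu^k/k)$. The genus of $f$ is $\max(\deg Q,p)$. The genus of an entire function of infinite order is infinite. *)

(* Defs.v *)
From HB Require Import structures.
From mathcomp Require Import all_boot all_order all_algebra.
From mathcomp Require Import all_classical all_reals all_analysis.
From mathcomp Require Import complex.

Set Implicit Arguments.
Unset Strict Implicit.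
Unset Printing Implicit Defensive.

Import Order.TTheory GRing.Theory Num.Theory.
Import numFieldNormedType.Exports.

Local Open Scope classical_set_scope.
Local Open Scope ring_scope.
Local Open Scope card_scope.
Local Open Scope complex_scope.

(* The topology of R[i] is the one of its modulus.  As a normed module, R[i]
   is a module over itself, so that [derivable] below is complex
   differentiability. *)
HB.instance Definition _ (R : rcfType) :=
  PseudoPointedMetric.copy R[i] (R[i])^o.
HB.instance Definition _ (R : rcfType) := NormedModule.copy R[i] (R[i])^o.

Section Smoothness.
Context {R : realType}.

Fixpoint Ck_on {n : nat} {V : normedModType R} (k : nat)
    (U : set 'rV[R]_n) (f : 'rV[R]_n -> V) : Prop :=
  {in U, continuous f} /\
  (if k is k'.+1 then
     forall v : 'rV[R]_n, {in U, forall x, derivable f x v} /\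
                          Ck_on k' U (fun x => 'D_v f x)
   else True).

(* Only used on open sets U. *)
Definition smooth_on {n : nat} {V : normedModType R}
    (U : set 'rV[R]_n) (f : 'rV[R]_n -> V) : Prop :=
  forall k, Ck_on k U f.

End Smoothness.

(* The values of [cmap] outside [cdom], and of [cinv] outside the image of
   [cdom], are irrelevant. *)
Record chart (R : realType) (n : nat) (M : topologicalType) := Chart {
  cdom : set M;
  cmap : M -> 'rV[R]_n;
  cinv : 'rV[R]_n -> M;
  cdom_open : open cdom;
  cimg_open : open (cmap @` cdom);
  cmapK : {in cdom, cancel cmap cinv};
  cmap_continuous : {in cdom, continuous cmap};
  cinv_continuous : {in cmap @` cdom, continuous cinv} }.

(* Smooth manifolds of dimension n without boundary.  The atlas need not be
   maximal. *)
Record smoothManifold (R : realType) (n : nat) := SmoothManifold {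
  mcarrier :> topologicalType;
  mhausdorff : hausdorff_space mcarrier;
  msecond_countable : @second_countable mcarrier;
  atlas : set (chart R n mcarrier);
  (* a preferred chart around each point, used to represent tangent vectors *)
  chart_at : mcarrier -> chart R n mcarrier;
  chart_at_atlas : forall x, atlas (chart_at x);
  chart_at_dom : forall x, cdom (chart_at x) x;
  atlas_compatible : forall a b, atlas a -> atlas b ->
    smooth_on (cmap a @` (cdom a `&` cdom b)) (cmap b \o cinv a) }.

Section Manifolds.
Context {R : realType}.

Definition smooth_map {m n : nat} {M : smoothManifold R m}
    {N : smoothManifold R n} (F : M -> N) : Prop :=
  continuous F /\
  forall a b, atlas a -> atlas b ->
    smooth_on (cmap a @` (cdom a `&` F @^-1` cdom b)) (cmap b \o F \o cinv a).

Definition smooth_cfun {n : nat} {M : smoothManifold R n} (g : M -> R[i]) :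
    Prop :=
  forall a, atlas a ->
    smooth_on (cmap a @` cdom a) (fun y => complex.Re (g (cinv a y))) /\
    smooth_on (cmap a @` cdom a) (fun y => complex.Im (g (cinv a y))).

(* T_xM is identified with row vectors by means of the derivative of the
   preferred chart at x.  In these coordinates D_xF is v |-> v *m tangent F x. *)
Definition tangent {m n : nat} {M : smoothManifold R m}
    {N : smoothManifold R n} (F : M -> N) (x : M) : 'M[R]_(m, n) :=
  'J (cmap (chart_at (F x)) \o F \o cinv (chart_at x)) (cmap (chart_at x) x).

(* G x is the Gram matrix of the metric on T_xM, in the coordinates of the
   preferred chart at x; smoothness is tested in each fixed chart a of the
   atlas, where the Gram matrix is P *m G x *m P^T with P the change of
   coordinates from a to the preferred chart at x. *)
Definition riemannian_metric_on {n : nat} {M : smoothManifold R n}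
    (U : set M) (G : M -> 'M[R]_n) : Prop :=
  [/\ forall x, U x -> (G x)^T = G x,
      forall x (v : 'rV[R]_n), U x -> v != 0 -> 0 < (v *m G x *m v^T) 0 0
    & forall a, atlas a ->
        smooth_on (cmap a @` (cdom a `&` U))
          (fun y => let x := cinv a y in
                    let P := 'J (cmap (chart_at x) \o cinv a) y in
                    P *m G x *m P^T)].

Definition tnorm {n : nat} {M : smoothManifold R n} (G : M -> 'M[R]_n)
    (x : M) (v : 'rV[R]_n) : R :=
  Num.sqrt ((v *m G x *m v^T) 0 0).

End Manifolds.

Record diffeo (R : realType) (n : nat) (M : smoothManifold R n) := Diffeo {
  dfun :> M -> M;
  dinv : M -> M;
  dfunK : cancel dfun dinv;
  dinvK : cancel dinv dfun;
  dfun_smooth : smooth_map dfun;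
  dinv_smooth : smooth_map dinv }.

Section BasicSets.
Context {R : realType} {n : nat} {M : smoothManifold R n}.
Variables (T : diffeo M) (K : set M).

Definition ziter (k : int) : M -> M :=
  match k with Posz j => iter j T | Negz j => iter j.+1 (dinv T) end.

Definition hyperbolic : Prop :=
  exists (U : set M) (G Eu Es : M -> 'M[R]_n) (lambda c : R),
    [/\ open U /\ K `<=` U,
        riemannian_metric_on U G,
        (* the subspaces E^u_x, E^s_x are the row spaces of Eu x, Es x *)
        forall x, K x ->
          [/\ row_full (Eu x + Es x)%MS,
              (Eu x :&: Es x)%MS = 0,
              (Eu x *m tangent T x == Eu (T x))%MS
            & (Es x *m tangent T x == Es (T x))%MS],
        1 < lambda /\ 0 < c
      & forall x, K x -> forall (j : nat) (v : 'rV[R]_n),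
          ((v <= Es x)%MS ->
             tnorm G (iter j T x) (v *m tangent (iter j T) x)
               <= c * lambda ^- j * tnorm G x v) /\
          ((v <= Eu x)%MS ->
             tnorm G (iter j (dinv T) x) (v *m tangent (iter j (dinv T)) x)
               <= c * lambda ^- j * tnorm G x v)].

Definition isolating (V : set M) : Prop :=
  K `<=` V° /\ K = \bigcap_(k in [set: int]) (ziter k @` V).

(* existence of a dense forward orbit; in particular K is nonempty *)
Definition transitive_on : Prop :=
  exists2 x, K x & K `<=` closure [set iter j T x | j in [set: nat]].

Definition hyperbolic_basic_set : Prop :=
  [/\ compact K, T @` K = K, hyperbolic, exists V, isolating V
    & transitive_on].

End BasicSets.

Section Entire.
Context {R : realType}.
Implicit Types (f : R[i] -> R[i]) (z w : R[i]).

Definition cexp z : R[i] :=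
  (expR (complex.Re z) * cos (complex.Im z))
    +i* (expR (complex.Re z) * sin (complex.Im z)).

(* the modulus, as an element of R: `|z| has type R[i] *)
Definition modulus z : R := complex.Re `|z|.

Definition entire f : Prop := forall z, derivable f z 1.

Definition lnplus (x : R) : R := ln (Num.max 1 x).

Definition entire_order f : \bar R :=
  limf_esup (fun r : R =>
      (lnplus (lnplus (sup [set modulus (f z) | z in [set z | modulus z <= r]]))
         / ln r)%:E)
    (pinfty_nbhs R).

(* f vanishes at w with multiplicity exactly k *)
Definition zero_mult f w (k : nat) : Prop :=
  exists h, [/\ entire h, h w != 0 & forall z, f z = (z - w) ^+ k * h z].

(* (zs m), for m in D, lists the zeros of f with multiplicity; D accounts for
   the case of finitely many zeros *)
Definition zeros_enum f (D : pred nat) (zs : nat -> R[i]) : Prop :=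
  forall w, exists2 k, zero_mult f w k &
                       [set m : nat | D m /\ zs m = w] #= `I_k.

Definition zeros_summable (D : pred nat) (zs : nat -> R[i]) (q : nat) : Prop :=
  (\sum_(0 <= m <oo | D m) (modulus (zs m) ^- q)%:E < +oo)%E.

Definition weierstrass_factor (p : nat) (u : R[i]) : R[i] :=
  (1 - u) * cexp (\sum_(1 <= k < p.+1) u ^+ k / k%:R).

(* [has_genus f None] stands for infinite genus.  The degree of Q is
   (size Q).-1, so that Q = 0 counts as degree 0. *)
Definition has_genus f (gamma : option nat) : Prop :=
  match gamma with
  | None => entire_order f = +oo%E
  | Some k =>
      [/\ (entire_order f < +oo)%E, f 0 != 0
        & exists (D : pred nat) (zs : nat -> R[i]) (p : nat) (Q : {poly R[i]}),
            [/\ zeros_enum f D zs,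
                zeros_summable D zs p.+1,
                forall q : nat, zeros_summable D zs q.+1 -> (p <= q)%N,
                forall z,
                  (fun N : nat => cexp Q.[z] *
                     \prod_(0 <= m < N | D m) weierstrass_factor p (z / zs m))
                    @ \oo --> f z
              & k = maxn (size Q).-1 p]]
  end.

End Entire.

Section Determinant.
Context {R : realType} {n : nat} {M : smoothManifold R n}.
Variables (T : diffeo M) (K : set M) (g : M -> R[i]).

(* The set of x in K with T^j x = x is finite when K is a hyperbolic basic set
   and j > 0, so the finitely supported sum below is the actual sum; likewise
   the determinants do not vanish. *)
Definition dyndet_coef (j : nat) : R[i] :=
  j%:R^-1 * \sum_(x \in [set x | K x /\ iter j T x = x])
    ((\prod_(0 <= k < j) g (iter k T x))
       / `|\det (1%:M - tangent (iter j T) x)|%:C).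

(* d is the entire extension of the function defined by the exponential formula,
   whose series converges near 0 *)
Definition dynamical_determinant (d : R[i] -> R[i]) : Prop :=
  entire d /\
  exists2 r : R, 0 < r & forall z, modulus z < r ->
    exists2 S : R[i],
      series (fun j => dyndet_coef j.+1 * z ^+ j.+1) @ \oo --> S
      & d z = cexp (- S).

End Determinant.

(* Main.v *)
(* The basic set is a linear Smale horseshoe K in the plane, conjugate to the
   full shift on two symbols, on which the diffeomorphism T has the constant
   derivative diag (9, 1/9); hence |det (I - D T^n)| = D_n does not depend on the
   periodic point, and 1 / D_n = (9^n - 1)^-1 (1 - 9^-n)^-1 is the sum of the
   q^n over the family of numbers q = 9^-(i+j+1), i, j >= 0.

   The weight is 1 on the sequences starting with 0 and c_k on those starting
   with 1 0^(k-1) 1.  It extends smoothly as soon as c_k decays faster than any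
   exponential, since the sequences with first gap k lie at distance about 9^-k
   of the code of 1 0 0 0 ...  Cutting periodic words at their 1's gives
     exp (- sum_n z^n/n sum_(T^n x = x) prod g)
       = (1 - z) (1 - sum_k c_k z^k),
   where 1 - sum_k c_k z^k can be any entire function with value 1 at 0; take it
   to be exp (sum_n D_n t_n z^n).  Division by D_n then yields
     d (z) = prod_(i, j) (1 - 9^-(i+j+1) z) * exp (sum_n t_n z^n).
   The product has order 0 and genus 0, so the exponent z^k (0 if k = 0) produces genus
   k, and the exponent e^(-z) - 1 produces infinite order. *)
From HB Require Import structures.
Require Import Defs.
From mathcomp Require Import all_boot all_order all_algebra.
From mathcomp Require Import all_classical all_reals all_analysis.
From mathcomp Require Import complex ring lra zify.

Set Implicit Arguments.
Unset Strict Implicit.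
Unset Printing Implicit Defensive.

Import Order.TTheory GRing.Theory Num.Theory.
Import numFieldNormedType.Exports.

Local Open Scope classical_set_scope.
Local Open Scope ring_scope.

(** * Smooth functions of one variable *)

(** The weight depends on the future alone, hence on the coordinate U alone, so that apart from a
    cutoff it is a smooth function of one real variable. Among the periodic sequences only the zero
    one contains no 1; its terms $z^n/(n D_n)$ alone produce the infinite product, while all the
    periodic points containing a 1 contribute together $-n D_n t_n$ in period n, that is, the factor
    $\exp(\sum_n t_n z^n)$. The obstacle is the size of $D_n$, about $9^n$: the numbers $D_n t_n$
    are exponentiated, and the resulting $c_k$ must still decay faster than any exponential.
    Newton's recursion shows that it is enough for $D_n t_n$ to do so, which holds for a finite
    exponent and for $e^{-z} - 1$. The base 9 puts the codes starting with 0 in [0, 1/8] and those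
    starting with 1 in [1, 9/8]. On the basic set U + V is then at most 1/4 or at least 1, away from
    the interval [1/2, 3/4] in which the step function varies, and two codes of different first gaps
    never meet the same rescaled bump. The final formula is entire by construction and is compared
    with the exponential series on $|z| < 1$. *)

Lemma is_derive_of_quadratic (K : numFieldType) (f : K -> K) (x l C : K) :
  0 < C -> (forall h, `|h| <= 1 -> `|f (x + h) - f x - l * h| <= C * `|h| ^+ 2) ->
  is_derive x 1 f l.
Proof.
move=> C0 H.
have cv : h^-1 *: (f (h *: 1 + x) - f x) @[h --> 0^'] --> l.
  apply/cvgrPdist_le => /= e e0.
  near=> h.
  have hn0 : h != 0 by near: h; exact: nbhs_dnbhs_neq.
  have h1 : `|h| <= 1 by near: h; apply: dnbhs0_le.
  have hC : `|h| <= e / C by near: h; apply: dnbhs0_le; rewrite divr_gt0.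
  have h0 : 0 < `|h| by rewrite normr_gt0.
  rewrite -(ler_pM2r h0) -normrM mulrBl.
  rewrite /GRing.scale /= mulr1 (addrC h) mulrAC mulVf // mul1r -normrN opprB.
  apply: (le_trans (H h h1)).
  by rewrite expr2 mulrA ler_pM2r // mulrC -ler_pdivlMr.
apply: DeriveDef; first by apply/cvg_ex; exists l.
exact: cvg_lim.
Unshelve. all: by end_near.
Qed.

Section SmoothOneVariable.
Variable R : realType.
Implicit Types (f g : R -> R) (x c : R) (k n : nat).

(** Derivatives are witnesses, so closure under an operation amounts to exhibiting a formula. The
    last derivative need not be continuous; results that use its continuity ask for one more order,
    as [Ck_comp] does. *)
Fixpoint diffn k f : Prop :=
  if k is k'.+1 then
    exists f', (forall x, is_derive x 1 f (f' x)) /\ diffn k' f'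
  else True.

Definition smooth1 f := forall k, diffn k f.

Lemma diffnW k f : diffn k.+1 f -> diffn k f.
Proof.
elim: k f => [//|k IH] f [f' [ff' f'k]].
by exists f'; split => //; exact: IH.
Qed.

Lemma diffn_cst k c : diffn k (cst c).
Proof.
elim: k c => [//|k IH] c; exists (cst 0); split => // x.
exact: is_derive_cst.
Qed.

Lemma diffnD k f g : diffn k f -> diffn k g -> diffn k (fun x => f x + g x).
Proof.
elim: k f g => [//|k IH] f g [f' [ff' f'k]] [g' [gg' g'k]].
exists (fun x => f' x + g' x); split; last exact: IH.
by move=> x; have := is_deriveD (ff' x) (gg' x).
Qed.

Lemma diffnM k f g : diffn k f -> diffn k g -> diffn k (fun x => f x * g x).
Proof.
elim: k f g => [//|k IH] f g /[dup] /diffnW fk [f' [ff' f'k]].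
move=> /[dup] /diffnW gk [g' [gg' g'k]].
exists (fun x => f x * g' x + g x * f' x); split.
  by move=> x; have := is_deriveM (ff' x) (gg' x).
by apply: diffnD; exact: IH.
Qed.

Lemma diffnZ k c f : diffn k f -> diffn k (fun x => c * f x).
Proof. by move=> fk; apply: diffnM => //; exact: diffn_cst. Qed.

Lemma diffnN k f : diffn k f -> diffn k (fun x => - f x).
Proof.
move=> fk; rewrite (_ : (fun x => - f x) = (fun x => -1 * f x)).
  exact: diffnZ.
by apply/funext => x; rewrite mulN1r.
Qed.

Lemma diffnB k f g : diffn k f -> diffn k g -> diffn k (fun x => f x - g x).
Proof. by move=> fk gk; apply: diffnD => //; exact: diffnN. Qed.

Lemma diffnV k f : (forall x, f x != 0) -> diffn k f ->
  diffn k (fun x => (f x)^-1).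
Proof.
move=> f0; elim: k => [//|k IH] /[dup] /diffnW fk [f' [ff' f'k]].
exists (fun x => - (f x)^-1 * (f x)^-1 * f' x); split.
  move=> x; apply: (is_derive_eq (is_deriveV (f0 x) (ff' x))).
  rewrite /GRing.scale /= expr2 invfM. by rewrite !mulNr.
by apply: diffnM => //; apply: diffnM; [apply: diffnN|]; exact: IH.
Qed.

Lemma diffn_affine k a c : diffn k (fun x => a * x + c).
Proof.
apply: diffnD; last exact: diffn_cst.
apply: diffnZ; case: k => [//|k]; exists (cst 1); split; last exact: diffn_cst.
by move=> x; exact: is_derive_id.
Qed.

Lemma diffn_comp k f g : diffn k f -> diffn k g -> diffn k (f \o g).
Proof.
elim: k f g => [//|k IH] f g [f' [ff' f'k]] /[dup] /diffnW gk [g' [gg' g'k]].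
exists (fun x => g' x * (f' \o g) x); split.
  by move=> x; apply: (is_derive_eq (is_derive1_comp (ff' (g x)) (gg' x))); rewrite /= mulrC.
by apply: diffnM => //; exact: IH.
Qed.

Lemma diffn_comp_affine k f a c : diffn k f -> diffn k (fun x => f (a * x + c)).
Proof. by move=> fk; apply: (diffn_comp fk); exact: diffn_affine. Qed.

Lemma is_derive_flat f x (C : R) : 0 < C ->
  (forall y, `|f y| <= C * (y - x) ^+ 2) -> is_derive x 1 f 0.
Proof.
move=> C0 H; apply: (@is_derive_of_quadratic _ _ _ _ C) => // h _.
have fx : f x = 0.
  by apply/eqP; rewrite -normr_le0; have := H x; rewrite subrr expr0n mulr0.
by rewrite fx mul0r !subr0 (le_trans (H _)) // addrAC subrr add0r real_normK ?num_real.
Qed.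

(** The classical flat function is the case n = 0; the powers $x^{-n}$ close the family under
    differentiation up to linear combinations, so one induction treats all orders. *)
Definition expinv n x : R := if 0 < x then x ^- n * expR (- x^-1) else 0.

(** The exponential series gives $e^{1/x} \ge x^{-(n+2)}/(n+2)!$: n of these powers cancel the pole
    and two remain, as [is_derive_flat] requires at 0. *)
Lemma expinv_le n x : `|expinv n x| <= n.+2`!%:R * x ^+ 2.
Proof.
rewrite /expinv; case: ifPn => [x0|_]; last first.
  by rewrite normr0 mulr_ge0 // sqr_ge0.
have xi0 : 0 < x^-1 by rewrite invr_gt0.
rewrite ger0_norm ?mulr_ge0 ?expR_ge0 ?invr_ge0 ?exprn_ge0 ?(ltW x0)//.
rewrite expRN ler_pdivrMr ?expR_gt0 //.
have /(_ n.+1) := @expR_ge1Dxn R _ _ (ltW xi0).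
set e := expR _ => He.
have : x^-1 ^+ n.+2 / n.+2`!%:R <= e by lra.
rewrite ler_pdivrMr ?ltr0n ?fact_gt0 // => {}He.
apply: (@le_trans _ _ (x ^+ 2 * (e * n.+2`!%:R))); last by rewrite mulrA mulrC mulrA.
apply: le_trans (ler_wpM2l _ He); last exact: sqr_ge0.
have xn0 : x != 0 by rewrite gt_eqF.
rewrite exprVn !(exprS x) expr0 le_eqVlt; apply/orP; left; apply/eqP.
by field; rewrite xn0 expf_neq0.
Qed.

Lemma is_derive_expinv n x :
  is_derive x 1 (expinv n) (expinv n.+2 x - n%:R * expinv n.+1 x).
Proof.
have [x0|x0|<-] := ltgtP 0 x.
- have xn0 : x != 0 by rewrite gt_eqF.
  apply: (@near_eq_is_derive R R R (fun y => y ^- n * expR (- y^-1)) (expinv n) x 1).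
    near=> y; rewrite /expinv ifT //.
    by near: y; exact: lt_nbhsr.
  rewrite /expinv x0.
  have dV := is_deriveV xn0 (is_derive_id x 1).
  have xnn0 : ((id : R -> R) ^+ n) x != 0 by rewrite exprfctE expf_neq0.
  have dX : is_derive x 1 (fun y : R => y ^- n) (- (x ^+ n) ^- 2 * (n%:R * x ^+ n.-1)).
    rewrite (_ : (fun y : R => y ^- n) = fun y => (((id : R -> R) ^+ n) y)^-1).
      apply: (is_derive_eq (is_deriveV (f := (id : R -> R) ^+ n) xnn0 (is_deriveX n (is_derive_id x 1)))).
      by rewrite /GRing.scale /= mulr1 exprfctE.
    by apply/funext => y; rewrite exprfctE.
  have dN : is_derive x 1 (fun y : R => - y^-1) (x ^- 2).
    by apply: (is_derive_eq (is_deriveN dV)); rewrite /GRing.scale /= mulr1 opprK.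
  have de := is_derive1_comp (g := fun y : R => - y^-1) (is_derive_expR (- x^-1)) dN.
  apply: (is_derive_eq (is_deriveM dX de)).
  rewrite /GRing.scale /=; case: n xnn0 {dX} => [|n] xnn0.
    by rewrite !mul0r subr0 !mulr0 addr0 expr0 invr1 mul1r mulrC.
  rewrite /= !exprS; field.
  by rewrite xn0 /= expf_neq0.
- have e0 m : expinv m x = 0 by rewrite /expinv ltNge (ltW x0).
  rewrite !e0 mulr0 subr0.
  apply: (@near_eq_is_derive R R R (cst 0) (expinv n) x 1).
  near=> y; rewrite /expinv ifF //; apply/negbTE; rewrite -leNgt.
  by near: y; exact: lt_le_nbhsl.
- have e0 m : expinv m 0 = 0 by rewrite /expinv ltxx.
  rewrite !e0 mulr0 subr0.
  apply: (@is_derive_flat _ _ n.+2`!%:R); first by rewrite ltr0n fact_gt0.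
  by move=> y; rewrite subr0; exact: expinv_le.
Unshelve. all: by end_near. Qed.

Lemma diffn_expinv k n : diffn k (expinv n).
Proof.
elim: k n => [//|k IH] n.
exists (fun x => expinv n.+2 x - n%:R * expinv n.+1 x); split.
  exact: is_derive_expinv.
by apply: diffnB => //; apply: diffnZ.
Qed.

(** The denominator is positive because the half-lines $x > 1/2$ and $x < 3/4$ cover the line. The
    window between them lies in the gap (1/4, 1) of the values of U + V on the basic set. *)
Definition smoothstep x : R :=
  expinv 0 (x - 2^-1) / (expinv 0 (x - 2^-1) + expinv 0 (3 / 4 - x)).

Let expinv0_ge0 x : 0 <= expinv 0 x.
Proof. by rewrite /expinv; case: ifP => // _; rewrite expr0 invr1 mul1r expR_ge0. Qed.

Let expinv0_gt0 x : 0 < x -> 0 < expinv 0 x.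
Proof. by rewrite /expinv => ->; rewrite expr0 invr1 mul1r expR_gt0. Qed.

Let smoothstep_den_gt0 x : 0 < expinv 0 (x - 2^-1) + expinv 0 (3 / 4 - x).
Proof.
have [x2|x2] := ltP 2^-1 x.
  by rewrite ltr_pwDl ?expinv0_gt0 // subr_gt0.
by rewrite ltr_wpDl ?expinv0_gt0 //; lra.
Qed.

Lemma smooth1_smoothstep : smooth1 smoothstep.
Proof.
move=> k; have affineE c : (fun x => expinv 0 (x - c)) = (fun x => expinv 0 (1 * x + (- c))).
  by apply/funext => x; rewrite mul1r.
have affineE' c : (fun x => expinv 0 (c - x)) = (fun x => expinv 0 (-1 * x + c)).
  by apply/funext => x; rewrite mulN1r addrC.
apply: diffnM.
  by rewrite affineE; apply: diffn_comp_affine; exact: diffn_expinv.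
apply: diffnV => [x|]; first by rewrite gt_eqF.
apply: diffnD.
  by rewrite affineE; apply: diffn_comp_affine; exact: diffn_expinv.
by rewrite affineE'; apply: diffn_comp_affine; exact: diffn_expinv.
Qed.

Lemma smoothstep0 x : x <= 2^-1 -> smoothstep x = 0.
Proof. by move=> x2; rewrite /smoothstep /expinv ltNge subr_le0 x2 /= mul0r. Qed.

Lemma smoothstep1 x : 3 / 4 <= x -> smoothstep x = 1.
Proof.
move=> x2; have := smoothstep_den_gt0 x; rewrite /smoothstep.
have -> : expinv 0 (3 / 4 - x) = 0 by rewrite /expinv ltNge subr_le0 x2.
by rewrite addr0 => ?; rewrite divff // gt_eqF.
Qed.

Lemma diffn_continuous k f : diffn k.+1 f -> continuous f.
Proof.
move=> [f' [ff' _]] x.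
by apply: differentiable_continuous; apply/derivable1_diffP; have [] := ff' x.
Qed.

Lemma diffn_bounded_itv k f (a b : R) : diffn k.+1 f ->
  exists2 C, 0 < C & forall x, a <= x <= b -> `|f x| <= C.
Proof.
move=> /diffn_continuous cf; have [ab|ba] := leP a b; last first.
  by exists 1 => // x /andP[/le_trans /[apply]]; rewrite leNgt ba.
have [c _ Hc] := @EVT_max R (fun x => `|f x|) a b ab
  (continuous_subspaceT (fun x => cvg_norm (cf x))).
exists (`|f c| + 1); first by rewrite ltr_wpDl.
by move=> x xab; rewrite (le_trans (Hc x _)) ?lerDl.
Qed.

End SmoothOneVariable.

(** * Smooth functions on R^n and flat series *)

Section SmoothSeveralVariables.
Variable R : realType.

Lemma mx_continuous (T : topologicalType) m n (f : T -> 'M[R]_(m, n)) :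
  (forall i j, continuous (fun x => f x i j)) -> continuous f.
Proof.
move=> cf x; apply/cvgrPdist_lt => e e0.
have : \forall t \near x, forall i j, `|f x i j - f t i j| < e.
  apply: filter_forall => i; apply: filter_forall => j.
  by move/cvgrPdist_lt : (cf i j x); apply.
apply: filterS => t ft; rewrite -[`|_|]/(mx_norm _) mx_normrE.
by apply: bigmax_lt => //= -[i j] _ /=; rewrite !mxE.
Qed.

(** Global counterpart of [Ck_on] with derivatives as witnesses: the maps and weights built below
    are smooth on the whole plane, so no open set has to be tracked. *)
Fixpoint Ck {n} {V : normedModType R} k (f : 'rV[R]_n -> V) : Prop :=
  continuous f /\
  if k is k'.+1 then
    forall v, exists f', (forall x, is_derive x v f (f' x)) /\ Ck k' f'
  else True.

Lemma CkW n (V : normedModType R) k (f : 'rV[R]_n -> V) : Ck k.+1 f -> Ck k f.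
Proof.
elim: k f => [|k IH] f [cf Hf]; first by split.
by split=> // v; have [f' [ff' f'k]] := Hf v; exists f'; split => //; exact: IH.
Qed.

Lemma Ck_continuous n (V : normedModType R) k (f : 'rV[R]_n -> V) :
  Ck k f -> continuous f.
Proof. by case: k => [|k] []. Qed.

Lemma Ck_smooth_on n (V : normedModType R) (U : set 'rV[R]_n)
    (f : 'rV[R]_n -> V) : (forall k, Ck k f) -> smooth_on U f.
Proof.
move=> fk k; move: {fk}(fk k); elim: k f => [|k IH] f [cf Hf].
  by split=> // x _; exact: cf.
split=> [x _|v]; first exact: cf.
have [f' [ff' f'k]] := Hf v; split => [x _|]; first by have [] := ff' x.
rewrite (_ : (fun x => 'D_v f x) = f'); first exact: IH.
by apply/funext => x; have [] := ff' x.
Qed.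

Lemma Ck_cst n (V : normedModType R) k (c : V) : Ck k (cst c : 'rV[R]_n -> V).
Proof.
elim: k c => [|k IH] c; split => //; try exact: cst_continuous.
by move=> v; exists (cst 0); split => // x; exact: is_derive_cst.
Qed.

Lemma CkD n k (f g : 'rV[R]_n -> R) : Ck k f -> Ck k g ->
  Ck k (fun x => f x + g x).
Proof.
elim: k f g => [|k IH] f g [cf Hf] [cg Hg].
  by split => // x; apply: continuousD; [exact: cf|exact: cg].
split=> [x|v]; first by apply: continuousD; [exact: cf|exact: cg].
have [f' [ff' f'k]] := Hf v; have [g' [gg' g'k]] := Hg v.
exists (fun x => f' x + g' x); split; last exact: IH.
by move=> x; have := is_deriveD (ff' x) (gg' x).
Qed.

Lemma CkM n k (f g : 'rV[R]_n -> R) : Ck k f -> Ck k g ->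
  Ck k (fun x => f x * g x).
Proof.
elim: k f g => [|k IH] f g /[dup] fk [cf Hf] /[dup] gk [cg Hg].
  by split => // x; apply: continuousM; [exact: cf|exact: cg].
split=> [x|v]; first by apply: continuousM; [exact: cf|exact: cg].
have [f' [ff' f'k]] := Hf v; have [g' [gg' g'k]] := Hg v.
exists (fun x => f x * g' x + g x * f' x); split.
  by move=> x; have := is_deriveM (ff' x) (gg' x).
by apply: CkD; apply: IH => //; exact: CkW.
Qed.

Lemma CkZ n k c (f : 'rV[R]_n -> R) : Ck k f -> Ck k (fun x => c * f x).
Proof. by move=> fk; apply: CkM => //; exact: Ck_cst. Qed.

Lemma CkB n k (f g : 'rV[R]_n -> R) : Ck k f -> Ck k g ->
  Ck k (fun x => f x - g x).
Proof.
move=> fk gk; rewrite (_ : (fun x => _) = (fun x => f x + -1 * g x)).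
  by apply: CkD => //; exact: CkZ.
by apply/funext => x; rewrite mulN1r.
Qed.

Lemma Ck_coord n k i j : Ck k (fun x : 'rV[R]_n => x i j).
Proof.
case: k => [|k]; split => //; try exact: coord_continuous.
move=> v; exists (cst (v i j)); split; last exact: Ck_cst.
move=> x; have dx : derivable id x v by exact: derivable_id.
split; first by move/derivable_mxP : dx => /(_ i j).
by have /matrixP/(_ i j) := derive_mx dx; rewrite derive_id mxE => /= ->.
Qed.

(** Reduces directional derivatives to one variable, where the chain rule needed by [Ck_comp]
    applies. *)
Lemma is_derive_line n (V : normedModType R) (f : 'rV[R]_n -> V) x v l :
  is_derive (0 : R) 1 (fun h => f (h *: v + x)) l <-> is_derive x v f l.
Proof.
have E : 'D_1 (fun h : R => f (h *: v + x)) 0 = 'D_v f x.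
  rewrite /derive; set g1 := fun h => h^-1 *: _; set g2 := fun h => h^-1 *: _.
  suff -> : g1 = g2 by [].
  by apply/funext => h; rewrite /g1 /g2 /= addr0 scale0r add0r [_%:A]mulr1.
split=> -[df fl]; split.
- exact/derivable1P.
- by rewrite -E.
- exact/(derivable1P f x v).
- by rewrite E.
Qed.

Lemma Ck_comp n k (f : R -> R) (s : 'rV[R]_n -> R) :
  diffn k.+1 f -> Ck k s -> Ck k (f \o s).
Proof.
elim: k f s => [|k IH] f s fk /[dup] sk [cs Hs].
  split => // x; apply: continuous_comp; first exact: cs.
  exact: diffn_continuous fk _.
split=> [x|v].
  apply: continuous_comp; first exact: cs.
  exact: diffn_continuous fk _.
move: fk => [f' [ff' f'k]]; have [s' [ss' s'k]] := Hs v.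
exists (fun x => (f' \o s) x * s' x); split; last first.
  by apply: CkM => //; apply: IH => //; exact: CkW.
move=> x; apply/is_derive_line.
have /is_derive_line ss'x := ss' x.
have ffx : is_derive (s (0 *: v + x)) 1 f (f' (s x)) by rewrite scale0r add0r.
exact: is_derive1_comp ffx ss'x.
Qed.

Lemma Ck_mx n m k (f : 'rV[R]_n -> 'rV[R]_m) :
  (forall j, Ck k (fun x => f x 0 j)) -> Ck k f.
Proof.
elim: k f => [|k IH] f fk.
  by split => //; apply: mx_continuous => i j; rewrite ord1; have [] := fk j.
split; first by apply: mx_continuous => i j; rewrite ord1; have [] := fk j.
move=> v.
exists (fun x => \row_j 'D_v (fun y => f y 0 j) x); split; last first.
  apply: IH => j; have [_ /(_ v)[f' [ff' f'k]]] := fk j.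
  rewrite (_ : (fun x => _) = f') //.
  by apply/funext => x; rewrite mxE; have [] := ff' x.
move=> x; have df : derivable f x v.
  apply/derivable_mxP => i j; rewrite ord1.
  by have [_ /(_ v)[f' [/(_ x)[] ]]] := fk j.
split => //; rewrite (derive_mx df); apply/matrixP => i j.
by rewrite !mxE ord1.
Qed.

End SmoothSeveralVariables.

(** * Series of rescaled bumps, flat at the origin *)

Section FlatSeries.
Variable R : realType.
Implicit Types (h : nat -> R) (b : R -> R) (t : R).

(** Stable under multiplication by $9^k$, the factor that each differentiation of [b (9 ^+ k * t)]
    produces. *)
Definition flat_seq h := forall m, exists C, forall k, `|h k| * 9 ^+ (m * k) <= C.

Definition bump_support b := forall y, y < 2^-1 \/ 2 < y -> b y = 0.

(* At each [t] only finitely many terms are nonzero. *)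
Definition flat_series h b t : R := limn (series (fun k => h k * b (9 ^+ k * t))).

Lemma flat_series_le0 h b t : bump_support b -> t <= 0 -> flat_series h b t = 0.
Proof.
move=> bb t0; rewrite /flat_series (_ : series _ = cst 0) ?lim_cst //.
apply/funext => n; rewrite /series /= big1 // => k _.
rewrite bb ?mulr0 //; left; apply: (@le_lt_trans _ _ 0); last by rewrite invr_gt0.
by rewrite mulr_ge0_le0 // exprn_ge0.
Qed.

(** The condition $2 < 9^N t$ is open in t, so one finite sum represents the series on a whole
    neighbourhood, which is what differentiation at t > 0 uses. *)
Lemma flat_seriesE h b N t : bump_support b -> 2 < 9 ^+ N * t ->
  flat_series h b t = \sum_(0 <= k < N) h k * b (9 ^+ k * t).
Proof.
move=> bb Nt; have t0 : 0 < t.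
  by rewrite -(pmulr_rgt0 _ (exprn_gt0 N (ltr0n _ 9))); apply: lt_trans Nt.
rewrite /flat_series; apply: lim_near_cst; first exact: norm_hausdorff.
near=> n; have Nn : (N <= n)%N by near: n; exists N.
rewrite /series /= (big_cat_nat _ Nn) //= [X in _ + X]big_nat_cond [X in _ + X]big1 ?addr0 //.
move=> k /andP[/andP[Nk _] _]; rewrite bb ?mulr0 //; right.
apply: (lt_le_trans Nt); rewrite ler_pM2r //.
by rewrite ler_weXn2l // ler1n.
Unshelve. all: by end_near. Qed.

Let pow_large t : 0 < t -> exists N, 2 < 9 ^+ N * t.
Proof.
move=> t0; pose N := Num.truncn (2 / t); exists N.+1.
rewrite -ltr_pdivrMr //; apply: (lt_trans (truncnS_gt _)).
rewrite -natrX ltr_nat -/N; exact: ltn_expl.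
Qed.

(** A nonzero term has $9^k t \ge 1/2$, hence $1 \le 4 (9^k t)^2$. The bound $|h_k| \le C_0 9^{-3k}$
    pays two powers for this square and keeps one, $9^{-k}$, for summability. *)
Lemma flat_series_bound h b : flat_seq h -> bump_support b ->
  (exists2 B, 0 < B & forall y, 2^-1 <= y <= 2 -> `|b y| <= B) ->
  exists2 C, 0 < C & forall t, `|flat_series h b t| <= C * t ^+ 2.
Proof.
move=> /(_ 3) [C0 HC] bb [B B0 HB].
have C00 : 0 <= C0 by apply: le_trans (HC 0%N); rewrite mulr_ge0 // exprn_ge0.
exists (8 * (C0 + 1) * B); first by rewrite !mulr_gt0 // ltr_wpDl.
move=> t; have [t0|t0] := leP t 0.
  by rewrite flat_series_le0 // normr0 mulr_ge0 ?sqr_ge0 // mulr_ge0 ?(ltW B0) //; lra.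
have [N Nt] := pow_large t0.
rewrite (flat_seriesE _ bb Nt).
have q0 : 0 <= (9^-1 : R) by rewrite invr_ge0.
have P0 : 0 <= 4 * (C0 + 1) * B * t ^+ 2.
  by apply: mulr_ge0 (sqr_ge0 _); apply: mulr_ge0 (ltW B0); lra.
have term k : `|h k * b (9 ^+ k * t)| <= 4 * (C0 + 1) * B * t ^+ 2 * 9^-1 ^+ k.
  have [kt|] := boolP (2^-1 <= 9 ^+ k * t <= 2); last first.
    move=> kt; rewrite bb ?mulr0 ?normr0; last first.
      by move: kt; rewrite negb_and -!ltNge => /orP.
    by rewrite mulr_ge0 ?exprn_ge0.
  have /andP[kt1 _] := kt.
  have k0 : 0 < 9 ^+ k :> R by rewrite exprn_gt0.
  have kt0 : 0 <= 9 ^+ k * t by rewrite mulr_ge0 // ltW.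
  have sq : 1 <= 4 * (9 ^+ k * t) ^+ 2.
    have : 2^-1 ^+ 2 <= (9 ^+ k * t) ^+ 2 :> R by rewrite ler_sqr ?nnegrE ?invr_ge0.
    lra.
  rewrite normrM; apply: (le_trans (ler_pM _ _ (lexx _) (HB _ kt))) => //.
  have hk : `|h k| * 9 ^+ k ^+ 3 <= C0 by rewrite -exprM mulnC; exact: HC.
  set H := `|h k| in hk *; have H0 : 0 <= H := normr_ge0 _.
  rewrite exprVn; set Q := 9 ^+ k in k0 sq hk *.
  rewrite ler_pdivlMr //.
  apply: (@le_trans _ _ (H * B * Q * (4 * (Q * t) ^+ 2))).
    rewrite ler_peMr //; apply: mulr_ge0; last exact: ltW.
    by apply: mulr_ge0 => //; exact: ltW.
  rewrite (_ : _ * _ = (H * Q ^+ 3) * (4 * B * t ^+ 2)); last ring.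
  rewrite [X in _ <= X](_ : _ = (C0 + 1) * (4 * B * t ^+ 2)); last ring.
  apply: ler_wpM2r; last by rewrite (le_trans hk) // lerDl.
  by apply: mulr_ge0 (sqr_ge0 _); apply: mulr_ge0 (ltW B0).
apply: (le_trans (ler_norm_sum _ _ _)).
apply: (le_trans (ler_sum _ (fun k _ => term k))).
rewrite -mulr_sumr.
apply: (@le_trans _ _ (4 * (C0 + 1) * B * t ^+ 2 * 2)); last by lra.
rewrite ler_wpM2l //.
have : \sum_(0 <= k < N) 9^-1 ^+ k * (1 - 9^-1) = 1 - 9^-1 ^+ N :> R.
  elim: N {Nt} => [|N IH]; first by rewrite big_nil expr0 subrr.
  by rewrite big_nat_recr //= IH exprS; ring.
rewrite -mulr_suml; set S := \sum_(_ <= _ < _) _ => HS.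
have : 0 <= 9^-1 ^+ N :> R by rewrite exprn_ge0.
lra.
Qed.

(** Termwise differentiation gives a series of the same kind, with [9 ^+ k * h k] and [b']. Only t =
    0, where the bumps accumulate, needs the quadratic bound. *)
Lemma diffn_flat_series k h b : flat_seq h -> bump_support b ->
  diffn k.+1 b -> diffn k (flat_series h b).
Proof.
elim: k h b => [//|k IH] h b hh bb bk.
have [B B0 HB] := diffn_bounded_itv 2^-1 2 bk.
have [C C0 HC] := flat_series_bound hh bb (ex_intro2 _ _ B B0 HB).
move: bk => [b' [bb' b'k]].
have b'b : bump_support b'.
  move=> y yb; have [_ <-] := bb' y.
  rewrite (@near_eq_derive R R R b (cst 0)) ?derive_cst //.
  case: yb => yb; near=> z; apply: bb.
    by left; near: z; exact: lt_nbhsl.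
  by right; near: z; exact: lt_nbhsr.
have h'h : flat_seq (fun k => 9 ^+ k * h k).
  move=> m; have [D HD] := hh m.+1; exists D => j.
  apply: le_trans (HD j); rewrite normrM ger0_norm ?exprn_ge0 //.
  by rewrite mulSn exprD mulrCA mulrA.
exists (flat_series (fun k => 9 ^+ k * h k) b'); split; last exact: IH.
move=> t; have [t0|t0|->] := ltgtP t 0.
- rewrite flat_series_le0 //; last exact: ltW.
  apply: (@near_eq_is_derive R R R (cst 0)).
  near=> y; rewrite flat_series_le0 //.
  by near: y; exact: lt_le_nbhsl.
- have [N Nt] := pow_large t0; rewrite (flat_seriesE _ b'b Nt).
  have N0 : 0 < 9 ^+ N :> R by rewrite exprn_gt0.
  apply: (@near_eq_is_derive R R R
      (fun y => \sum_(0 <= k < N) h k * b (9 ^+ k * y))).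
    near=> y; rewrite (@flat_seriesE h b N) //.
    rewrite -ltr_pdivrMl //; near: y; apply: lt_nbhsr.
    by rewrite ltr_pdivrMl.
  elim: N {Nt N0} => [|N IHN].
    rewrite big_nil (_ : (fun y => _) = cst 0); first exact: is_derive_cst.
    by apply/funext => y; rewrite big_nil.
  rewrite (_ : (fun y => _) = fun y =>
    \sum_(0 <= k < N) h k * b (9 ^+ k * y) + h N * b (9 ^+ N * y)); last first.
    by apply/funext => y; rewrite big_nat_recr.
  rewrite big_nat_recr //=; apply: (is_deriveD IHN).
  have dl : is_derive t 1 (fun y => 9 ^+ N * y) (9 ^+ N).
    apply: (is_derive_eq (is_deriveZ (9 ^+ N) (is_derive_id t 1))).
    by rewrite /GRing.scale /= mulr1.
  have := is_derive1_comp (bb' (9 ^+ N * t)) dl => /(is_deriveZ (h N)) H.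
  apply: (is_derive_eq H); rewrite /GRing.scale /=; ring.
- rewrite flat_series_le0 //; apply: (is_derive_flat C0) => y.
  by rewrite subr0.
Unshelve. all: by end_near. Qed.

End FlatSeries.

(** * Newton's recursion and cyclic words *)

Section NewtonRecursion.
Variables (R : realType) (p : nat -> R).

(** Equivalently, $\sum_n u_n z^n$ has infinite radius of convergence. *)
Definition superexp (u : nat -> R) := forall m, exists C, forall n, `|u n| * m%:R ^+ n <= C.

Let step (n : nat) (c : nat -> R) : R :=
  - p n + n%:R^-1 * \sum_(j < n.-1) c j.+1 * ((n.-1 - j)%:R * p (n.-1 - j)%N).

(** Course-of-values recursion: [approx n] carries the values of index below n and is 0 beyond. *)
Let approx := fix approx n : nat -> R := if n is n'.+1 then
  fun m => if m == n' then step n' (approx n') else approx n' m else fun=> 0.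

Let approx_stable n m : (m < n)%N -> approx n m = approx m.+1 m.
Proof.
elim: n => [//|n IH]; rewrite ltnS leq_eqVlt => /orP[/eqP -> //|mn] /=.
by rewrite (ltn_eqF mn) IH //= eqxx.
Qed.

(* The coefficients of [1 - exp (\sum_n p_n z^n)], by logarithmic
   differentiation. *)
Definition newton_coef n : R := approx n.+1 n.

(** With $P = \sum_{n \ge 1} p_n z^n$ and $F = 1 - e^P$, this is the coefficient of $z^n$ in $F' =
    -P' + P' F$. *)
Lemma newton_coefE n : n.+1%:R * newton_coef n.+1 = - (n.+1%:R * p n.+1) +
  \sum_(j < n) newton_coef j.+1 * ((n - j)%:R * p (n - j)%N).
Proof.
have E : newton_coef n.+1 = step n.+1 (approx n.+1) by rewrite /newton_coef /= eqxx.
rewrite E /step mulrDr mulrN mulVKf ?pnatr_eq0 // succnK.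
congr (_ + _); apply: eq_bigr => j _; congr (_ * _).
by rewrite approx_stable ?ltnS.
Qed.

(** Put $\rho = 2m$, $a_n = |c_{n+1}| \rho^{n+1}$ and $s_n = 1 + \sum_{j<n} a_j$. The recursion
    gives $(n+1) a_n \le M s_n$, so $s_n$ at most doubles once $n \ge M$. Hence $a_n = O(2^n)$, and
    the factor 2 in $\rho$ cancels this growth. *)
Lemma superexp_newton_coef : superexp p -> superexp newton_coef.
Proof.
move=> sp m.
have [M [M1 HM]] : exists M, 1 <= M /\
    forall n, n%:R * `|p n| * (2 * m)%:R ^+ n <= M.
  (* The ratio $2^n$ between the powers of 4m and of 2m absorbs the factor n. *)
  have [C HC] := sp (4 * m)%N; exists (Num.max 1 C); split; first by rewrite le_max lexx.
  move=> n; rewrite le_max; apply/orP; right; apply: le_trans (HC n).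
  rewrite mulrC [leRHS]mulrC mulrA ler_wpM2r // mulrC -natrX -natrM -natrX ler_nat.
  rewrite (_ : (4 * m = 2 * (2 * m))%N); last by rewrite mulnA.
  rewrite (expnMn 2 (2 * m)%N) leq_mul2r; apply/orP; right; exact/ltnW/ltn_expl.
set rho : R := (2 * m)%:R in HM.
have rho0 : 0 <= rho by [].
pose a n := `|newton_coef n.+1| * rho ^+ n.+1.
pose s n := 1 + \sum_(j < n) a j.
have a0 n : 0 <= a n by rewrite mulr_ge0 // exprn_ge0.
have s1 n : 1 <= s n by rewrite lerDl sumr_ge0.
have M0 : 0 <= M by lra.
have as_ n : n.+1%:R * a n <= M * s n.
  rewrite /a mulrA -{1}(ger0_norm (ler0n R n.+1)) -normrM newton_coefE.
  apply: (@le_trans _ _ ((`|n.+1%:R * p n.+1| +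
     \sum_(j < n) `|newton_coef j.+1| * ((n - j)%:R * `|p (n - j)%N|)) * rho ^+ n.+1)).
    rewrite ler_wpM2r ?exprn_ge0 // (le_trans (ler_normD _ _)) // normrN lerD2l.
    rewrite (le_trans (ler_norm_sum _ _ _)) // ler_sum // => j _.
    by rewrite !normrM normr_nat.
  rewrite mulrDl /s mulrDr mulr1 lerD //.
    by rewrite normrM normr_nat; exact: HM.
  rewrite mulr_suml mulr_sumr ler_sum // => j _.
  rewrite (_ : n.+1 = j.+1 + (n - j))%N; last by rewrite addSn subnKC // ltnW.
  rewrite exprD (_ : _ * _ = a j * ((n - j)%:R * `|p (n - j)%N| * rho ^+ (n - j))); last first.
    by rewrite /a; ring.
  by rewrite [leRHS]mulrC ler_wpM2l.
have sS n : s n.+1 = s n + a n by rewrite /s big_ord_recr addrA.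
have sM n : s n.+1 <= (1 + M) * s n.
  rewrite sS mulrDl mul1r lerD2l; apply: le_trans (as_ n).
  by rewrite ler_peMl // ler1n.
pose N := (Num.truncn M).+1.
have MN : M <= N%:R by exact/ltW/truncnS_gt.
have s2 n : (N <= n)%N -> s n.+1 <= 2 * s n.
  move=> Nn; rewrite sS mulrDl mul1r lerD2l -(ler_pM2l (ltr0Sn R n)).
  apply: (le_trans (as_ n)); rewrite ler_wpM2r //; first by rewrite (le_trans _ (s1 n)).
  by rewrite (le_trans MN) // ler_nat leqW.
have s_le n : s n <= (1 + M) ^+ n.
  elim: n => [|n IH]; first by rewrite /s big_ord0 addr0 expr0.
  by rewrite (le_trans (sM n)) // exprS ler_wpM2l // addr_ge0.
have B0 n : 0 <= (1 + M) ^+ n by rewrite exprn_ge0 // addr_ge0.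
have sB n : s n <= (1 + M) ^+ N * 2 ^+ n.
  have [nN|/ltnW Nn] := leqP n N.
    apply: (le_trans (s_le n)).
    apply: (le_trans (ler_weXn2l _ nN)); first by rewrite lerDl.
    by rewrite ler_peMr // exprn_ege1 // ler1n.
  rewrite -(subnKC Nn); elim: (n - N)%N => [|k IH].
    rewrite addn0; apply: (le_trans (s_le N)).
    by rewrite ler_peMr // exprn_ege1 // ler1n.
  rewrite addnS (le_trans (s2 _ (leq_addr _ _))) // exprS mulrCA ler_wpM2l //.
exists (Num.max `|newton_coef 0| (2 * (1 + M) ^+ N)) => -[|n].
  by rewrite expr0 mulr1 le_max lexx.
rewrite le_max; apply/orP; right.
have : a n <= 2 * (1 + M) ^+ N * 2 ^+ n.+1.
  apply: (@le_trans _ _ (s n.+1)); first by rewrite sS lerDr (le_trans _ (s1 n)).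
  rewrite (le_trans (sB _)) // -mulrA ler_peMl // ?mulr_ge0 ?exprn_ge0 ?addr_ge0 //.
  by rewrite ler1n.
by rewrite /a /rho natrM exprMn mulrCA [leRHS]mulrC ler_pM2l // exprn_gt0.
Qed.

End NewtonRecursion.

(** * Weights of cyclic binary words *)

Section CyclicWords.
Variables (R : realType) (c : nat -> R).
Implicit Types (w : seq bool) (d e m n : nat).

(* distance from the start of [w] to the next symbol 1, when the first 1 after
   the end of [w] is at distance [d] *)
Definition gap w d := if true \in w then index true w else (size w + d)%N.

(** Each 1 is weighted by its distance to the next 1, where w is followed by $0^d 1$. Closing w
    cyclically means taking d to be the index of its own first 1. *)
Fixpoint word_weight w d : R :=
  if w is b :: w' then (if b then c (gap w' d).+1 else 1) * word_weight w' d
  else 1.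

Fixpoint words n : seq (seq bool) :=
  if n is n'.+1 then map (cons false) (words n') ++ map (cons true) (words n')
  else [:: [::]].

Lemma mem_words n w : (w \in words n) = (size w == n).
Proof.
elim: n w => [|n IH] [|b w] //=.
  by rewrite mem_cat; apply/negP => /orP[] /mapP[].
rewrite mem_cat eqSS -IH; case: b.
  rewrite [X in X || _](_ : _ = false) /=.
    by rewrite mem_map // => ? ? [].
  by apply/negP => /mapP[].
rewrite [X in _ || X](_ : _ = false) ?orbF.
  by rewrite mem_map // => ? ? [].
by apply/negP => /mapP[].
Qed.

Lemma uniq_words n : uniq (words n).
Proof.
elim: n => [//|n IH] /=; rewrite cat_uniq !map_inj_uniq ?IH /= ?andbT; last 2 first.
- by move=> ? ? [].
- by move=> ? ? [].
by apply/hasPn => _ /mapP[w _ ->]; apply/negP => /mapP[].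
Qed.

(** Total weight of the words $1 0^e w$ with w of length m, followed by $0^d 1$: the argument of c
    is the gap of the leading 1. *)
Let open_sum e d m := \sum_(w <- words m) c (e + gap w d).+1 * word_weight w d.

Let open_sumS e d m :
  open_sum e d m.+1 = open_sum e.+1 d m + c e.+1 * open_sum 0 d m.
Proof.
rewrite /open_sum /= big_cat !big_map mulr_sumr; congr (_ + _); apply: eq_bigr => w _ /=.
  rewrite mul1r (_ : (e + gap (false :: w) d) = e.+1 + gap w d)%N //.
  by rewrite /gap in_cons /=; case: ifP => _ /=; lia.
by rewrite /gap in_cons /= addn0.
Qed.

(** Split according to the position j of the first 1 of w; the isolated term is $w = 0^m$. *)
Let open_sumE e d m : open_sum e d m = c (e + m + d).+1 +
  \sum_(j < m) c (e + j).+1 * open_sum 0 d (m.-1 - j).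
Proof.
elim: m e => [|m IH] e.
  by rewrite big_ord0 addr0 /open_sum /= big_seq1 /= mulr1 addn0.
rewrite open_sumS IH big_ord_recl /= addn0 subn0 addSnnS -addrA; congr (_ + _).
rewrite addrC; congr (_ + _); apply: eq_bigr => j _.
rewrite addSnnS /bump /= add1n; congr (_ * open_sum _ _ _).
by have := ltn_ord j; lia.
Qed.

(** Cyclic weight of the words $0^e w$: the leading zeros only delay the first 1. The parameter e
    makes induction on the first letter possible. *)
Let cyclic_sum e n := \sum_(w <- words n) word_weight w (e + index true w)%N.

(** Cut the circle at the first 1 of w, in position i: a free word of length n - 1 - i follows, then
    e + i zeros before the same 1 returns. The term 1 is the zero word. *)
Let cyclic_sumE e n :
  cyclic_sum e n = 1 + \sum_(i < n) open_sum 0 (e + i) (n.-1 - i).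
Proof.
elim: n e => [|n IH] e; first by rewrite big_ord0 addr0 /cyclic_sum /= big_seq1.
rewrite /cyclic_sum /= big_cat !big_map /=.
rewrite [X in X + _](_ : _ = cyclic_sum e.+1 n); last first.
  by apply: eq_bigr => w _; rewrite mul1r addSnnS.
rewrite IH big_ord_recl /= addn0 subn0 -addrA; congr (_ + _).
rewrite addrC; congr (_ + _).
apply: eq_bigr => i _; rewrite /bump /= add1n addSnnS; congr (open_sum _ _ _).
by have := ltn_ord i; lia.
Qed.

(** After cutting at the first 1, look at the block it opens. If it fills the circle, the n + 1
    rotations of $1 0^n$ give the first term; otherwise deleting the block, of length j + 1, leaves
    a shorter cyclic word containing a 1. In terms of generating functions, $Y = z C'/(1 - C)$. *)
Lemma cyclic_sum_rec n :
  let Y k := \sum_(w <- words k) word_weight w (index true w) - 1 in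
  Y n.+1 = n.+1%:R * c n.+1 + \sum_(j < n) c j.+1 * Y (n - j)%N.
Proof.
move=> Y; have YE k : Y k = \sum_(i < k) open_sum 0 i (k.-1 - i).
  rewrite /Y [X in X - 1](_ : _ = cyclic_sum 0 k) // cyclic_sumE addrAC subrr add0r.
  by [].
rewrite YE.
under eq_bigr => i _ do rewrite open_sumE add0n.
rewrite big_split /= (eq_bigr (fun=> c n.+1)); last first.
  by move=> i _; rewrite subnK // -ltnS.
rewrite sumr_const card_ord mulr_natl; congr (_ + _).
rewrite big_ord_recr /= subnn big_ord0 addr0.
under eq_bigr => i _.
  rewrite (big_ord_widen n (fun j => c (0 + j).+1 * open_sum 0 i ((n - i).-1 - j))) ?leq_subr //.
  over.
rewrite /= (exchange_big_dep xpredT) //=; apply: eq_bigr => j _.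
rewrite YE mulr_sumr (big_ord_widen_cond n xpredT
  (fun i => c j.+1 * open_sum 0 i ((n - j).-1 - i))) ?leq_subr //=.
apply: eq_big => i; first by rewrite !ltn_subRL addnC.
move=> _; congr (_ * open_sum _ _ _).
lia.
Qed.

End CyclicWords.

(** Since $1 - C = e^P$, the series $z C'/(1 - C)$ is $-z P'$; the proof makes the sums of the two
    recursions cancel term by term. The summand 1 is the zero word. *)
Lemma cyclic_sum_newton (R : realType) (p : nat -> R) n :
  \sum_(w <- words n.+1) word_weight (newton_coef p) w (index true w) =
    1 - n.+1%:R * p n.+1.
Proof.
pose Y k := \sum_(w <- words k) word_weight (newton_coef p) w (index true w) - 1.
suff YE k : Y k.+1 = - (k.+1%:R * p k.+1) by rewrite -YE /Y addrC subrK.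
elim/ltn_ind: k => k IH; rewrite /Y cyclic_sum_rec newton_coefE -/Y -addrA.
rewrite -big_split /= big1 ?addr0 // => j _.
rewrite -mulrDr -[X in _ * (_ + X)]/(Y (k - j)%N).
have -> : (k - j = (k - j.+1).+1)%N by have := ltn_ord j; lia.
by rewrite IH ?addrN ?mulr0 //; have := ltn_ord j; lia.
Qed.

(** * Complex analysis *)

Section Modulus.
Variable R : realType.
Implicit Types (z w : R[i]) (u v : nat -> R[i]).

Lemma modulusE z : `|z| = (modulus z)%:C%C.
Proof. by rewrite /modulus normc_def. Qed.

Lemma modulus_ge0 z : 0 <= modulus z.
Proof. by rewrite -ler0c -modulusE normr_ge0. Qed.

Lemma modulus_eq0 z : (modulus z == 0) = (z == 0).
Proof. by rewrite -[z == 0]normr_eq0 modulusE -(inj_eq (@complexI R)). Qed.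

Lemma modulusM z w : modulus (z * w) = modulus z * modulus w.
Proof. by apply: complexI; rewrite rmorphM /= -!modulusE normrM. Qed.

Lemma modulusX z n : modulus (z ^+ n) = modulus z ^+ n.
Proof. by apply: complexI; rewrite rmorphXn /= -!modulusE normrX. Qed.

Lemma modulusN z : modulus (- z) = modulus z.
Proof. by rewrite /modulus normrN. Qed.

Lemma modulusV z : modulus z^-1 = (modulus z)^-1.
Proof. by apply: complexI; rewrite fmorphV /= -!modulusE normfV. Qed.

Lemma modulus_real (x : R) : modulus x%:C%C = `|x|.
Proof. by rewrite /modulus normc_def /= expr0n addr0 sqrtr_sqr. Qed.

Lemma modulus_nat n : modulus (n%:R : R[i]) = n%:R.
Proof. by rewrite /modulus normr_nat -[n%:R]/(n%:R) -(rmorph_nat (real_complex R)). Qed.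

Lemma modulus0 : modulus (0 : R[i]) = 0.
Proof. exact: (modulus_nat 0). Qed.

Lemma modulus1 : modulus (1 : R[i]) = 1.
Proof. exact: (modulus_nat 1). Qed.

Lemma modulusD z w : modulus (z + w) <= modulus z + modulus w.
Proof. by rewrite -lecR rmorphD /= -!modulusE ler_normD. Qed.

Lemma modulusB z w : modulus (z - w) <= modulus z + modulus w.
Proof. by rewrite -(modulusN w) modulusD. Qed.

Lemma modulus_distD z w x : modulus (z - w) <= modulus (z - x) + modulus (x - w).
Proof. by rewrite (le_trans _ (modulusD _ _)) // addrA subrK. Qed.

Lemma modulus_prod n (F : nat -> R[i]) :
  modulus (\prod_(0 <= i < n) F i) = \prod_(0 <= i < n) modulus (F i).
Proof.
elim: n => [|n IH]; first by rewrite !big_nil modulus1.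
by rewrite !big_nat_recr //= modulusM IH.
Qed.

Lemma Re_le_modulus z : `|complex.Re z| <= modulus z.
Proof. by rewrite -lecR -modulusE normc_ge_Re. Qed.

Lemma Im_le_modulus z : `|complex.Im z| <= modulus z.
Proof.
rewrite /modulus normc_def /= -sqrtr_sqr ler_wsqrtr // lerDr; exact: sqr_ge0.
Qed.

Lemma modulus_le_ReIm z : modulus z <= `|complex.Re z| + `|complex.Im z|.
Proof.
rewrite {1}(complexE z) (le_trans (modulusD _ _)) // modulusM !modulus_real.
by rewrite (_ : modulus 'i%C = 1) ?mul1r // /modulus normc_def /= expr0n expr1n add0r sqrtr1.
Qed.

Lemma pos_complexE z : 0 < z -> z = (complex.Re z)%:C%C /\ 0 < complex.Re z.
Proof. by case: z => x y; rewrite ltcE /= => /andP[/eqP -> ->]. Qed.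

(** Norms in [R[i]] are themselves complex numbers; positive ones are real, so real radii
    suffice. *)
Lemma cvg_modulusP (T : Type) (F : set_system T) {FF : Filter F} (f : T -> R[i]) z :
  f @ F --> z <-> forall e : R, 0 < e -> \forall t \near F, modulus (z - f t) <= e.
Proof.
split=> [/cvgrPdist_le fz e e0|H].
  have e0' : 0 < e%:C%C :> R[i] by rewrite ltcR.
  by have := fz _ e0'; apply: filterS => t; rewrite modulusE lecR.
apply/cvgrPdist_le => e /pos_complexE [-> e0].
by apply: filterS (H _ e0) => t; rewrite modulusE lecR.
Qed.

Lemma cvg_modulus_le (u : nat -> R[i]) z (B : R) :
  u @ \oo --> z -> (forall n, modulus (u n) <= B) -> modulus z <= B.
Proof.
move=> /cvg_modulusP uz uB; rewrite leNgt; apply/negP => Bz.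
have e0 : 0 < (modulus z - B) / 2 by rewrite divr_gt0 // subr_gt0.
have [N _ /(_ N (leqnn N))/= H] := uz _ e0.
have := modulusD (z - u N) (u N); rewrite subrK => H2.
by have := uB N; lra.
Qed.

Lemma cvg_modulus_ge (u : nat -> R[i]) z (B : R) :
  u @ \oo --> z -> (forall n, B <= modulus (u n)) -> B <= modulus z.
Proof.
move=> /cvg_modulusP uz uB; rewrite leNgt; apply/negP => Bz.
have e0 : 0 < (B - modulus z) / 2 by rewrite divr_gt0 // subr_gt0.
have [N _ /(_ N (leqnn N))/= H] := uz _ e0.
have := modulusB z (z - u N); rewrite opprB addrC subrK => H2.
by have := uB N; lra.
Qed.

Lemma ReB z w : complex.Re (z - w) = complex.Re z - complex.Re w.
Proof. by case: z; case: w. Qed.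

Lemma ImB z w : complex.Im (z - w) = complex.Im z - complex.Im w.
Proof. by case: z; case: w. Qed.

Lemma cvg_ReIm (u : nat -> R[i]) (x y : R) :
  (fun n => complex.Re (u n)) @ \oo --> x -> (fun n => complex.Im (u n)) @ \oo --> y ->
  u @ \oo --> (x +i* y)%C.
Proof.
move=> /cvgrPdist_le ux /cvgrPdist_le uy; apply/cvg_modulusP => e e0.
have e2 : 0 < e / 2 by rewrite divr_gt0.
near=> n; rewrite (le_trans (modulus_le_ReIm _)) // [leRHS]splitr lerD //.
  by rewrite ReB /=; near: n; exact: ux.
by rewrite ImB /=; near: n; exact: uy.
Unshelve. all: by end_near. Qed.

(** Real and imaginary parts are telescoping series dominated by b, so completeness is used in R
    only. *)
Lemma cvg_complex_series (u : nat -> R[i]) (b : nat -> R) :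
  cvgn (series b) -> (forall n, modulus (u n.+1 - u n) <= b n) -> cvgn u.
Proof.
move=> cb ub.
have comp (f : R[i] -> R) : (forall z w, f (z - w) = f z - f w) ->
    (forall z, `|f z| <= modulus z) ->
    cvgn (f \o u).
  move=> fB fm; have -> : f \o u = fun n => f (u 0%N) + series (telescope (f \o u)) n.
    by apply/funext => n; rewrite telescopeK /= addrC subrK.
  apply: is_cvgD; first exact: is_cvg_cst.
  apply: normed_cvg; apply: (series_le_cvg (v_ := b)) cb => n.
  - exact: normr_ge0.
  - exact: le_trans (modulus_ge0 _) (ub n).
  - by rewrite /telescope /= -fB (le_trans (fm _)).
have /cvg_ex[x Rx] := comp (@complex.Re R) ReB Re_le_modulus.
have /cvg_ex[y Iy] := comp (@complex.Im R) ImB Im_le_modulus.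
by apply/cvg_ex; exists (x +i* y)%C; exact: cvg_ReIm.
Qed.

End Modulus.

Section DerivativeSmallO.
Variable K : numFieldType.
Implicit Types (f g : K -> K) (x l m : K).

Lemma is_derive_smallP f x l : is_derive x 1 f l <->
  forall e, 0 < e -> \forall h \near 0, `|f (x + h) - f x - l * h| <= e * `|h|.
Proof.
split.
  move=> [/derivable_nbhs df fl] e e0; move: df; rewrite fl => /eqaddoP/(_ e e0).
  apply: filterS => h /=.
  rewrite /cst /= [X in `|X|](_ : _ = f (x + h) - f x - l * h) //.
  by rewrite !fctE /= [_ *: 1]mulr1 [h *: _]mulrC opprD addrA (addrC h).
move=> H.
have cv : h^-1 *: (f (h *: 1 + x) - f x) @[h --> 0^'] --> l.
  apply/cvgrPdist_le => /= e e0.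
  near=> h.
  have hn0 : h != 0 by near: h; exact: nbhs_dnbhs_neq.
  have h0 : 0 < `|h| by rewrite normr_gt0.
  rewrite -(ler_pM2r h0) -normrM mulrBl.
  rewrite /GRing.scale /= mulr1 (addrC h) mulrAC mulVf // mul1r -normrN opprB.
  by near: h; apply: nbhs_dnbhs; exact: H.
apply: DeriveDef; first by apply/cvg_ex; exists l.
exact: cvg_lim.
Unshelve. all: by end_near. Qed.

Lemma is_derive1_chain f g x l m : is_derive (g x) 1 f l -> is_derive x 1 g m ->
  is_derive x 1 (f \o g) (l * m).
Proof.
move=> [/[dup] dfd /derivable1_diffP df <-] [/[dup] dgd /derivable1_diffP dg <-].
have dfg : differentiable (f \o g) x by exact: differentiable_comp.
apply: DeriveDef; first exact/derivable1_diffP.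
rewrite (deriveE _ dfg) (deriveE _ df) (deriveE _ dg) (diff_comp dg df) /=.
by rewrite -[X in 'd f _ X = _]mulr1 [LHS]linearZ mulrC.
Qed.

End DerivativeSmallO.

Section ComplexExponential.
Variable R : realType.
Implicit Types (z w : R[i]).

Lemma cexp0 : cexp (0 : R[i]) = 1.
Proof. by rewrite /cexp /= expR0 cos0 sin0 mulr1 mulr0. Qed.

Lemma cexpD z w : cexp (z + w) = cexp z * cexp w.
Proof.
case: z => a b; case: w => c d; rewrite /cexp /= expRD cosD sinD.
apply/eqP; rewrite eq_complex /=; apply/andP; split; apply/eqP; ring.
Qed.

Lemma cexpN z : cexp (- z) * cexp z = 1.
Proof. by rewrite -cexpD addNr cexp0. Qed.

Lemma cexp_neq0 z : cexp z != 0.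
Proof.
apply/eqP => z0; have := cexpN z; rewrite z0 mulr0 => /eqP.
by rewrite eq_sym oner_eq0.
Qed.

Lemma modulus_cexp z : modulus (cexp z) = expR (complex.Re z).
Proof.
rewrite /modulus normc_def /= !exprMn -mulrDr cos2Dsin2 mulr1.
by rewrite sqrtr_sqr ger0_norm // expR_ge0.
Qed.

Lemma cexp_real (x : R) : cexp x%:C%C = (expR x)%:C%C.
Proof. by rewrite /cexp /= cos0 sin0 mulr1 mulr0. Qed.

Let real_small (f : R -> R) (x l : R) : is_derive x 1 f l -> forall e, 0 < e ->
  exists2 d, 0 < d & forall h, `|h| < d -> `|f (x + h) - f x - l * h| <= e * `|h|.
Proof.
move=> /is_derive_smallP H e e0; have /nbhs_ballP[d /= d0 Hd] := H _ e0.
exists d => // h hd; apply: Hd; rewrite -ball_normE /= sub0r normrN; exact: hd.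
Qed.

(** The functional equation reduces the claim to first-order expansions of exp, cos and sin at 0,
    all taken with the same small slope error q. *)
Lemma is_derive_cexp z : is_derive z 1 (@cexp R) (cexp z).
Proof.
apply/is_derive_smallP => e1 /pos_complexE[-> e0]; set e := complex.Re e1 in e0 *.
have M0 : 0 < modulus (cexp z) by rewrite modulus_cexp expR_gt0.
set M := modulus (cexp z) in M0.
(* The real and imaginary errors below are 3 q r and 5 q r; after multiplication by M their sum is 8
   M q r, within the margin left by 20 M q <= e. *)
pose q := Num.min (e / (20 * M)) 1.
have q0 : 0 < q by rewrite lt_min ltr01 andbT divr_gt0 // mulr_gt0.
have q1 : q <= 1 by rewrite ge_min lexx orbT.
have qe : q * (20 * M) <= e by rewrite -ler_pdivlMr ?mulr_gt0 // ge_min lexx.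
clearbody q.
have [d1 d10 H1] := real_small (is_derive_expR 0) q0.
have [d2 d20 H2] := real_small (is_derive_cos 0) q0.
have [d3 d30 H3] := real_small (is_derive_sin 0) q0.
pose d := Num.min (Num.min d1 d2) (Num.min d3 q).
have d0 : 0 < d by rewrite !lt_min d10 d20 d30 q0.
apply/nbhs_ballP; exists d%:C%C; first by rewrite /= ltcR.
move=> h; rewrite -ball_normE /= sub0r normrN modulusE ltcR => hd.
have -> : cexp (z + h) - cexp z - cexp z * h = cexp z * (cexp h - 1 - h).
  by rewrite cexpD; ring.
rewrite !modulusE -rmorphM lecR modulusM -/M.
have xh := Re_le_modulus h; have yh := Im_le_modulus h.
set r := modulus h in hd xh yh *.
have r0 : 0 <= r by exact: modulus_ge0.
case: h @r hd xh yh r0 => x y /=; set r := modulus _ => hd xh yh r0.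
move: hd; rewrite !lt_min => /andP[/andP[rd1 rd2] /andP[rd3 rq]].
have := H1 x (le_lt_trans xh rd1).
have := H2 y (le_lt_trans yh rd2).
have := H3 y (le_lt_trans yh rd3).
rewrite !add0r expR0 cos0 sin0 !mul1r !oppr0 !mul0r !oppr0 !addr0 => E3 E2 E1.
set ex := expR x in E1 *; set cy := cos y in E2 *; set sy := sin y in E3 *.
have Cy : `|cy| <= 1 by exact: cos_max.
have qr : 0 <= q * r by rewrite mulr_ge0 // ltW.
have {}E1 : `|ex - 1 - x| <= q * r by rewrite (le_trans E1) // ler_pM2l.
have {}E2 : `|cy - 1| <= q * r by rewrite (le_trans E2) // ler_pM2l.
have {}E3 : `|sy - y| <= q * r by rewrite (le_trans E3) // ler_pM2l.
have r1 : r <= 1 by lra.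
have E4 : `|ex - 1| <= 2 * r.
  rewrite (_ : ex - 1 = (ex - 1 - x) + x); last ring.
  rewrite (le_trans (ler_normD _ _)) //.
  have : q * r <= 1 * r by rewrite ler_wpM2r.
  lra.
have E5 : `|sy| <= 2 * r.
  rewrite (_ : sy = (sy - y) + y); last ring.
  rewrite (le_trans (ler_normD _ _)) //.
  have : q * r <= 1 * r by rewrite ler_wpM2r.
  lra.
have rr : r * r <= q * r by rewrite ler_wpM2r // ltW.
have A1 : `|ex * cy - 1 - x| <= 3 * (q * r).
  rewrite (_ : _ - x = (ex - 1 - x) * cy + (1 + x) * (cy - 1)); last ring.
  rewrite (le_trans (ler_normD _ _)) // !normrM.
  have : `|ex - 1 - x| * `|cy| <= q * r * 1 by rewrite ler_pM.
  have : `|1 + x| * `|cy - 1| <= 2 * (q * r).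
    by rewrite ler_pM // (le_trans (ler_normD _ _)) // normr1; lra.
  lra.
have A2 : `|ex * sy - y| <= 5 * (q * r).
  rewrite (_ : _ - y = (ex - 1) * sy + (sy - y)); last ring.
  rewrite (le_trans (ler_normD _ _)) // normrM.
  have : `|ex - 1| * `|sy| <= (2 * r) * (2 * r) by rewrite ler_pM.
  lra.
have A3 : modulus (cexp (x +i* y)%C - 1 - (x +i* y)%C) <= 8 * (q * r).
  rewrite (le_trans (modulus_le_ReIm _)) //= -/ex -/cy -/sy oppr0 addr0; lra.
rewrite -/M -/e; apply: (le_trans (ler_wpM2l (ltW M0) A3)).
have : (q * (20 * M)) * r <= e * r by rewrite ler_wpM2r.
have : 0 <= M * (q * r) by rewrite mulr_ge0 // ltW.
lra.
Qed.

Lemma is_derive_cexp_comp (f : R[i] -> R[i]) z l : is_derive z 1 f l ->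
  is_derive z 1 (fun w => cexp (f w)) (cexp (f z) * l).
Proof. by move=> fl; exact: (is_derive1_chain (is_derive_cexp (f z)) fl). Qed.

Lemma is_derive_modulusP (f : R[i] -> R[i]) z l : is_derive z 1 f l <->
  forall e : R, 0 < e -> exists2 d : R, 0 < d &
    forall h, modulus h < d -> modulus (f (z + h) - f z - l * h) <= e * modulus h.
Proof.
split=> [/is_derive_smallP H e e0|H].
  have e0' : 0 < e%:C%C :> R[i] by rewrite ltcR.
  have /nbhs_ballP[d /= /pos_complexE[dE d0] Hd] := H _ e0'.
  exists (complex.Re d) => // h hd; rewrite -lecR rmorphM /= -!modulusE; apply: Hd.
  by rewrite -ball_normE /= sub0r normrN modulusE dE ltcR.
apply/is_derive_smallP => e1 /pos_complexE[-> e0].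
have [d d0 Hd] := H _ e0.
apply/nbhs_ballP; exists d%:C%C; first by rewrite /= ltcR.
move=> h; rewrite -ball_normE /= sub0r normrN !modulusE ltcR => /Hd.
by rewrite -rmorphM lecR.
Qed.

Lemma is_derive_Re_ray (f : R[i] -> R[i]) w l (s : R) :
  is_derive (s%:C%C * w) 1 f l ->
  is_derive s 1 (fun t : R => complex.Re (f (t%:C%C * w))) (complex.Re (l * w)).
Proof.
move=> /is_derive_modulusP H; apply/is_derive_smallP => e e0.
have W0 : 0 < modulus w + 1 by rewrite ltr_wpDl // modulus_ge0.
have [d d0 Hd] := H _ (divr_gt0 e0 W0).
apply/nbhs_ballP; exists (d / (modulus w + 1)); first by rewrite /= divr_gt0.
move=> h; rewrite -ball_normE /= sub0r normrN => hd.
have hm : modulus (h%:C%C * w) <= `|h| * (modulus w + 1).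
  by rewrite modulusM modulus_real ler_wpM2l // lerDl.
have := Hd (h%:C%C * w); rewrite -mulrDl -rmorphD => {}Hd.
have hwd : modulus (h%:C%C * w) < d by rewrite (le_lt_trans hm) // -ltr_pdivlMr.
have -> : complex.Re (f ((s + h)%:C%C * w)) - complex.Re (f (s%:C%C * w)) -
   complex.Re (l * w) * h = complex.Re (f ((s + h)%:C%C * w) - f (s%:C%C * w) - l * (h%:C%C * w)).
  rewrite !ReB; congr (_ - _); rewrite mulrCA; case: (l * w) => a b /=.
  by rewrite mul0r subr0 mulrC.
rewrite (le_trans (Re_le_modulus _)) // (le_trans (Hd hwd)) //.
by rewrite mulrAC ler_pdivrMr // -mulrA ler_pM2l.
Qed.

(** The mean value theorem is applied on the segment from 0 to w to the real parts of f and of -i f,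
    the latter being the imaginary part of f; hence the factor 2. *)
Lemma complex_mean_value (f f' : R[i] -> R[i]) w (B : R) :
  (forall s : R, 0 <= s <= 1 -> is_derive (s%:C%C * w) 1 f (f' (s%:C%C * w)) /\
     modulus (f' (s%:C%C * w)) <= B) ->
  modulus (f w - f 0) <= 2 * (B * modulus w).
Proof.
move=> H.
have ReH (g g' : R[i] -> R[i]) :
  (forall s : R, 0 <= s <= 1 -> is_derive (s%:C%C * w) 1 g (g' (s%:C%C * w)) /\
     modulus (g' (s%:C%C * w)) <= B) -> `|complex.Re (g w - g 0)| <= B * modulus w.
  move=> {}H; pose u t := complex.Re (g (t%:C%C * w)).
  have du (s : R) : 0 <= s <= 1 -> is_derive s 1 u (complex.Re (g' (s%:C%C * w) * w)).
    by move=> /H[dg _]; exact: is_derive_Re_ray.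
  have [||c] := @MVT_segment R u (fun s => complex.Re (g' (s%:C%C * w) * w)) 0 1 ler01.
  - move=> x; rewrite in_itv /= => /andP[x0 x1]; apply: du; lra.
  - apply: derivable_within_continuous => x; rewrite in_itv /= => x01.
    by have [] := du x x01.
  rewrite in_itv /= => /H[_ cB]; rewrite subr0 mulr1 /u rmorph1 rmorph0 mul1r mul0r.
  rewrite -ReB => ->; rewrite (le_trans (Re_le_modulus _)) // modulusM.
  by rewrite ler_wpM2r // modulus_ge0.
have H2 : `|complex.Im (f w - f 0)| <= B * modulus w.
  have := ReH (fun z => - 'i%C * f z) (fun z => - 'i%C * f' z).
  rewrite -mulrBr (_ : complex.Re (- 'i%C * _) = complex.Im (f w - f 0)); last first.
    by case: (f w - f 0) => a b /=; ring.
  apply=> s /H[dfs fB]; split.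
    by have := is_deriveZ (- 'i%C) dfs.
  rewrite modulusM modulusN (_ : modulus 'i%C = 1) ?mul1r //.
  by rewrite /modulus normc_def /= expr0n expr1n add0r sqrtr1.
have := modulus_le_ReIm (f w - f 0); have := ReH f f' H; lra.
Qed.

End ComplexExponential.

Section EntireFunctions.
Variable R : realType.
Implicit Types (z w h : R[i]).

Lemma entireM (f g : R[i] -> R[i]) : entire f -> entire g ->
  entire (fun z => f z * g z).
Proof. by move=> ef eg z; exact: derivableM (ef z) (eg z). Qed.

Lemma entireB (f g : R[i] -> R[i]) : entire f -> entire g ->
  entire (fun z => f z - g z).
Proof. by move=> ef eg z; exact: derivableB (ef z) (eg z). Qed.

Lemma entire_cst c : entire (fun _ : R[i] => c).
Proof. by move=> z; exact: derivable_cst. Qed.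

Lemma entire_cexp_comp (f : R[i] -> R[i]) : entire f -> entire (fun z => cexp (f z)).
Proof.
by move=> ef z; have [] := is_derive_cexp_comp (derivableP (ef z)).
Qed.

(** A quadratic Taylor remainder with a constant independent of n survives pointwise limits and
    identifies the derivative of the limit. *)
Lemma entire_limit (F G : nat -> R[i] -> R[i]) (f g : R[i] -> R[i]) :
  (forall z, (fun n => F n z) @ \oo --> f z) ->
  (forall z, (fun n => G n z) @ \oo --> g z) ->
  (forall z, exists M : R, forall n h, modulus h <= 1 ->
     modulus (F n (z + h) - F n z - G n z * h) <= M * modulus h ^+ 2) ->
  entire f.
Proof.
move=> Ff Gg H z; have [M HM] := H z.
have M0 : 0 <= M.
  have := HM 0%N 1; rewrite modulus1 expr1n !mulr1 => /(_ (lexx _)).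
  by move/(le_trans (modulus_ge0 _)).
have [] // := @is_derive_of_quadratic _ f z (g z) (M + 1)%:C%C _ _.
  by rewrite ltcR ltr_wpDl.
move=> h; rewrite !modulusE -[X in _ <= X -> _](rmorph1 (real_complex R)) lecR => h1.
rewrite -rmorphXn -rmorphM lecR.
apply: (@le_trans _ _ (M * modulus h ^+ 2)); last first.
  by rewrite ler_wpM2r ?exprn_ge0 ?modulus_ge0 // lerDl.
apply: (@cvg_modulus_le _ (fun n => F n (z + h) - F n z - G n z * h)).
  apply: cvgB; first by apply: cvgB; exact: Ff.
  by apply: cvgM; [exact: Gg|exact: cvg_cst].
by move=> n; exact: HM.
Qed.

End EntireFunctions.

(** * Canonical products of genus zero *)

Section GenusZeroProduct.
Variables (R : realType) (a : nat -> R).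
Hypothesis a_ge0 : forall i, 0 <= a i.
Hypothesis a_cvg : cvgn (series a).
Implicit Types (z w h : R[i]).

Let P n z := \prod_(0 <= i < n) (1 - (a i)%:C%C * z).

Fixpoint prod_deriv n z : R[i] :=
  if n is n'.+1 then
    prod_deriv n' z * (1 - (a n')%:C%C * z) - (a n')%:C%C * P n' z
  else 0.

Definition genus0_prod z : R[i] := limn (fun n => P n z).

Let A := limn (series a).

Let seriesS n : series a n.+1 = series a n + a n.
Proof. by rewrite /series /= big_nat_recr. Qed.

Let PS n z : P n.+1 z = P n z * (1 - (a n)%:C%C * z).
Proof. by rewrite /P big_nat_recr. Qed.

Let series_leA n : series a n <= A.
Proof.
apply: nondecreasing_cvgn_le => //.
by apply/nondecreasing_seqP => m; rewrite seriesS lerDl.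
Qed.

Let series_ge0' n : 0 <= series a n.
Proof. by rewrite /series /= sumr_ge0. Qed.

Lemma modulus_factor_le n z (r : R) : modulus z <= r ->
  modulus (1 - (a n)%:C%C * z) <= 1 + a n * r.
Proof.
move=> zr; rewrite (le_trans (modulusB _ _)) // modulus1 lerD2l modulusM modulus_real.
by rewrite ger0_norm // ler_wpM2l.
Qed.

(** Majorant of the partial products on $|z| \le r$. The inequality [BS] is the inductive step of
    the bounds on the product, its derivative and its Taylor remainder. *)
Let B r n : R := expR (r * series a n).

Let BS r n : 0 <= r -> (1 + a n * r) * B r n <= B r n.+1.
Proof.
move=> r0; rewrite /B seriesS mulrDr expRD [leRHS]mulrC ler_wpM2r ?expR_ge0 //.
by rewrite [r * _]mulrC expR_ge1Dx.
Qed.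

Let modulusP_le n z r : modulus z <= r -> modulus (P n z) <= B r n.
Proof.
move=> zr; have r0 := le_trans (modulus_ge0 _) zr.
elim: n => [|n IH].
  by rewrite /P big_nil modulus1 /B /series /= big_nil mulr0 expR0.
rewrite PS modulusM mulrC (le_trans _ (BS n r0)) // ler_pM ?modulus_ge0 //.
exact: modulus_factor_le.
Qed.

Let modulusG_le n z r : modulus z <= r ->
  modulus (prod_deriv n z) <= series a n * B r n.
Proof.
move=> zr; have r0 := le_trans (modulus_ge0 _) zr.
elim: n => [|n IH] /=; first by rewrite modulus0 mulr_ge0 // expR_ge0.
rewrite (le_trans (modulusB _ _)) // !modulusM modulus_real ger0_norm //.
rewrite seriesS mulrDl lerD //.
  apply: (@le_trans _ _ (series a n * B r n * (1 + a n * r))).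
    by rewrite ler_pM ?modulus_ge0 // modulus_factor_le.
  by rewrite -mulrA ler_wpM2l // mulrC BS.
rewrite ler_wpM2l // (le_trans (modulusP_le n zr)) //.
rewrite (le_trans _ (BS n r0)) // ler_peMl ?expR_ge0 // lerDl mulr_ge0 //.
Qed.

(** The remainder obeys $D_{n+1} = D_n (1 - a_n (z + h)) - a_n P_n' h^2$. With $S_n$ the partial
    sums of a, the induction closes because $S_n^2 + a_n S_n \le S_{n+1}^2$. *)
Let modulus_quadratic n z h r : modulus z + modulus h <= r ->
  modulus (P n (z + h) - P n z - prod_deriv n z * h) <=
  series a n ^+ 2 * B r n * modulus h ^+ 2.
Proof.
move=> zr; have r0 : 0 <= r by rewrite (le_trans _ zr) // addr_ge0 // modulus_ge0.
have zr' : modulus z <= r by rewrite (le_trans _ zr) // lerDl modulus_ge0.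
have zhr : modulus (z + h) <= r by rewrite (le_trans (modulusD _ _)).
elim: n => [|n IH].
  rewrite /P !big_nil /= mul0r subrr subr0 modulus0 /series /= big_nil.
  by rewrite expr0n !mul0r.
rewrite !PS /=.
set D := P n (z + h) - P n z - _ in IH.
rewrite (_ : _ - _ * h = D * (1 - (a n)%:C%C * (z + h)) - (a n)%:C%C * prod_deriv n z * h ^+ 2); last first.
  by rewrite /D; ring.
rewrite (le_trans (modulusB _ _)) // (modulusM _ (h ^+ 2)) modulusX !modulusM modulus_real ger0_norm //.
have h2 : 0 <= modulus h ^+ 2 by rewrite exprn_ge0 // modulus_ge0.
apply: (@le_trans _ _ ((series a n ^+ 2 * B r n * modulus h ^+ 2) * (1 + a n * r) +
   a n * (series a n * B r n) * modulus h ^+ 2)).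
  apply: lerD; first by rewrite ler_pM ?modulus_ge0 // modulus_factor_le.
  by rewrite ler_wpM2r // ler_wpM2l // modulusG_le.
have BB : B r n <= B r n.+1.
  by rewrite (le_trans _ (BS n r0)) // ler_peMl ?expR_ge0 // lerDl mulr_ge0.
rewrite (mulrAC _ (modulus h ^+ 2)) -mulrDl ler_wpM2r // seriesS.
apply: (@le_trans _ _ (series a n ^+ 2 * B r n.+1 + a n * (series a n * B r n.+1))).
  apply: lerD; first by rewrite -mulrA ler_wpM2l ?exprn_ge0 // mulrC BS.
  by rewrite ler_wpM2l // ler_wpM2l.
rewrite mulrA -mulrDl ler_wpM2r ?expR_ge0 //.
have := series_ge0' n; have := a_ge0 n; set x := a n; set y := series a n => x0 y0.
have : 0 <= x * x by rewrite mulr_ge0.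
have : 0 <= x * y by rewrite mulr_ge0.
lra.
Qed.

Let B_le r n : 0 <= r -> B r n <= expR (r * A).
Proof. by move=> r0; rewrite ler_expR ler_wpM2l. Qed.

Let cvg_seriesZ c : cvgn (series (fun n => c * a n)).
Proof. exact: is_cvg_seriesZ. Qed.

Lemma cvg_genus0_prod z :
  (fun n => \prod_(0 <= i < n) (1 - (a i)%:C%C * z)) @ \oo --> genus0_prod z.
Proof.
apply: (cvg_complex_series (b := fun n => modulus z * expR (modulus z * A) * a n)) => //.
move=> n; rewrite -/(P n z) -/(P n.+1 z) PS mulrBr mulr1 addrAC subrr add0r modulusN.
rewrite !modulusM modulus_real ger0_norm // mulrCA mulrC ler_wpM2r // mulrC.
rewrite ler_wpM2l ?modulus_ge0 // (le_trans (modulusP_le n (lexx _))) //.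
by rewrite B_le // modulus_ge0.
Qed.

Let cvg_prod_deriv z : cvgn (fun n => prod_deriv n z).
Proof.
set r := modulus z.
apply: (cvg_complex_series (b := fun n => (r * (A * expR (r * A)) + expR (r * A)) * a n)) => //.
move=> n /=.
rewrite (_ : _ - _ = - (prod_deriv n z * ((a n)%:C%C * z)) - (a n)%:C%C * P n z); last by ring.
have r0 : 0 <= r by exact: modulus_ge0.
rewrite (le_trans (modulusB _ _)) // modulusN !modulusM modulus_real ger0_norm // -/r.
rewrite mulrDl lerD //.
  rewrite mulrCA mulrC ler_wpM2r // mulrC ler_wpM2l // (le_trans (modulusG_le n (lexx _))) //.
  by rewrite ler_pM ?expR_ge0 // B_le.
by rewrite mulrC ler_wpM2r // (le_trans (modulusP_le n (lexx _))) // B_le.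
Qed.

Lemma entire_genus0_prod : entire genus0_prod.
Proof.
apply: (@entire_limit _ P prod_deriv genus0_prod (fun z => limn (fun n => prod_deriv n z))).
- exact: cvg_genus0_prod.
- exact: cvg_prod_deriv.
move=> z; exists (A ^+ 2 * expR ((modulus z + 1) * A)) => n h h1.
have r0 : 0 <= modulus z + 1 by rewrite addr_ge0 // modulus_ge0.
rewrite (le_trans (@modulus_quadratic n z h (modulus z + 1) _)) //; first by rewrite lerD2l.
rewrite ler_wpM2r ?exprn_ge0 ?modulus_ge0 // ler_pM ?exprn_ge0 ?expR_ge0 // ?B_le //.
by rewrite ler_pXn2r ?nnegrE // (le_trans (series_ge0' n)).
Qed.

Lemma modulus_genus0_prod_le z : modulus (genus0_prod z) <= expR (modulus z * A).
Proof.
apply: (@cvg_modulus_le _ (fun n => P n z)); first exact: cvg_genus0_prod.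
move=> n; by rewrite (le_trans (modulusP_le n (lexx _))) // B_le // modulus_ge0.
Qed.

(* Weierstrass' inequality: the tail of the product from [N] on has modulus at
   least [1 - |z| \sum_(i >= N) a_i]. *)
Lemma genus0_prod_neq0 z : (forall i, (a i)%:C%C * z != 1) -> genus0_prod z != 0.
Proof.
move=> az; set r := modulus z.
have r0 : 0 <= r by exact: modulus_ge0.
have [N HN] : exists N, forall n, r * (series a (N + n)%N - series a N) <= 2^-1.
  have e0 : 0 < (2 * (r + 1))^-1 by rewrite invr_gt0 mulr_gt0 // ltr_wpDl.
  have /cvgrPdist_le/(_ _ e0)[N _ HN] := a_cvg.
  exists N => n; have := HN N (leqnn N); rewrite /= -/A => {}HN.
  have := series_leA (N + n)%N; rewrite (ger0_norm _) ?subr_ge0 // in HN => H.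
  have : series a (N + n)%N - series a N <= (2 * (r + 1))^-1 by lra.
  move=> /(ler_wpM2l r0)/le_trans; apply.
  by rewrite ler_pdivrMr ?mulr_gt0 // ?ltr_wpDl // mulrA mulVf // mul1r lerDl.
have tail n : 1 - r * (series a (N + n)%N - series a N) <=
    \prod_(N <= i < N + n) modulus (1 - (a i)%:C%C * z).
  elim: n => [|n IH]; first by rewrite addn0 subrr mulr0 subr0 big_geq.
  rewrite addnS big_nat_recr ?leq_addr //= seriesS.
  set x := series a (N + n)%N - series a N in IH *.
  have x0 : 0 <= x.
    have nd : nondecreasing_seq (series a).
      by apply/nondecreasing_seqP => m; rewrite seriesS lerDl.
    by rewrite subr_ge0 nd // leq_addr.
  have fac : 1 - a (N + n)%N * r <= modulus (1 - (a (N + n)%N)%:C%C * z).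
    have := modulusB 1 (1 - (a (N + n)%N)%:C%C * z).
    rewrite opprB addrC subrK modulusM modulus_real ger0_norm // -/r.
    have := modulusD (1 - (a (N + n)%N)%:C%C * z) ((a (N + n)%N)%:C%C * z).
    rewrite subrK modulus1 modulusM modulus_real ger0_norm // -/r; lra.
  rewrite (_ : _ - _ = 1 - r * x - a (N + n)%N * r); last by rewrite /x; ring.
  have y0 : 0 <= a (N + n)%N * r by rewrite mulr_ge0.
  (* Multiplying lower bounds requires a nonnegative factor $1 - a_i |z|$; when it is negative, the
     left-hand side is already at most 0. *)
  have [y1|y1] := leP (a (N + n)%N * r) 1; last first.
    apply: (@le_trans _ _ 0); first by have : 0 <= r * x by [rewrite mulr_ge0]; lra.
    by apply: mulr_ge0; [apply: prodr_ge0 => i _|]; exact: modulus_ge0.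
  have Hx : r * x <= 2^-1 by exact: HN.
  apply: (@le_trans _ _ ((1 - r * x) * (1 - a (N + n)%N * r))).
    have : 0 <= (r * x) * (a (N + n)%N * r) by rewrite !mulr_ge0.
    lra.
  by apply: ler_pM => //; lra.
have PN0 : P N z != 0.
  rewrite /P; elim: N {HN tail} => [|N IH]; first by rewrite big_nil oner_eq0.
  by rewrite big_nat_recr //= mulf_neq0 // subr_eq0 eq_sym.
rewrite -modulus_eq0; apply: lt0r_neq0.
apply: (@lt_le_trans _ _ (modulus (P N z) / 2)).
  by rewrite divr_gt0 // lt_def modulus_eq0 PN0 modulus_ge0.
have cv : (fun n => P (n + N)%N z) @ \oo --> genus0_prod z.
  by rewrite (cvg_shiftn N (fun n => P n z)); exact: cvg_genus0_prod.
apply: (cvg_modulus_ge cv) => n.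
rewrite -/(P (n + N)%N z) /P (big_cat_nat _ (leq_addl n N)) //= modulusM.
rewrite ler_wpM2l ?modulus_ge0 //.
have -> : modulus (\prod_(N <= i < n + N) (1 - (a i)%:C%C * z)) =
   \prod_(N <= i < N + n) modulus (1 - (a i)%:C%C * z).
  rewrite addnC; elim: n => [|n IH]; first by rewrite addn0 !big_geq // modulus1.
  by rewrite addnS !big_nat_recr ?leq_addr //= modulusM IH.
apply: le_trans (tail n); have := HN n; lra.
Qed.

End GenusZeroProduct.

Section CardSeq.
Import mathcomp.finmap.finmap.

Lemma card_uniq_seq (T : choiceType) (s : seq T) : uniq s -> ([set` s] #= `I_(size s))%card.
Proof.
move=> us; have -> : [set` s] = [set` [fset x in s]%fset].
  by apply/seteqP; split => x /=; rewrite !inE.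
by apply/card_eq_fsetP; rewrite card_fseq undup_id.
Qed.

End CardSeq.

Section ZeroMultiplicity.
Variable R : realType.
Implicit Types (z w : R[i]) (a : nat -> R).

Lemma complex_cvg_unique (u : nat -> R[i]) z w :
  u @ \oo --> z -> u @ \oo --> w -> z = w.
Proof.
move=> uz uw; apply/eqP; rewrite -subr_eq0 -modulus_eq0 eq_le modulus_ge0 andbT.
apply/ler_addgt0Pl => e e0; rewrite addr0.
have e2 : 0 < e / 2 by rewrite divr_gt0.
have [N1 _ H1] := (cvg_modulusP _ _).1 uz _ e2.
have [N2 _ H2] := (cvg_modulusP _ _).1 uw _ e2.
have := H1 _ (leq_maxl N1 N2); have := H2 _ (leq_maxr N1 N2) => /= {}H2 {}H1.
rewrite (le_trans (modulus_distD _ _ (u (maxn N1 N2)))) // [leRHS]splitr lerD //.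
by rewrite -modulusN opprB.
Qed.

(** As $a_i$ tends to 0, only finitely many i satisfy $a_i w = 1$. Each such factor equals $-w^{-1}
    (z - w)$; replacing these $a_i$ by 0 leaves a product that does not vanish at w. *)
Lemma zero_mult_genus0_prod a w : (forall i, 0 <= a i) -> cvgn (series a) ->
  exists2 k, zero_mult (genus0_prod a) w k &
    ([set m : nat | a m != 0%R /\ (a m)%:C%C^-1 = w :> R[i]] #= `I_k)%card.
Proof.
move=> a0 ca; pose q i := (a i)%:C%C * w == 1.
have [N0 HN0] : exists N0, forall i, (N0 <= i)%N -> ~~ q i.
  have e0 : 0 < (modulus w + 1)^-1 by rewrite invr_gt0 ltr_wpDl // modulus_ge0.
  have /cvgrPdist_lt/(_ _ e0)[N _ HN] := cvg_series_cvg_0 ca.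
  exists N => i /HN; rewrite sub0r normrN ger0_norm // => ai.
  apply/negP => /eqP/(congr1 (@modulus R)); rewrite modulusM modulus_real modulus1.
  rewrite ger0_norm //; move: ai; rewrite -[_^-1]mul1r ltr_pdivlMr ?ltr_wpDl ?modulus_ge0 //.
  by have := a0 i; lra.
pose s := [seq i <- iota 0 N0 | q i]; pose k := size s.
pose a' i := if q i then 0 else a i.
have a'0 i : 0 <= a' i by rewrite /a'; case: ifP.
have ca' : cvgn (series a').
  by apply: series_le_cvg ca => // i; rewrite /a'; case: ifP.
have qw i : q i -> w != 0.
  by rewrite /q => /eqP aw; apply/eqP => w0; move/eqP: aw; rewrite w0 mulr0 eq_sym oner_eq0.
have fin n z : \prod_(0 <= i < n) (1 - (a i)%:C%C * z) =
   ((- w^-1) * (z - w)) ^+ (count q (iota 0 n)) *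
   \prod_(0 <= i < n) (1 - (a' i)%:C%C * z).
  elim: n => [|n IH]; first by rewrite !big_nil mulr1.
  have -> : count q (iota 0 n.+1) = (count q (iota 0 n) + q n)%N.
    by rewrite -addn1 iotaD count_cat /= addn0.
  rewrite !big_nat_recr // IH /=.
  rewrite exprD /a' /q; case: ifPn => [/eqP aw|_]; last by rewrite expr0 mulr1 mulrA.
  have w0 : w != 0 by apply: (qw n); exact/eqP.
  rewrite rmorph0 mul0r subr0 mulr1 expr1 mulrAC; congr (_ * _ * _).
  by rewrite -[(a n)%:C%C](mulfK w0) aw; field.
have cnt n : count q (iota 0 (n + N0)) = k.
  rewrite addnC iotaD count_cat /= -size_filter -/s -/k.
  rewrite (_ : count _ _ = 0%N) ?addn0 //; apply/eqP; rewrite -leqn0 leqNgt -has_count.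
  by apply/hasPn => i; rewrite mem_iota => /andP[/HN0].
exists k.
  exists (fun z => (- w^-1) ^+ k * genus0_prod a' z); split.
  - by apply: entireM; [exact: entire_cst|exact: entire_genus0_prod].
  - rewrite mulf_neq0 //.
      (* If k = 0, then w may be 0 and the power is 1; otherwise some factor vanishes at w, which
         forces w to be nonzero. *)
      case: (k =P 0%N) => [->|/eqP]; first by rewrite expr0 oner_eq0.
      rewrite -lt0n /k size_filter -has_count => /hasP[i _ /qw w0].
      by rewrite expf_neq0 // oppr_eq0 invr_eq0.
    apply: genus0_prod_neq0 => // i; rewrite /a'; case: ifPn => //.
    by rewrite rmorph0 mul0r eq_sym oner_eq0.
  - move=> z; rewrite mulrA -exprMn [(z - w) * _]mulrC.
    have c1 : (fun n => \prod_(0 <= i < n + N0) (1 - (a i)%:C%C * z)) @ \oo --> genus0_prod a z.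
      rewrite (cvg_shiftn N0 (fun n => \prod_(0 <= i < n) (1 - (a i)%:C%C * z))).
      exact: cvg_genus0_prod.
    apply: (complex_cvg_unique c1).
    under eq_cvg => n do rewrite fin cnt.
    apply: cvgM; first exact: cvg_cst.
    rewrite (cvg_shiftn N0 (fun n => \prod_(0 <= i < n) (1 - (a' i)%:C%C * z))).
    exact: cvg_genus0_prod.
have -> : [set m : nat | a m != 0 /\ (a m)%:C%C^-1 = w] = [set` s].
  have aq m : a m != 0 /\ (a m)%:C%C^-1 = w <-> q m.
    have ac : (a m == 0) = ((a m)%:C%C == 0) by rewrite -(inj_eq (@complexI R)).
    rewrite ac /q; split=> [[am <-]|/eqP aw]; first by rewrite divff.
    have am : (a m)%:C%C != 0.
      by apply/eqP => am; move/eqP: aw; rewrite am mul0r eq_sym oner_eq0.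
    by split => //; rewrite -[RHS](mulKf am) aw mulr1.
  apply/seteqP; split=> m /=; rewrite aq mem_filter; last by case/andP.
  move=> qm; rewrite qm mem_iota /= add0n ltnNge; apply/negP => /HN0.
  by rewrite qm.
by apply: card_uniq_seq; rewrite filter_uniq // iota_uniq.
Qed.

Lemma zero_mult_unit (f u : R[i] -> R[i]) w k : entire u -> u w != 0 ->
  zero_mult f w k -> zero_mult (fun z => f z * u z) w k.
Proof.
move=> eu uw [h [eh hw fE]]; exists (fun z => h z * u z).
by split => [||z]; [exact: entireM|rewrite mulf_neq0|rewrite fE mulrA].
Qed.

End ZeroMultiplicity.

(** * Exponential and logarithm series *)

Section ExpLogSeries.
Variable R : realType.
Implicit Types (z w u : R[i]).

Let is_derive_powS z n : is_derive z 1 (fun w => w ^+ n.+1) (n.+1%:R * z ^+ n).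
Proof.
apply: DeriveDef; first exact: exprn_derivable.
by rewrite exp_derive /GRing.scale /= mulr1.
Qed.

Let is_derive_sum_seq (F F' : nat -> R[i] -> R[i]) z :
  (forall n, is_derive z 1 (F n) (F' n z)) -> forall N,
  is_derive z 1 (fun w => \sum_(0 <= n < N) F n w) (\sum_(0 <= n < N) F' n z).
Proof.
move=> FF'; elim=> [|N IH].
  rewrite big_nil (_ : (fun w => _) = cst 0); first exact: is_derive_cst.
  by apply/funext => w; rewrite big_nil.
rewrite big_nat_recr //= (_ : (fun w => _) =
    (fun w => \sum_(0 <= n < N) F n w) + F N); first exact: is_deriveD.
by apply/funext => w; rewrite big_nat_recr.
Qed.

Let squeeze1 (f : nat -> R[i]) (b : nat -> R) (k : nat) : b @ \oo --> 0 ->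
  (forall n, modulus (f (n + k)%N - 1) <= b n) -> f @ \oo --> (1 : R[i]).
Proof.
move=> b0 fb; rewrite -(cvg_shiftn k); apply/cvg_modulusP => e e0.
move/cvgrPdist_le: b0 => /(_ _ e0); apply: filterS => n.
rewrite sub0r normrN => bn; rewrite -modulusN opprB (le_trans (fb n)) //.
exact: le_trans (ler_norm _) bn.
Qed.

Let cvgZ0 (c : R) (v : nat -> R) : v @ \oo --> (0 : R) -> (fun n => c * v n) @ \oo --> (0 : R).
Proof. by move=> v0; rewrite -[X in _ --> X](mulr0 c); exact: cvgM (cvg_cst c) v0. Qed.

Lemma continuous_cexp : continuous (@cexp R).
Proof.
move=> z; apply: differentiable_continuous; apply/derivable1_diffP.
by have [] := is_derive_cexp z.
Qed.

Lemma cvg_cexp (T : Type) (F : set_system T) {FF : Filter F} (f : T -> R[i]) z :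
  f @ F --> z -> (fun t => cexp (f t)) @ F --> cexp z.
Proof. by move=> fz; exact: (cvg_comp f (@cexp R) fz (@continuous_cexp z)). Qed.

(** For the partial sums $e_N$, the derivative of $e^{-z} e_{N+1}(z)$ collapses to $-e^{-z} z^N/N!$;
    by the mean value inequality this function, which is 1 at 0, tends to 1 at u. *)
Lemma cvg_cexp_series u : (fun N => \sum_(0 <= n < N) u ^+ n / n`!%:R) @ \oo --> cexp u.
Proof.
pose e N z := \sum_(0 <= n < N) z ^+ n / n`!%:R : R[i].
have de z N : is_derive z 1 (e N.+1) (e N z).
  rewrite /e (_ : (fun z => _) = fun z => 1 + \sum_(0 <= n < N) z ^+ n.+1 / n.+1`!%:R); last first.
    by apply/funext => w; rewrite big_nat_recl // expr0 fact0 divr1.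
  have ds : is_derive z 1 (fun w => \sum_(0 <= n < N) w ^+ n.+1 / n.+1`!%:R) (e N z).
    apply: (@is_derive_sum_seq (fun n w => w ^+ n.+1 / n.+1`!%:R)
      (fun n w => w ^+ n / n`!%:R)) => n.
    have dn := is_deriveZ ((n.+1`!%:R)^-1) (is_derive_powS z n).
    rewrite (_ : (fun w => _) = (n.+1`!%:R)^-1 \*: (fun w => w ^+ n.+1)); last first.
      by apply/funext => w /=; rewrite mulrC.
    apply: (is_derive_eq dn); rewrite /GRing.scale /= factS natrM.
    by rewrite invfM mulrACA mulVf ?pnatr_eq0 // mul1r mulrC.
  by have := is_deriveD (is_derive_cst (1 : R[i]) z 1) ds; rewrite add0r.
pose g N z := cexp (- z) * e N z.
have dg z N : is_derive z 1 (g N.+1) (- cexp (- z) * (z ^+ N / N`!%:R)).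
  have dN : is_derive z 1 (fun w => cexp (- w)) (- cexp (- z)).
    have := is_derive_cexp_comp (is_deriveNid z 1).
    by rewrite mulrN1.
  apply: (is_derive_eq (is_deriveM dN (de z N))).
  rewrite /GRing.scale /= /e (big_nat_recr N) //=; ring.
have gu : (fun N => g N u) @ \oo --> (1 : R[i]).
  apply: (squeeze1 (k := 1%N) (b := fun N => (2 * expR (modulus u) * modulus u) * exp_coeff (modulus u) N)).
    by apply: cvgZ0; exact: cvg_exp_coeff.
  move=> N; rewrite addn1.
  have g0 : g N.+1 0 = 1.
    rewrite /g oppr0 cexp0 mul1r /e big_nat_recl // expr0 fact0 divr1 big1 ?addr0 // => i _.
    by rewrite expr0n mul0r.
  rewrite -[X in modulus (_ - X)]g0.
  apply: (le_trans (@complex_mean_value R (g N.+1) (fun z => - cexp (- z) * (z ^+ N / N`!%:R)) u (expR (modulus u) * exp_coeff (modulus u) N) _)).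
    move=> s s01; split; first exact: dg.
    rewrite modulusM modulusN modulus_cexp modulusM modulusV modulusX modulus_nat.
    have su : modulus (s%:C%C * u) <= modulus u.
      by rewrite modulusM modulus_real ger0_norm ?ler_piMl ?modulus_ge0 //; lra.
    rewrite ler_pM ?expR_ge0 ?divr_ge0 ?exprn_ge0 ?modulus_ge0 //.
      rewrite ler_expR (le_trans (ler_norm _)) // (le_trans (Re_le_modulus _)) // modulusN.
      exact: su.
    by rewrite /exp_coeff /= ler_wpM2r ?invr_ge0 // lerXn2r ?nnegrE ?modulus_ge0.
  by rewrite le_eqVlt; apply/orP; left; apply/eqP; ring.
have -> : (fun N => \sum_(0 <= n < N) u ^+ n / n`!%:R) = fun N => cexp u * g N u.
  by apply/funext => N; rewrite /g mulrA [cexp u * _]mulrC cexpN mul1r.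
by rewrite -[X in _ --> X]mulr1; exact: cvgM (cvg_cst (cexp u)) gu.
Qed.

Let log_partial N z : R[i] := \sum_(0 <= n < N) z ^+ n.+1 / n.+1%:R.

Lemma sum_geometric_le (r : R) N : 0 <= r < 1 ->
  \sum_(0 <= n < N) r ^+ n.+1 <= r / (1 - r).
Proof.
move=> /andP[r0 r1]; rewrite ler_pdivlMr ?subr_gt0 // mulr_suml.
have -> : \sum_(0 <= n < N) r ^+ n.+1 * (1 - r) = r - r ^+ N.+1.
  elim: N => [|N IH]; first by rewrite big_nil expr1 subrr.
  by rewrite big_nat_recr //= IH !exprS; ring.
by rewrite lerBlDr lerDl exprn_ge0.
Qed.

Let modulus_log_partial N z : modulus z < 1 ->
  modulus (log_partial N z) <= modulus z / (1 - modulus z).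
Proof.
move=> z1; have z0 := modulus_ge0 z.
apply: (le_trans _ (@sum_geometric_le (modulus z) N _)); last by rewrite z0.
rewrite /log_partial; elim: N => [|N IH]; first by rewrite !big_nil modulus0.
rewrite !big_nat_recr //= (le_trans (modulusD _ _)) // lerD // modulusM modulusX.
rewrite modulusV modulus_nat ler_piMr ?exprn_ge0 // invf_le1 ?ler1n ?ltr0n //.
Qed.

(** The partial sums $L_N$ make $(1 - z) e^{L_N(z)}$ have derivative $-z^N e^{L_N(z)}$, which tends
    to 0 uniformly on the segment from 0 to u; the value at 0 is 1. *)
Lemma cexp_log_series u l : modulus u < 1 ->
  (fun N => \sum_(0 <= n < N) u ^+ n.+1 / n.+1%:R) @ \oo --> l -> cexp (- l) = 1 - u.
Proof.
move=> u1 ul.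
pose f N z := (1 - z) * cexp (log_partial N z).
have dlog z N : is_derive z 1 (log_partial N) (\sum_(0 <= n < N) z ^+ n).
  apply: (@is_derive_sum_seq (fun n w => w ^+ n.+1 / n.+1%:R) (fun n w => w ^+ n)) => n.
  have dn := is_deriveZ (n.+1%:R^-1) (is_derive_powS z n).
  rewrite (_ : (fun w => _) = (n.+1%:R)^-1 \*: (fun w => w ^+ n.+1)); last first.
    by apply/funext => w /=; rewrite mulrC.
  by apply: (is_derive_eq dn); rewrite /GRing.scale /= mulKf // pnatr_eq0.
have geo z N : (1 - z) * (\sum_(0 <= n < N) z ^+ n) = 1 - z ^+ N.
  elim: N => [|N IH]; first by rewrite big_nil mulr0 expr0 subrr.
  by rewrite big_nat_recr //= mulrDr IH exprS; ring.
have df z N : is_derive z 1 (f N) (- z ^+ N * cexp (log_partial N z)).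
  have d1 : is_derive z 1 (fun w => 1 - w) (-1).
    by have := is_deriveB (is_derive_cst (1 : R[i]) z 1) (is_derive_id z 1); rewrite sub0r.
  apply: (is_derive_eq (is_deriveM d1 (is_derive_cexp_comp (dlog z N)))).
  rewrite /GRing.scale /= mulrCA geo; ring.
pose b := modulus u / (1 - modulus u).
have u0 := modulus_ge0 u.
have fu : (fun N => f N u) @ \oo --> (1 : R[i]).
  apply: (squeeze1 (k := 0%N) (b := fun N => (2 * expR b * modulus u) * modulus u ^+ N)).
    by apply: cvgZ0; apply: cvg_expr; rewrite ger0_norm.
  move=> N; rewrite addn0.
  have f0 : f N 0 = 1.
    rewrite /f /log_partial big1 ?subr0 ?cexp0 ?mulr1 // => i _.
    by rewrite exprS mul0r mul0r.
  rewrite -[X in modulus (_ - X)]f0.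
  apply: (le_trans (@complex_mean_value R (f N) (fun z => - z ^+ N * cexp (log_partial N z)) u (modulus u ^+ N * expR b) _)).
    move=> s s01; split; first exact: df.
    have su : modulus (s%:C%C * u) <= modulus u.
      by rewrite modulusM modulus_real ger0_norm ?ler_piMl //; lra.
    rewrite modulusM modulusN modulus_cexp modulusX.
    rewrite ler_pM ?expR_ge0 ?exprn_ge0 ?modulus_ge0 //.
      by rewrite lerXn2r ?nnegrE ?modulus_ge0.
    rewrite ler_expR (le_trans (ler_norm _)) // (le_trans (Re_le_modulus _)) //.
    apply: (le_trans (modulus_log_partial N (le_lt_trans su u1))).
    rewrite /b ler_pM ?modulus_ge0 ?invr_ge0 ?subr_ge0 ?(ltW (le_lt_trans su u1)) //.
    rewrite lef_pV2 ?posrE ?subr_gt0 ?(le_lt_trans su u1) //.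
    by rewrite lerD2l lerN2.
  by rewrite le_eqVlt; apply/orP; left; apply/eqP; ring.
have fl : (fun N => f N u) @ \oo --> (1 - u) * cexp l.
  exact: (cvgM (cvg_cst (1 - u)) (cvg_cexp ul)).
have E : (1 - u) * cexp l = 1 by exact: (complex_cvg_unique fl fu).
by apply: (mulIf (cexp_neq0 l)); rewrite E cexpN.
Qed.

Lemma is_cvg_log_series u : modulus u < 1 ->
  cvgn (fun N => \sum_(0 <= n < N) u ^+ n.+1 / n.+1%:R).
Proof.
move=> u1; have u0 := modulus_ge0 u.
apply: (cvg_complex_series (b := geometric (modulus u) (modulus u))).
  by apply: is_cvg_geometric_series; rewrite ger0_norm.
move=> N; rewrite big_nat_recr //= addrAC subrr add0r modulusM modulusX modulusV.
rewrite modulus_nat /geometric /= -exprS ler_piMr ?exprn_ge0 //.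
by rewrite invf_le1 ?ler1n ?ltr0n.
Qed.

End ExpLogSeries.

(** * Logarithm of the canonical product *)

Section PairWeight.
Variable R : realType.
Implicit Types q : R.

Let unpair (i : nat) : option (nat * nat) := pickle_inv i.
Let pair_code : nat * nat -> nat := choice.pickle.

(** The double family $q^{i+j+1}$ listed along a coding of pairs. An integer coding no pair gets 0,
    that is, a factor 1 of the product and no zero. *)
Definition pair_weight q (i : nat) : R :=
  if (pickle_inv i : option (nat * nat)) is Some k then q ^+ (k.1 + k.2).+1 else 0.

Lemma pair_weight_ge0 q i : 0 <= q -> 0 <= pair_weight q i.
Proof. by move=> q0; rewrite /pair_weight; case: pickle_inv => // k; rewrite exprn_ge0. Qed.

Lemma pair_weight_le1 q i : 0 <= q <= 1 -> pair_weight q i <= 1.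
Proof.
by move=> q01; rewrite /pair_weight; case: pickle_inv => // k; rewrite exprn_ile1; lra.
Qed.

Lemma pair_weightX q i n : pair_weight q i ^+ n.+1 = pair_weight (q ^+ n.+1) i.
Proof.
rewrite /pair_weight; case: pickle_inv => [k|]; last by rewrite expr0n.
by rewrite -!exprM mulnC.
Qed.

Let nneseries_geometric q c : 0 <= q < 1 -> 0 <= c ->
  (\sum_(i <oo) (c * q ^+ i)%:E = (c / (1 - q))%:E)%E.
Proof.
move=> q01 c0; apply: cvg_lim => //.
rewrite (_ : (fun n => _) = EFin \o series (geometric c q)); last first.
  by apply/funext => n /=; rewrite /series /= sumEFin.
apply: cvg_EFin; first by apply: nearW.
rewrite (_ : fine \o _ = series (geometric c q)) //.
by apply: cvg_geometric_series; rewrite ger0_norm; lra.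
Qed.

(** The sum is passed to nonnegative extended reals, where reindexing by pairs and iterated
    summation are free; two geometric series remain. *)
Lemma cvg_pair_weight q : 0 <= q < 1 ->
  series (pair_weight q) @ \oo --> q / (1 - q) ^+ 2.
Proof.
move=> q01; have q0 : 0 <= q by lra.
have w0 i : (0 <= (pair_weight q i)%:E)%E by rewrite lee_fin pair_weight_ge0.
have E : (\sum_(i <oo) (pair_weight q i)%:E = (q / (1 - q) ^+ 2)%:E)%E.
  rewrite nneseries_esumT //.
  rewrite (_ : (\esum_(i in [set: nat]) (pair_weight q i)%:E =
      \esum_(i in range pair_code) (pair_weight q i)%:E)%E); last first.
    rewrite [RHS]esum_mkcond; apply: eq_esum => i _; case: ifPn => // /negP ni.
    rewrite /pair_weight; case E : (unpair i) => [k|]; last by move: E; rewrite /unpair => ->.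
    exfalso; apply: ni; apply: mem_set; exists k => //.
    by have := pickle_invK i : oapp pair_code i (unpair i) = i; rewrite E.
  rewrite (@esum_image R _ _ setT pair_code); last first.
    by move=> x y _ _ /(pcan_inj choice.pickleK).
  rewrite (eq_esum (b := fun k : nat * nat => (q ^+ (k.1 + k.2).+1)%:E)); last first.
    by move=> k _; rewrite /pair_weight pickleK_inv.
  have -> : [set: nat * nat] = [set: nat] `*`` (fun=> [set: nat]).
    by apply/seteqP; split.
  rewrite -(@esum_esum R nat nat setT (fun=> setT) (fun i j => (q ^+ (i + j).+1)%:E)); last first.
    by move=> i j _ _; rewrite lee_fin exprn_ge0.
  rewrite (eq_esum (b := fun i => (q / (1 - q) * q ^+ i)%:E)); last first.
    move=> i _; rewrite -nneseries_esumT; last by move=> j; rewrite lee_fin exprn_ge0.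
    rewrite (eq_eseriesr (g := fun j => (q ^+ i.+1 * q ^+ j)%:E)); last first.
      by move=> j _; rewrite -exprD addSn.
    by rewrite nneseries_geometric ?exprn_ge0 // exprS mulrAC.
  have c0 : 0 <= q / (1 - q) by rewrite divr_ge0 // subr_ge0; lra.
  rewrite -nneseries_esumT; last by move=> i; rewrite lee_fin mulr_ge0 // exprn_ge0.
  by rewrite nneseries_geometric // expr2 invfM mulrA.
have cv : (fun n => (\sum_(0 <= i < n) (pair_weight q i)%:E)%E) @ \oo --> (q / (1 - q) ^+ 2)%:E.
  by rewrite -E; exact: (is_cvg_nneseries (fun n _ _ => w0 n)).
rewrite (_ : series _ = fine \o (fun n => (\sum_(0 <= i < n) (pair_weight q i)%:E)%E)).
  exact: fine_cvg cv.
by apply/funext => n /=; rewrite sumEFin.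
Qed.

End PairWeight.

Section LogOfProduct.
Variables (R : realType) (a : nat -> R) (s : nat -> R).
Hypothesis a_ge0 : forall i, 0 <= a i.
Hypothesis a_le1 : forall i, a i <= 1.
Hypothesis a_cvg : cvgn (series a).
Hypothesis s_cvg : forall n, series (fun i => a i ^+ n.+1) @ \oo --> s n.
Implicit Types (z w : R[i]).

Let A := limn (series a).

Let a_pow_le i n : a i ^+ n.+1 <= a i.
Proof. by rewrite exprS ler_piMr // exprn_ile1. Qed.

Let series_pow_mono n : nondecreasing_seq (series (fun i => a i ^+ n.+1)).
Proof.
apply/nondecreasing_seqP => m.
by rewrite /series /= big_nat_recr //= lerDl exprn_ge0.
Qed.

Let tail_ge0 M n : 0 <= s n - series (fun i => a i ^+ n.+1) M.
Proof.
rewrite subr_ge0 -(cvg_lim _ (@s_cvg n)) //.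
apply: nondecreasing_cvgn_le => //.
by apply/cvg_ex; exists (s n).
Qed.

(** As $0 \le a_i \le 1$, the tails of all power sums are dominated by the tail of $\sum a_i$,
    uniformly in n. *)
Let tail_le M n : s n - series (fun i => a i ^+ n.+1) M <= A - series a M.
Proof.
have H k : series (fun i => a i ^+ n.+1) k - series (fun i => a i ^+ n.+1) M <= A - series a M.
  have [kM|/ltnW Mk] := leqP k M.
    apply: (@le_trans _ _ 0); first by rewrite subr_le0 series_pow_mono.
    rewrite subr_ge0; apply: nondecreasing_cvgn_le => //.
    by apply/nondecreasing_seqP => m; rewrite /series /= big_nat_recr //= lerDl.
  apply: (@le_trans _ _ (series a k - series a M)).
    rewrite !sub_series_geq //; apply: ler_sum => i _; exact: a_pow_le.
  rewrite lerD2r; apply: nondecreasing_cvgn_le => //.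
  by apply/nondecreasing_seqP => m; rewrite /series /= big_nat_recr //= lerDl.
rewrite lerBlDr.
rewrite -(cvg_lim _ (@s_cvg n)) //; apply: limr_le.
  by apply/cvg_ex; exists (s n).
by apply: nearW => k; have := H k; rewrite lerBlDr.
Qed.

(** The double series $\sum_i \sum_n (a_i z)^n/n$ is summed in the other order. Truncation at M
    factors costs at most $(A - \sum_{i<M} a_i) |z|/(1 - |z|)$, uniformly in the number N of powers,
    which justifies the exchange. *)
Lemma genus0_prod_log z : modulus z < 1 ->
  exists2 S : R[i], series (fun n => (s n / n.+1%:R)%:C%C * z ^+ n.+1) @ \oo --> S
    & genus0_prod a z = cexp (- S).
Proof.
move=> z1; set r := modulus z; have r0 : 0 <= r by exact: modulus_ge0.
pose L N := \sum_(0 <= n < N) (s n / n.+1%:R)%:C%C * z ^+ n.+1 : R[i].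
pose LM M N := \sum_(0 <= n < N)
  (series (fun i => a i ^+ n.+1) M / n.+1%:R)%:C%C * z ^+ n.+1 : R[i].
pose C := r / (1 - r).
have diff_bound M N : modulus (L N - LM M N) <= (A - series a M) * C.
  apply: (@le_trans _ _ ((A - series a M) * \sum_(0 <= n < N) r ^+ n.+1)); last first.
    apply: ler_wpM2l; first exact: le_trans (tail_ge0 M 0) (tail_le M 0).
    by apply: sum_geometric_le; rewrite r0.
  elim: N => [|N IH]; first by rewrite /L /LM !big_nil subrr modulus0 mulr0.
  rewrite /L /LM !big_nat_recr //= -/(L N) -/(LM M N) opprD addrACA mulrDr.
  rewrite (le_trans (modulusD _ _)) // lerD // -mulrBl -rmorphB -mulrBl.
  rewrite modulusM modulusX modulus_real ger0_norm ?divr_ge0 // -/r.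
  rewrite ler_wpM2r ?exprn_ge0 // (le_trans _ (tail_le M N)) // ler_piMr //.
  by rewrite invf_le1 ?ler1n ?ltr0n.
have cL : cvgn L.
  apply: (cvg_complex_series (b := geometric (A * r) r)).
    by apply: is_cvg_geometric_series; rewrite ger0_norm.
  move=> N; rewrite /L big_nat_recr //= addrAC subrr add0r.
  have s0 : 0 <= s N by have := tail_ge0 0 N; rewrite /series /= big_geq // subr0.
  have sA : s N <= A by have := tail_le 0 N; rewrite /series /= !big_geq // !subr0.
  rewrite modulusM modulusX modulus_real ger0_norm ?divr_ge0 // -/r /geometric /=.
  rewrite -[leRHS]mulrA -exprS ler_wpM2r ?exprn_ge0 // (le_trans _ sA) // ler_piMr //.
  by rewrite invf_le1 ?ler1n ?ltr0n.
have /cvg_ex[S LS] := cL; exists S; first exact: LS.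
have az i : modulus ((a i)%:C%C * z) < 1.
  by rewrite modulusM modulus_real ger0_norm // (le_lt_trans _ z1) // ler_piMl.
have [l Hl] : exists l : nat -> R[i], forall i,
    (fun N => \sum_(0 <= n < N) ((a i)%:C%C * z) ^+ n.+1 / n.+1%:R) @ \oo --> l i.
  have H i : exists y : R[i], (fun N => \sum_(0 <= n < N) ((a i)%:C%C * z) ^+ n.+1 / n.+1%:R) @ \oo --> y.
    by have /cvg_ex[y Hy] := is_cvg_log_series (az i); exists y.
  by exists (fun i => sval (cid (H i))) => i; exact: (svalP (cid (H i))).
pose lM M := \sum_(0 <= i < M) l i : R[i].
have LMl M : LM M @ \oo --> lM M.
  elim: M => [|M IH].
    rewrite /lM big_nil (_ : LM 0%N = cst 0); first exact: cvg_cst.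
    apply/funext => N; rewrite /LM big1 // => n _.
    by rewrite /series /= big_nil mul0r mul0r.
  have -> : lM M.+1 = lM M + l M by rewrite /lM big_nat_recr.
  rewrite (_ : LM M.+1 = fun N => LM M N + \sum_(0 <= n < N) ((a M)%:C%C * z) ^+ n.+1 / n.+1%:R).
    exact: cvgD IH (Hl M).
  apply/funext => N; rewrite /LM -big_split /=; apply: eq_bigr => n _.
  rewrite /series /= big_nat_recr //= mulrDl rmorphD mulrDl; congr (_ + _).
  by rewrite exprMn rmorphM rmorphXn /= fmorphV rmorph_nat mulrAC.
have PM M : \prod_(0 <= i < M) (1 - (a i)%:C%C * z) = cexp (- lM M).
  elim: M => [|M IH]; first by rewrite /lM !big_nil oppr0 cexp0.
  rewrite big_nat_recr //= IH /lM big_nat_recr //= opprD cexpD.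
  by rewrite (cexp_log_series (az M) (Hl M)).
have lMS : lM @ \oo --> S.
  apply/cvg_modulusP => e e0.
  have C0 : 0 <= C by rewrite divr_ge0 // subr_ge0 ltW.
  have e1 : 0 < e / (C + 1) by rewrite divr_gt0 // ltr_wpDl.
  have /cvgrPdist_le/(_ _ e1) := a_cvg; apply: filterS => M; rewrite -/A => AM.
  have B : modulus (S - lM M) <= (A - series a M) * C.
    apply: (@cvg_modulus_le _ (fun N => L N - LM M N)); last exact: diff_bound.
    exact: (cvgB LS (@LMl M)).
  apply: (le_trans B); have := le_trans (ler_norm _) AM.
  move=> /(ler_wpM2r C0)/le_trans; apply.
  by rewrite mulrAC ler_pdivrMr ?ltr_wpDl // ler_pM2l // lerDl.
apply: (@complex_cvg_unique _ (fun M => \prod_(0 <= i < M) (1 - (a i)%:C%C * z))).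
  exact: cvg_genus0_prod.
under eq_cvg => M do rewrite PM.
by apply: cvg_cexp; exact: cvgN lMS.
Qed.

End LogOfProduct.

(** * Order and genus *)

Section Genus.
Variable R : realType.
Implicit Types (f : R[i] -> R[i]) (z : R[i]).

Let growth f (r : R) : R :=
  lnplus (lnplus (sup [set modulus (f z) | z in [set z | modulus z <= r]])) / ln r.

Lemma le_lnplus (x y : R) : x <= y -> lnplus x <= lnplus y.
Proof.
move=> xy; rewrite /lnplus ler_ln ?posrE ?lt_max ?ltr01 //.
by rewrite ge_max !le_max lexx xy /= orbT.
Qed.

Lemma lnplus_expR (x : R) : 0 <= x -> lnplus (expR x) = x.
Proof. by move=> x0; rewrite /lnplus max_r ?expRK // -expR0 ler_expR. Qed.

Lemma finite_entire_order f (C : R) (m : nat) : 1 <= C ->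
  (forall (r : R) z, 1 <= r -> modulus z <= r -> modulus (f z) <= expR (C * r ^+ m)) ->
  (entire_order f < +oo)%E.
Proof.
move=> C1 H; apply: (@le_lt_trans _ _ (ln C + m%:R)%:E); last exact: ltry.
rewrite /entire_order /limf_esup.
(* Beyond e the logarithm exceeds 1, so $\ln C/\ln r \le \ln C$. *)
set V := [set r : R | expR 1 < r].
apply: (@le_trans _ _ (ereal_sup ((fun r => (growth f r)%:E) @` V))).
  apply: ereal_inf_lbound; exists V => //.
  by exists (expR 1); split; rewrite ?num_real.
apply: ge_ereal_sup => _ [r /= er <-]; rewrite lee_fin /growth.
have r0 : 0 < r by rewrite (lt_trans _ er) // expR_gt0.
have lr1 : 1 < ln r by rewrite -[X in X < _](@expRK R) ltr_ln // posrE expR_gt0.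
have r1 : 1 <= r by rewrite (le_trans _ (ltW er)) // -[leLHS](@expR0 R) ler_expR.
have C0 : 0 < C by lra.
have Cr1 : 1 <= C * r ^+ m by rewrite (le_trans C1) // ler_peMr ?exprn_ege1 //; lra.
rewrite ler_pdivrMr; last lra.
set S := sup _.
have SC : S <= expR (C * r ^+ m).
  apply: ge_sup.
    by exists (modulus (f 0)); exists 0 => //=; rewrite modulus0 ltW.
  by move=> _ [z /= zr <-]; exact: H.
have l1 : lnplus S <= C * r ^+ m.
  by rewrite (le_trans (le_lnplus SC)) // lnplus_expR //; lra.
rewrite (le_trans (le_lnplus l1)) // /lnplus max_r //.
rewrite lnM ?posrE ?exprn_gt0 // lnXn // mulrDl -[ln r *+ m]mulr_natl lerD2r.
by rewrite ler_peMr ?ln_ge0 // ltW.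
Qed.

(** The majorant B makes the supremum over each disc that of a bounded set. The values on the
    negative axis then give an iterated logarithm of at least r - 1, which outgrows every multiple
    of ln r. *)
Lemma infinite_entire_order f (B : R -> R) :
  (forall r z, modulus z <= r -> modulus (f z) <= B r) ->
  (forall r, 0 <= r -> expR (expR r - 1) <= modulus (f (- r%:C%C))) ->
  entire_order f = +oo%E.
Proof.
move=> fB H; apply/eqP; rewrite -leye_eq /entire_order /limf_esup.
apply: le_ereal_inf_tmp => _ [V [M [_ MV]] <-].
rewrite leye_eq; apply/eqP/eqyP => A A0.
(* M + 1 puts r in the given neighbourhood of infinity. With $s = \sqrt r \ge 2A + 1$ and $\ln r \le
   2s$, one gets $A \ln r \le 2As \le s^2 - s \le r - 1$. *)
pose r := Num.max (M + 1) (Num.max 4 ((2 * A + 1) ^+ 2)).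
have rM : M < r by rewrite lt_max; apply/orP; left; lra.
have r4 : 4 <= r by rewrite !le_max lexx !orbT.
have rA : (2 * A + 1) ^+ 2 <= r by rewrite !le_max lexx !orbT.
apply: (@le_trans _ _ (growth f r)%:E); last first.
  by apply: ereal_sup_ubound; exists r => //; exact: MV.
have r0 : 0 <= r by lra.
rewrite lee_fin /growth ler_pdivlMr; last by rewrite ln_gt0 //; lra.
set S := sup _.
have SE : expR (expR r - 1) <= S.
  apply: (le_trans (H r r0)); apply: ub_le_sup.
    by exists (B r) => _ [z /= zr <-]; exact: fB.
  by exists (- r%:C%C) => //=; rewrite modulusN modulus_real ger0_norm.
have e1 : 2 <= expR 1 :> R by have := @expR_ge1Dx R 1; lra.
have er : expR (r - 1) <= expR r - 1.
  have -> : expR r = expR (r - 1) * expR 1 by rewrite -expRD subrK.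
  have : 1 <= expR (r - 1) by rewrite -[leLHS](@expR0 R) ler_expR; lra.
  have : expR (r - 1) * 2 <= expR (r - 1) * expR 1 by rewrite ler_wpM2l // expR_ge0.
  lra.
have l1 : expR (r - 1) <= lnplus S.
  rewrite (le_trans _ (le_lnplus SE)) // lnplus_expR //.
  by rewrite (le_trans _ er) // expR_ge0.
have l2 : r - 1 <= lnplus (lnplus S).
  by rewrite (le_trans _ (le_lnplus l1)) // lnplus_expR //; lra.
rewrite (le_trans _ l2) //.
pose s := Num.sqrt r.
have s0 : 0 < s by rewrite sqrtr_gt0; lra.
have rs : r = s ^+ 2 by rewrite sqr_sqrtr.
have sA : 2 * A + 1 <= s.
  rewrite -[leLHS]ger0_norm ?addr_ge0 ?mulr_ge0 // ?(ltW A0) // -sqrtr_sqr.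
  by rewrite ler_wsqrtr.
have lns : ln r <= 2 * s.
  rewrite rs lnXn // -[ln s *+ 2]mulr_natl ler_pM2l //; exact/ltW/ln_sublinear.
apply: (@le_trans _ _ (A * (2 * s))); first by rewrite ler_wpM2l // ltW.
rewrite rs expr2.
have : (2 * A + 1) * s <= s * s by rewrite ler_wpM2r // ltW.
have : 1 <= s by lra.
lra.
Qed.

Variable a : nat -> R.
Hypothesis a_ge0 : forall i, 0 <= a i.
Hypothesis a_cvg : cvgn (series a).

Let A := limn (series a).

Let A0 : 0 <= A.
Proof.
apply: limr_ge => //; apply: nearW => n; rewrite /series /=.
by apply: sumr_ge0 => i _.
Qed.

Lemma entire_horner (Q : {poly R[i]}) : entire (fun z => Q.[z]).
Proof.
elim/poly_ind: Q => [|Q c IH].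
  by rewrite (_ : (fun z => _) = cst 0); [exact: entire_cst|apply/funext => z; rewrite horner0].
rewrite (_ : (fun z => _) = (fun z => Q.[z] * z) + cst c); last first.
  by apply/funext => z; rewrite hornerMXaddC.
move=> z; apply: derivableD; last exact: derivable_cst.
by apply: derivableM; [exact: IH|exact: derivable_id].
Qed.

Let horner_bound (Q : {poly R[i]}) : exists2 C : R, 0 <= C &
  forall (r : R) z, 1 <= r -> modulus z <= r -> modulus Q.[z] <= C * r ^+ size Q.
Proof.
exists (\sum_(i < size Q) modulus Q`_i); first by apply: sumr_ge0 => i _; exact: modulus_ge0.
move=> r z r1 zr; rewrite horner_coef mulr_suml.
have B (n : nat) (F : 'I_n -> R[i]) (G : 'I_n -> R) :
    (forall i, modulus (F i) <= G i) -> modulus (\sum_i F i) <= \sum_i G i.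
  elim: n F G => [|n IH] F G FG; first by rewrite !big_ord0 modulus0.
  by rewrite !big_ord_recl (le_trans (modulusD _ _)) // lerD // IH.
apply: B => i; rewrite modulusM modulusX ler_wpM2l ?modulus_ge0 //.
have r0 : 0 <= r by lra.
apply: (@le_trans _ _ (r ^+ i)); first by rewrite lerXn2r ?nnegrE ?modulus_ge0.
by rewrite ler_weXn2l // ltnW.
Qed.

Lemma has_genus_finite (Q : {poly R[i]}) :
  has_genus (fun z => genus0_prod a z * cexp Q.[z]) (Some (size Q).-1).
Proof.
have a_cvg0 z : (fun n => \prod_(0 <= i < n) (1 - (a i)%:C%C * z)) @ \oo --> genus0_prod a z.
  exact: cvg_genus0_prod.
split.
- have [C C0 HC] := horner_bound Q.
  apply: (@finite_entire_order _ (A + C + 1) (size Q).+1); first by have := A0; lra.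
  move=> r z r1 zr; rewrite modulusM modulus_cexp.
  apply: (@le_trans _ _ (expR (r * A) * expR (C * r ^+ size Q))).
    rewrite ler_pM ?modulus_ge0 ?expR_ge0 //.
      rewrite (le_trans (modulus_genus0_prod_le a_ge0 a_cvg z)) //.
      by rewrite ler_expR ler_wpM2r.
    by rewrite ler_expR (le_trans (ler_norm _)) // (le_trans (Re_le_modulus _)) // HC.
  rewrite -expRD ler_expR.
  have r0 : 0 <= r by lra.
  have e1 : r <= r ^+ (size Q).+1 by rewrite exprS ler_peMr // exprn_ege1.
  have e2 : C * r ^+ size Q <= C * r ^+ (size Q).+1 by rewrite ler_wpM2l // ler_weXn2l.
  have e3 : r * A <= r ^+ (size Q).+1 * A by rewrite ler_wpM2r.
  have e4 : 0 <= r ^+ (size Q).+1 by rewrite exprn_ge0.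
  rewrite !mulrDl mul1r; lra.
- rewrite mulf_neq0 ?cexp_neq0 //; apply: genus0_prod_neq0 => // i.
  by rewrite mulr0 eq_sym oner_eq0.
(* The formula already is the Hadamard factorization: $E(u, 0) = 1 - u$, and p = 0 is minimal since
   the inverse zeros $a_i$ are summable. *)
exists (fun i => a i != 0), (fun i => (a i)%:C%C^-1), 0%N, Q.
have fac i z : weierstrass_factor 0 (z / (a i)%:C%C^-1) = 1 - (a i)%:C%C * z.
  by rewrite /weierstrass_factor big_geq // cexp0 mulr1 invrK mulrC.
split.
- move=> w; have [k zk ck] := zero_mult_genus0_prod w a_ge0 a_cvg.
  exists k; last exact: ck.
  apply: (zero_mult_unit _ _ zk); last exact: cexp_neq0.
  exact/entire_cexp_comp/entire_horner.
- rewrite /zeros_summable; apply: (@le_lt_trans _ _ A%:E); last exact: ltry.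
  apply: lime_le.
    by apply: is_cvg_nneseries_cond => n _ _; rewrite lee_fin invr_ge0 exprn_ge0 // modulus_ge0.
  apply: nearW => n; apply: (@le_trans _ _ (series a n)%:E).
    rewrite big_mkcond /= /series /= -sumEFin; apply: lee_sum => i _.
    case: ifP => _; last by rewrite lee_fin.
    by rewrite modulusV modulus_real ger0_norm // expr1 invrK.
  rewrite lee_fin; apply: nondecreasing_cvgn_le => //.
  by apply/nondecreasing_seqP => m; rewrite /series /= big_nat_recr //= lerDl.
- by [].
- move=> z; rewrite [X in _ --> X]mulrC.
  rewrite (_ : (fun N => _) = fun N => cexp Q.[z] * \prod_(0 <= i < N) (1 - (a i)%:C%C * z)).
    exact: cvgM (cvg_cst _) (a_cvg0 z).
  apply/funext => N; congr (_ * _); rewrite big_mkcond /=; apply: eq_bigr => i _.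
  by case: eqP => [->|_]; rewrite ?fac //= rmorph0 mul0r subr0.
- by rewrite maxn0.
Qed.

(** The sign in $e^{-z}$ makes the growth occur at z = -r, where every factor $1 + a_i r$ is at
    least 1 and the product cannot destroy it. *)
Lemma has_genus_infinite :
  has_genus (fun z => genus0_prod a z * cexp (cexp (- z) - 1)) None.
Proof.
apply: (@infinite_entire_order _ (fun r => expR (r * A) * expR (expR r + 1))).
  move=> r z zr; rewrite modulusM modulus_cexp.
  rewrite ler_pM ?modulus_ge0 ?expR_ge0 //.
    rewrite (le_trans (modulus_genus0_prod_le a_ge0 a_cvg z)) //.
    by rewrite ler_expR ler_wpM2r.
  rewrite ler_expR (le_trans (ler_norm _)) // (le_trans (Re_le_modulus _)) //.
  rewrite (le_trans (modulusB _ _)) // modulus1 lerD2r modulus_cexp ler_expR.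
  by rewrite (le_trans (ler_norm _)) // (le_trans (Re_le_modulus _)) // modulusN.
move=> r r0; rewrite opprK cexp_real modulusM modulus_cexp ReB /=.
rewrite ler_peMl ?expR_ge0 //.
apply: (@cvg_modulus_ge _ (fun n => \prod_(0 <= i < n) (1 - (a i)%:C%C * (- r%:C%C)))).
  exact: cvg_genus0_prod.
move=> n; rewrite modulus_prod; elim: n => [|n IH]; first by rewrite big_nil.
rewrite big_nat_recr //= mulr_ege1 // mulrN opprK -rmorphM.
rewrite (_ : 1 + _ = (1 + a n * r)%:C%C); last by rewrite rmorphD rmorph1.
rewrite modulus_real.
by rewrite ger0_norm ?lerDl ?addr_ge0 ?mulr_ge0.
Qed.

End Genus.

(** * Symbolic dynamics *)

Section CantorCode.
Variable R : realType.
Implicit Types (f g : nat -> bool) (j k n : nat).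

Let bit_term f j : R := (f j)%:R * 9^-1 ^+ j.

Definition cantor_code f : R := limn (series (bit_term f)).

Definition shift_bits k f : nat -> bool := fun j => f (k + j)%N.

Let q0 : 0 < 9^-1 :> R. Proof. by rewrite invr_gt0. Qed.
Let q1 : 9^-1 < 1 :> R. Proof. by rewrite invf_lt1 // ltr1n. Qed.

Let bit_term_ge0 f j : 0 <= bit_term f j.
Proof. by rewrite mulr_ge0 // exprn_ge0 // ltW. Qed.

Let bit_term_le f j : bit_term f j <= geometric 1 9^-1 j.
Proof.
rewrite /geometric /= mul1r ler_piMl ?exprn_ge0 ?(ltW q0) //.
by case: (f j).
Qed.

Let cvg_code f : cvgn (series (bit_term f)).
Proof.
apply: series_le_cvg (bit_term_ge0 f) _ (bit_term_le f) _.
  by move=> n; rewrite (le_trans (bit_term_ge0 f n)).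
by apply: is_cvg_geometric_series; rewrite ger0_norm // ltW.
Qed.

(** Iterating the relation expresses $u_0$ as a partial sum of the code plus $9^{-n} u_n$. Thus a
    bounded orbit of an expanding affine recursion is determined by its digits. *)
Lemma cantor_code_unique f (u : nat -> R) (B : R) :
  (forall j, u j = (f j)%:R + 9^-1 * u j.+1) -> (forall j, `|u j| <= B) ->
  u 0%N = cantor_code f.
Proof.
move=> uE uB; apply/esym/cvg_lim => //.
have -> : series (bit_term f) = fun n => u 0%N - 9^-1 ^+ n * u n.
  apply/funext; elim=> [|n IH]; first by rewrite /series /= big_nil expr0 mul1r subrr.
  rewrite /series /= big_nat_recr //= -[X in X + _]/(series (bit_term f) n) IH (uE n) /bit_term exprS.
  by ring.
rewrite -[X in _ --> X]subr0; apply: cvgB; first exact: cvg_cst.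
apply/cvgrPdist_le => e e0.
have B0 : 0 <= B by exact: le_trans (uB 0%N).
have e1 : 0 < e / (B + 1) by rewrite divr_gt0 // ltr_wpDl.
have c : (GRing.exp (9^-1 : R)) @ \oo --> (0 : R) by apply: cvg_expr; rewrite ger0_norm // ltW.
move/cvgrPdist_le: c => /(_ _ e1); apply: filterS => n.
rewrite !sub0r !normrN normrM => H.
rewrite (le_trans (ler_pM _ _ H (uB n))) // mulrAC ler_pdivrMr ?ltr_wpDl //.
by rewrite ler_pM2l // lerDl.
Qed.

Lemma cantor_code_bounds f : 0 <= cantor_code f <= 9 / 8.
Proof.
apply/andP; split.
  apply: limr_ge => //; apply: nearW => n; rewrite /series /=.
  by apply: sumr_ge0 => j _.
apply: limr_le => //; apply: nearW => n.
have : series (bit_term f) n <= series (geometric 1 9^-1) n.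
  by rewrite /series /=; apply: ler_sum => j _; exact: bit_term_le.
move/le_trans; apply; rewrite geometric_seriesE ?lt_eqF //= mul1r.
rewrite ler_pdivrMr ?subr_gt0 // (_ : 9 / 8 * _ = 1); last by field.
by rewrite gerDl oppr_le0 exprn_ge0 // ltW.
Qed.

Lemma cantor_codeS f : cantor_code f = (f 0%N)%:R + 9^-1 * cantor_code (shift_bits 1 f).
Proof.
apply: cvg_lim => //; rewrite -(cvg_shiftn 1).
rewrite (_ : (fun n => _) = fun n => (f 0%N)%:R + 9^-1 * series (bit_term (shift_bits 1 f)) n).
  by apply: cvgD; [exact: cvg_cst|apply: cvgM; [exact: cvg_cst|exact: cvg_code]].
apply/funext => n; rewrite addn1 /series /= big_nat_recl // /bit_term expr0 mulr1.
congr (_ + _); rewrite mulr_sumr; apply: eq_bigr => j _.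
by rewrite /shift_bits add1n exprS mulrCA.
Qed.

Lemma cantor_code0 f : f 0%N = false -> cantor_code f <= 8^-1.
Proof.
move=> f0; rewrite cantor_codeS f0 add0r.
have /andP[_] := cantor_code_bounds (shift_bits 1 f); lra.
Qed.

Lemma cantor_code1 f : f 0%N = true -> 1 <= cantor_code f.
Proof.
move=> f0; rewrite cantor_codeS f0 mulr1n.
have /andP[] := cantor_code_bounds (shift_bits 1 f); lra.
Qed.

Lemma cantor_code_inj f g : cantor_code f = cantor_code g -> f = g.
Proof.
move=> fg; apply/funext => n; elim: n f g fg => [|n IH] f g fg.
  case fE : (f 0%N); case gE : (g 0%N) => //.
    by have := cantor_code1 fE; have := cantor_code0 gE; rewrite fg; lra.
  by have := cantor_code0 fE; have := cantor_code1 gE; rewrite fg; lra.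
have fg0 : f 0%N = g 0%N.
  case fE : (f 0%N); case gE : (g 0%N) => //.
    by have := cantor_code1 fE; have := cantor_code0 gE; rewrite fg; lra.
  by have := cantor_code0 fE; have := cantor_code1 gE; rewrite fg; lra.
suff /IH : cantor_code (shift_bits 1 f) = cantor_code (shift_bits 1 g).
  by rewrite /shift_bits add1n.
move: fg; rewrite cantor_codeS [RHS]cantor_codeS fg0; lra.
Qed.

Lemma shift_bitsD k n f : shift_bits k (shift_bits n f) = shift_bits (n + k) f.
Proof. by apply/funext => j; rewrite /shift_bits addnA. Qed.

Lemma cantor_code_zeros f k : (forall j, (j < k)%N -> f j = false) ->
  cantor_code f = 9^-1 ^+ k * cantor_code (shift_bits k f).
Proof.
elim: k f => [|k IH] f fk.
  by rewrite expr0 mul1r; congr cantor_code; apply/funext => j.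
rewrite cantor_codeS fk // add0r IH => [|j jk]; last by rewrite /shift_bits add1n fk.
by rewrite shift_bitsD add1n exprS mulrA.
Qed.

Lemma cantor_code_close f g n : (forall j, (j < n)%N -> f j = g j) ->
  `|cantor_code f - cantor_code g| <= 2 * 9^-1 ^+ n.
Proof.
elim: n f g => [|n IH] f g fg.
  rewrite expr0 mulr1.
  have /andP[] := cantor_code_bounds f; have /andP[] := cantor_code_bounds g.
  by rewrite ler_norml; lra.
rewrite (cantor_codeS f) (cantor_codeS g) fg // opprD addrACA subrr add0r -mulrBr.
rewrite normrM ger0_norm ?(ltW q0) // exprS mulrCA ler_pM2l // IH // => j jn.
by rewrite /shift_bits add1n fg.
Qed.

End CantorCode.

(* the concatenation of all finite words *)
Lemma universal_bits : exists f : nat -> bool, forall w : seq bool,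
  exists n, forall i, (i < size w)%N -> f (n + i)%N = nth false w i.
Proof.
pose word n : seq bool := odflt [::] (choice.unpickle n).
(* The extra bit makes each prefix strictly longer than the preceding one, even when the decoded
   word is empty. *)
pose pre := fix pre n := if n is n'.+1 then pre n' ++ rcons (word n') false else [::].
have size_pre n : (n <= size (pre n))%N.
  elim: n => [//|n IH] /=; rewrite size_cat size_rcons addnS ltnS.
  exact: leq_trans IH (leq_addr _ _).
have pre_stable n k i : (i < size (pre n))%N ->
    nth false (pre (n + k)%N) i = nth false (pre n) i.
  move=> ni; elim: k => [|k IH]; first by rewrite addn0.
  rewrite addnS /= nth_cat IH; case: ltnP => // ki.
  move: ki; rewrite leqNgt => /negP[]; elim: k {IH} => [|k IHk]; first by rewrite addn0.
  by rewrite addnS /= size_cat; exact: leq_trans IHk (leq_addr _ _).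
exists (fun i => nth false (pre i.+1) i) => w.
pose m := choice.pickle w; exists (size (pre m)) => i iw.
set I := (size (pre m) + i)%N.
have wm : word m = w by rewrite /word /m choice.pickleK.
have IS : (I < size (pre m.+1))%N.
  by rewrite /= size_cat wm size_rcons ltn_add2l ltnW.
have HI : (I < size (pre I.+1))%N by exact: size_pre.
have -> : nth false (pre I.+1) I = nth false (pre m.+1) I.
  have [mI|Im] := leqP m.+1 I.+1.
    by rewrite -(subnKC mI) pre_stable.
  by rewrite -(subnKC (ltnW Im)) pre_stable.
rewrite /= nth_cat ltnNge leq_addr /= /I addKn wm nth_rcons iw.
by [].
Qed.

(** * The plane as a manifold *)

Section Plane.
Variable R : realType.

Lemma second_countable_rV n : @second_countable 'rV[R]_n.
Proof.
pose box (ab : 'rV[rat]_n * 'rV[rat]_n) : set 'rV[R]_n :=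
  [set x | forall j, ratr (ab.1 0 j) < x 0 j < ratr (ab.2 0 j)].
have box_open ab : open (box ab).
  rewrite openE => x /= xab; rewrite /interior.
  have H j : nbhs x [set y : 'rV[R]_n | ratr (ab.1 0 j) < y 0 j < ratr (ab.2 0 j)].
    have /andP[x1 x2] := xab j.
    have cj : (fun y : 'rV[R]_n => y 0 j) @ x --> x 0 j by exact: coord_continuous.
    near=> y; apply/andP; split; near: y.
      by exact: (cj _ (lt_nbhsr x1)).
    by exact: (cj _ (lt_nbhsl x2)).
  have H2 := @filter_forall _ _ _ (nbhs (x : 'rV[R]_n)) _ H.
  exact: H2.
exists (range box); first by apply: (sub_countable (card_image_le _ _)); exact: countableP.
split=> [_ [ab _ <-]|x]; first exact: box_open.
move=> A /nbhs_ballP[e /= e0 eA].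
have H j : exists ab : rat * rat, x 0 j - e < ratr ab.1 < x 0 j /\ x 0 j < ratr ab.2 < x 0 j + e.
  have [a aP] := @rat_in_itvoo R (x 0 j - e) (x 0 j) ltac:(lra).
  have [b bP] := @rat_in_itvoo R (x 0 j) (x 0 j + e) ltac:(lra).
  by exists (a, b); move: aP bP; rewrite !in_itv.
pose c j := sval (cid (H j)).
have cP j := svalP (cid (H j)).
exists (box (\row_j (c j).1, \row_j (c j).2)).
  split; first by exists (\row_j (c j).1, \row_j (c j).2).
  by move=> j /=; rewrite !mxE; have := cP j; rewrite -/(c j); lra.
move=> y /= yb; apply: eA; split => // i j; rewrite ord1.
have := yb j; rewrite /= !mxE; have := cP j; rewrite -/(c j) => cPj yj.
by rewrite /ball /= ltr_norml; lra.
Unshelve. all: by end_near. Qed.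

(** Kept transparent, so that [cmap] and [cinv] reduce to the identity. *)
Definition plane_chart : chart R 2 'rV[R]_2.
Proof.
apply: (@Chart R 2 'rV[R]_2 setT id id).
- exact: openT.
- by rewrite image_id; exact: openT.
- by [].
- by move=> x _; exact: cvg_id.
- by move=> x _; exact: cvg_id.
Defined.

Lemma Ck_id k : Ck k (id : 'rV[R]_2 -> 'rV[R]_2).
Proof. by apply: Ck_mx => j; exact: Ck_coord. Qed.

Lemma plane_atlas_compatible (a b : chart R 2 'rV[R]_2) :
  [set plane_chart] a -> [set plane_chart] b ->
  smooth_on (cmap a @` (cdom a `&` cdom b)) (cmap b \o cinv a).
Proof. by move=> -> ->; apply: Ck_smooth_on => k; exact: Ck_id. Qed.

Definition plane : smoothManifold R 2 :=
  @SmoothManifold R 2 'rV[R]_2 (@norm_hausdorff R 'rV[R]_2) (@second_countable_rV 2)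
    [set plane_chart] (fun=> plane_chart) (fun=> erefl) (fun=> Logic.I)
    plane_atlas_compatible.

Lemma smooth_map_plane (F : 'rV[R]_2 -> 'rV[R]_2) : (forall k, Ck k F) ->
  @smooth_map R 2 2 plane plane F.
Proof.
move=> HF; split; first by move=> x; exact: (Ck_continuous (HF 0%N)).
by move=> a b /= -> ->; apply: Ck_smooth_on.
Qed.

Lemma smooth_cfun_plane (g : 'rV[R]_2 -> R) : (forall k, Ck k g) ->
  @smooth_cfun R 2 plane (fun x => (g x)%:C%C).
Proof.
move=> Hg a /= ->; split; apply: Ck_smooth_on => k /=; first exact: Hg.
exact: Ck_cst.
Qed.

Lemma tangent_affine (F : 'rV[R]_2 -> 'rV[R]_2) (x : 'rV[R]_2) (L : 'M[R]_2) :
  (\forall y \near x, F y = F x + (y - x) *m L) ->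
  @tangent R 2 2 plane plane F x = L.
Proof.
move=> HF; rewrite /tangent /= /jacobian.
pose f := mulmxr L : {linear 'rV[R]_2 -> 'rV[R]_2}.
have cf : continuous f.
  apply: (@Ck_continuous R 2 _ 0); apply: Ck_mx => j.
  rewrite (_ : (fun _ => _) = fun x : 'rV[R]_2 => x 0 0 * L 0 j + x 0 1 * L 1 j).
    by apply: CkD; apply: CkM; (exact: Ck_coord || exact: Ck_cst).
  apply/funext => y; rewrite /= !mxE !big_ord_recl big_ord0 addr0.
  by congr (_ * _ + _ * _); congr (_ _ _); apply: val_inj.
have -> : 'd F x = f :> ('rV[R]_2 -> 'rV[R]_2).
  apply: diff_unique => //; apply/eqaddoP => e e0.
  have : \forall h \near (0 : 'rV[R]_2), F (h + x) = F x + h *m L.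
    have /= H : \forall y \near x, F y = F x + (y - x) *m L by [].
    rewrite (near_shift 0 x) in H.
    apply: filterS H => h /=; rewrite subr0 addrK => ->; by [].
  apply: filterS => h /= hE; rewrite !fctE /= hE /f /= opprD addrACA subrr add0r subrr.
  by rewrite normr0 mulr_ge0 // ltW.
by apply/row_matrixP => i; rewrite !rowE mul_rV_lin1.
Qed.

End Plane.

(** * The horseshoe *)

Section Horseshoe.
Variable R : realType.
Local Notation phi := (@smoothstep R).
Implicit Types (x y : 'rV[R]_2) (f p : nat -> bool).

Definition pair_row (u v : R) : 'rV[R]_2 := \row_j (if j == 0 then u else v).

Lemma pair_row0 u v : pair_row u v 0 0 = u. Proof. by rewrite mxE. Qed.
Lemma pair_row1 u v : pair_row u v 0 1 = v. Proof. by rewrite mxE. Qed.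

Lemma ord2P (P : 'I_2 -> Prop) : P 0 -> P 1 -> forall j, P j.
Proof.
move=> P0 P1 [[|[|//]] i]; first by rewrite (_ : Ordinal i = 0) //; apply: val_inj.
by rewrite (_ : Ordinal i = 1) //; apply: val_inj.
Qed.

Lemma row2P x y : x 0 0 = y 0 0 -> x 0 1 = y 0 1 -> x = y.
Proof. by move=> xy0 xy1; apply/rowP; apply: ord2P. Qed.

Lemma pair_rowE x : x = pair_row (x 0 0) (x 0 1).
Proof. by apply: row2P; rewrite mxE. Qed.

Lemma Ck_pair_row k (u v : 'rV[R]_2 -> R) : Ck k u -> Ck k v ->
  Ck k (fun x => pair_row (u x) (v x)).
Proof.
move=> uk vk; apply: Ck_mx; apply: ord2P.
  by rewrite (_ : (fun x => _) = u) //; apply/funext => x; rewrite mxE.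
by rewrite (_ : (fun x => _) = v) //; apply/funext => x; rewrite mxE.
Qed.

(* In the coordinates (U, V) = (sum_(j >= 0) e_j 9^-j, sum_(j >= 1) e_(-j) 9^-j)
   of a bi-infinite bit sequence e, the bit e_0 is phi (U + V), and the shift is
   the following map. *)
Definition horseshoe x : 'rV[R]_2 :=
  pair_row (9 * (x 0 0 - phi (x 0 0 + x 0 1))) (9^-1 * (x 0 1 + phi (x 0 0 + x 0 1))).

(** The map is diag (9, 1/9) after the shear $(U - \phi, V + \phi)$ with $\phi$ taken at U + V. The
    shear preserves U + V, so the bit is recovered from the image as $\phi(9^{-1} y_0 + 9 y_1)$. *)
Definition horseshoe_inv y : 'rV[R]_2 :=
  pair_row (9^-1 * y 0 0 + phi (9^-1 * y 0 0 + 9 * y 0 1))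
           (9 * y 0 1 - phi (9^-1 * y 0 0 + 9 * y 0 1)).

Lemma horseshoeK : cancel horseshoe horseshoe_inv.
Proof.
move=> x; rewrite /horseshoe_inv /horseshoe !pair_row0 !pair_row1.
rewrite (_ : 9^-1 * _ + 9 * _ = x 0 0 + x 0 1); last by field.
by apply: row2P; rewrite ?pair_row0 ?pair_row1; field.
Qed.

Lemma horseshoe_invK : cancel horseshoe_inv horseshoe.
Proof.
move=> y; rewrite /horseshoe /horseshoe_inv !pair_row0 !pair_row1.
rewrite [_ + _ + (_ - _)](_ : _ = 9^-1 * y 0 0 + 9 * y 0 1); last by ring.
by apply: row2P; rewrite ?pair_row0 ?pair_row1; field.
Qed.

Lemma Ck_horseshoe k : Ck k horseshoe.
Proof.
have phik : Ck k (fun x => phi (x 0 0 + x 0 1)).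
  apply: (@Ck_comp R 2 k phi (fun x => x 0 0 + x 0 1)).
    exact: smooth1_smoothstep.
  by apply: CkD; exact: Ck_coord.
apply: Ck_pair_row; apply: CkZ; first by apply: CkB => //; exact: Ck_coord.
by apply: CkD => //; exact: Ck_coord.
Qed.

Lemma Ck_horseshoe_inv k : Ck k horseshoe_inv.
Proof.
have phik : Ck k (fun x => phi (9^-1 * x 0 0 + 9 * x 0 1)).
  apply: (@Ck_comp R 2 k phi (fun x => 9^-1 * x 0 0 + 9 * x 0 1)).
    exact: smooth1_smoothstep.
  by apply: CkD; apply: CkZ; exact: Ck_coord.
apply: Ck_pair_row; first by apply: CkD => //; apply: CkZ; exact: Ck_coord.
by apply: CkB => //; apply: CkZ; exact: Ck_coord.
Qed.

Definition horseshoe_diffeo : diffeo (plane R) :=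
  @Diffeo R 2 (plane R) horseshoe horseshoe_inv horseshoeK horseshoe_invK
    (smooth_map_plane Ck_horseshoe) (smooth_map_plane Ck_horseshoe_inv).

Local Notation T := horseshoe_diffeo.

(** The box without the open strip in which the step function passes from 0 to 1; on each remaining
    piece the map is affine. *)
Definition horseshoe_domain : set 'rV[R]_2 :=
  [set x | [/\ `|x 0 0| <= 2, `|x 0 1| <= 2 &
    x 0 0 + x 0 1 <= 2^-1 \/ 3 / 4 <= x 0 0 + x 0 1]].

Definition horseshoe_set : set (plane R) :=
  \bigcap_(k in [set: int]) (ziter T k @` horseshoe_domain).

Local Notation V0 := horseshoe_domain.
Local Notation K := horseshoe_set.

Let iterK j : cancel (iter j horseshoe) (iter j horseshoe_inv).
Proof. by move=> x; elim: j => [//|j IH]; rewrite iterSr iterS horseshoeK. Qed.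

Let iter_invK j : cancel (iter j horseshoe_inv) (iter j horseshoe).
Proof. by move=> x; elim: j => [//|j IH]; rewrite iterSr iterS horseshoe_invK. Qed.

Lemma horseshoe_setP x : K x <->
  forall j, V0 (iter j horseshoe x) /\ V0 (iter j horseshoe_inv x).
Proof.
split=> [Kx j|H [k|k] _].
- split; last first.
    by have [y Vy <-] := Kx (Posz j) Logic.I; rewrite iterK.
  case: j => [|j]; first by have [y Vy <-] := Kx (Posz 0) Logic.I.
  by have [y Vy <-] := Kx (Negz j) Logic.I; rewrite /ziter iter_invK.
- by exists (iter k horseshoe_inv x); [exact: (H k).2|exact: iter_invK].
- by exists (iter k.+1 horseshoe x); [exact: (H k.+1).1|exact: iterK].
Qed.

Lemma horseshoe_set_map x : K x -> K (horseshoe x).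
Proof.
move=> /horseshoe_setP Kx; apply/horseshoe_setP => j; split.
  by rewrite -iterSr; exact: (Kx j.+1).1.
case: j => [|j]; first exact: (Kx 1%N).1.
by rewrite iterSr horseshoeK; exact: (Kx j).2.
Qed.

Lemma horseshoe_set_inv x : K x -> K (horseshoe_inv x).
Proof.
move=> /horseshoe_setP Kx; apply/horseshoe_setP => j; split.
  case: j => [|j]; first exact: (Kx 1%N).2.
  by rewrite iterSr horseshoe_invK; exact: (Kx j).1.
by rewrite -iterSr; exact: (Kx j.+1).2.
Qed.

Definition bit_of x : bool := 3 / 4 <= x 0 0 + x 0 1.

Lemma smoothstep_bit x : V0 x -> phi (x 0 0 + x 0 1) = (bit_of x)%:R.
Proof.
move=> [_ _ [x0|x1]]; last by rewrite /bit_of x1 smoothstep1.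
rewrite smoothstep0 // /bit_of leNgt (_ : _ < _) //.
by apply: (le_lt_trans x0); lra.
Qed.

Definition code_point f p : 'rV[R]_2 :=
  pair_row (cantor_code R f) (9^-1 * cantor_code R p).

(** While the orbit stays in the domain, the coordinates satisfy the recursion of codes, forwards
    for U and backwards for V, and boundedness makes the solution unique. *)
Lemma bits_of_point x : K x ->
  x = code_point (fun j => bit_of (iter j horseshoe x))
                 (fun j => bit_of (iter j.+1 horseshoe_inv x)).
Proof.
move=> /horseshoe_setP Kx; rewrite [LHS]pair_rowE; congr pair_row.
  apply: (@cantor_code_unique R _ (fun j => iter j horseshoe x 0 0) 2).
    move=> j; have := smoothstep_bit (Kx j).1; rewrite iterS /horseshoe => ->.
    by rewrite pair_row0; field.
  by move=> j; have [] := (Kx j).1.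
(* The code of the past is 9 V, because its digits start at $9^{-1}$ in V; $|V| \le 2$ gives the
   bound 18. *)
rewrite -(@cantor_code_unique R _ (fun j => 9 * iter j horseshoe_inv x 0 1) 18) /=.
- by field.
- move=> j; have := smoothstep_bit (Kx j.+1).2; rewrite iterS.
  set y := iter j _ x; rewrite -[in 9 * y 0 1](horseshoe_invK y) /horseshoe => ->.
  by rewrite pair_row1; field.
- move=> j; have [_ H _] := (Kx j).2; rewrite normrM ger0_norm //; lra.
Qed.

Definition cons_bits (b : bool) p : nat -> bool := fun i => if i is i'.+1 then p i' else b.

Lemma code_point_domain f p : V0 (code_point f p).
Proof.
have /andP[f1 f2] := cantor_code_bounds R f; have /andP[p1 p2] := cantor_code_bounds R p.
split; rewrite ?pair_row0 ?pair_row1 ?ler_norml; try by lra.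
case E : (f 0%N); first by right; have := cantor_code1 R E; lra.
by left; have := cantor_code0 R E; lra.
Qed.

Lemma bit_of_code_point f p : bit_of (code_point f p) = f 0%N.
Proof.
have /andP[f1 f2] := cantor_code_bounds R f; have /andP[p1 p2] := cantor_code_bounds R p.
rewrite /bit_of pair_row0 pair_row1; case E : (f 0%N).
  by have := cantor_code1 R E; lra.
by apply/negbTE; rewrite -ltNge; have := cantor_code0 R E; lra.
Qed.

Lemma horseshoe_code_point f p :
  horseshoe (code_point f p) = code_point (shift_bits 1 f) (cons_bits (f 0%N) p).
Proof.
rewrite /horseshoe (smoothstep_bit (code_point_domain f p)) bit_of_code_point.
rewrite !pair_row0 !pair_row1; congr pair_row.
  by rewrite (cantor_codeS R f); field.
by rewrite [in RHS]cantor_codeS addrC.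
Qed.

Lemma horseshoe_inv_code_point f p :
  horseshoe_inv (code_point f p) = code_point (cons_bits (p 0%N) f) (shift_bits 1 p).
Proof.
apply: (can_inj horseshoeK); rewrite horseshoe_invK horseshoe_code_point.
by congr (pair_row _ (_ * _)); congr cantor_code; apply/funext => -[|j].
Qed.

Lemma code_point_in f p : K (code_point f p).
Proof.
apply/horseshoe_setP => j; split.
  suff [f' [p' ->]] : exists f' p', iter j horseshoe (code_point f p) = code_point f' p'.
    exact: code_point_domain.
  elim: j => [|j [f' [p' IH]]]; first by exists f, p.
  by rewrite iterS IH horseshoe_code_point; eexists; eexists.
suff [f' [p' ->]] : exists f' p', iter j horseshoe_inv (code_point f p) = code_point f' p'.
  exact: code_point_domain.
elim: j => [|j [f' [p' IH]]]; first by exists f, p.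
by rewrite iterS IH horseshoe_inv_code_point; eexists; eexists.
Qed.

(** Bits that have left the future enter the past in reverse order, the latest one first. *)
Definition past_bits j f p : nat -> bool :=
  fun i => if (i < j)%N then f (j.-1 - i)%N else p (i - j)%N.

Lemma iter_horseshoe_code_point j f p :
  iter j horseshoe (code_point f p) = code_point (shift_bits j f) (past_bits j f p).
Proof.
elim: j => [|j IH].
  by congr code_point; apply/funext => i; rewrite /past_bits ?subn0.
rewrite iterS IH horseshoe_code_point shift_bitsD addn1; congr code_point.
apply/funext => -[|i]; rewrite /past_bits /cons_bits /=.
  by rewrite subn0 /shift_bits addn0.
rewrite ltnS; case: ifP => // ij; congr f; lia.
Qed.

Lemma code_point_inj f p f' p' : code_point f p = code_point f' p' -> f = f' /\ p = p'.
Proof.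
move=> E; have E0 : code_point f p 0 0 = code_point f' p' 0 0 by rewrite E.
have E1 : code_point f p 0 1 = code_point f' p' 0 1 by rewrite E.
rewrite !pair_row0 in E0; rewrite !pair_row1 in E1.
by split; apply: (@cantor_code_inj R) => //; lra.
Qed.

Lemma compact_box (c : 'rV[R]_2) (r : R) (A : set 'rV[R]_2) : closed A ->
  (forall x, A x -> `|x 0 0 - c 0 0| <= r /\ `|x 0 1 - c 0 1| <= r) -> compact A.
Proof.
move=> cA HA; apply: bounded_closed_compact => //.
exists (r + `|c|); split; first exact: num_real.
move=> M rM x /= /HA[h0 h1]; apply: (le_trans _ (ltW rM)).
rewrite -(subrK c x) (le_trans (ler_normD _ _)) // lerD2r.
rewrite -[`|_|]/(mx_norm _) mx_normrE; apply/bigmax_leP; split; first exact: le_trans h0.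
by move=> [i j] _ /=; rewrite ord1 !mxE; move: j; apply: ord2P.
Qed.

Let continuous_sum : continuous (fun x : 'rV[R]_2 => x 0 0 + x 0 1).
Proof. by apply: (@Ck_continuous R 2 R 0); apply: CkD; exact: Ck_coord. Qed.

Lemma closed_horseshoe_domain : closed V0.
Proof.
have -> : V0 = (fun x => `|x 0 0|) @^-1` [set r | r <= 2] `&`
   ((fun x => `|x 0 1|) @^-1` [set r | r <= 2] `&`
   ((fun x => x 0 0 + x 0 1) @^-1` [set r | r <= 2^-1] `|`
   (fun x => x 0 0 + x 0 1) @^-1` [set r | 3 / 4 <= r])).
  by apply/seteqP; split => x /=; [case|case=> ? []].
have cn j : continuous (fun x : 'rV[R]_2 => `|x 0 j|).
  by move=> x; exact: (cvg_norm (@coord_continuous R 1 2 0 j x)).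
have leP' (a : R) (h : 'rV[R]_2 -> R) : continuous h -> closed (h @^-1` [set r | r <= a]).
  by move=> ch; apply: closed_comp; [move=> x _; exact: ch|exact: closed_le].
have geP' (a : R) (h : 'rV[R]_2 -> R) : continuous h -> closed (h @^-1` [set r | a <= r]).
  by move=> ch; apply: closed_comp; [move=> x _; exact: ch|exact: closed_ge].
apply: closedI; first exact: leP'.
apply: closedI; first exact: leP'.
by apply: closedU; [exact: leP'|exact: geP'].
Qed.

Let continuous_iter (F : 'rV[R]_2 -> 'rV[R]_2) j : continuous F -> continuous (iter j F).
Proof.
move=> cF; elim: j => [|j IH] x; first exact: cvg_id.
by rewrite (_ : iter j.+1 F = F \o iter j F) //; apply: continuous_comp; [exact: IH|exact: cF].
Qed.

Lemma compact_horseshoe_set : compact K.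
Proof.
have KV x : K x -> V0 x by move=> /horseshoe_setP/(_ 0%N)[].
apply: (@compact_box 0 2).
  have -> : K = \bigcap_(j in [set: nat]) ((iter j horseshoe @^-1` V0) `&`
      (iter j horseshoe_inv @^-1` V0)).
    apply/seteqP; split=> x; first by move=> /horseshoe_setP Kx j _; exact: Kx.
    by move=> Kx; apply/horseshoe_setP => j; exact: Kx.
  apply: closed_bigI => j _; apply: closedI; apply: closed_comp.
  - by move=> x _; apply: continuous_iter; exact: (Ck_continuous (Ck_horseshoe 0)).
  - exact: closed_horseshoe_domain.
  - by move=> x _; apply: continuous_iter; exact: (Ck_continuous (Ck_horseshoe_inv 0)).
  - exact: closed_horseshoe_domain.
by move=> x /KV [? ? _]; rewrite !mxE !subr0.
Qed.

Definition horseshoe_interior : set 'rV[R]_2 :=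
  [set x | [/\ `|x 0 0| < 2, `|x 0 1| < 2 &
    x 0 0 + x 0 1 < 2^-1 \/ 3 / 4 < x 0 0 + x 0 1]].

Lemma open_horseshoe_interior : open horseshoe_interior.
Proof.
have -> : horseshoe_interior = (fun x => `|x 0 0|) @^-1` [set r | r < 2] `&`
   ((fun x => `|x 0 1|) @^-1` [set r | r < 2] `&`
   ((fun x => x 0 0 + x 0 1) @^-1` [set r | r < 2^-1] `|`
   (fun x => x 0 0 + x 0 1) @^-1` [set r | 3 / 4 < r])).
  by apply/seteqP; split => x /=; [case|case=> ? []].
have cn j : continuous (fun x : 'rV[R]_2 => `|x 0 j|).
  by move=> x; exact: (cvg_norm (@coord_continuous R 1 2 0 j x)).
have ltP' (a : R) (h : 'rV[R]_2 -> R) : continuous h -> open (h @^-1` [set r | r < a]).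
  by move=> ch; apply: open_comp; [move=> x _; exact: ch|exact: open_lt].
have gtP' (a : R) (h : 'rV[R]_2 -> R) : continuous h -> open (h @^-1` [set r | a < r]).
  by move=> ch; apply: open_comp; [move=> x _; exact: ch|exact: open_gt].
apply: openI; first exact: ltP'.
apply: openI; first exact: ltP'.
by apply: openU; [exact: ltP'|exact: gtP'].
Qed.

Lemma horseshoe_interior_sub : horseshoe_interior `<=` V0.
Proof. by move=> x [/ltW ? /ltW ? [/ltW ?|/ltW ?]]; split => //; [left|right]. Qed.

Lemma horseshoe_set_interior : K `<=` horseshoe_interior.
Proof.
move=> x /bits_of_point ->; set f := fun j => _; set p := fun j => _.
have /andP[f1 f2] := cantor_code_bounds R f; have /andP[p1 p2] := cantor_code_bounds R p.
split; rewrite ?pair_row0 ?pair_row1 ?ltr_norml; try by lra.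
case E : (f 0%N); first by right; have := cantor_code1 R E; lra.
by left; have := cantor_code0 R E; lra.
Qed.

(** K is the maximal invariant set of the domain, so every neighbourhood inside the domain isolates
    it as well. This allows the support of the weight to be as small as desired. *)
Lemma isolating_horseshoe (V : set 'rV[R]_2) :
  K `<=` V° -> V `<=` V0 -> @isolating R 2 (plane R) T K V.
Proof.
move=> KV VV0; split => //.
apply/seteqP; split=> x; last first.
  by move=> Hx k _; have [y Vy <-] := Hx k Logic.I; exists y => //; exact: VV0.
have KV' y : K y -> V y by move=> /KV/interior_subset.
have iK j y : K y -> K (iter j horseshoe y).
  by move=> Ky; elim: j => [//|j IH]; rewrite iterS; exact: horseshoe_set_map.
have iK' j y : K y -> K (iter j horseshoe_inv y).
  by move=> Ky; elim: j => [//|j IH]; rewrite iterS; exact: horseshoe_set_inv.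
move=> Kx [k|k] _.
  by exists (iter k horseshoe_inv x); [exact/KV'/iK'|exact: iter_invK].
by exists (iter k.+1 horseshoe x); [exact/KV'/iK|exact: iterK].
Qed.

(** To approach the point with future f' and past p', find in the universal future the word formed
    by N bits of p', reversed, followed by N bits of f', and shift to its middle. Both coordinates
    are then within $2 \cdot 9^{-N}$. *)
Lemma horseshoe_transitive : transitive_on T K.
Proof.
have [f fP] := universal_bits.
exists (code_point f (fun=> false)); first exact: code_point_in.
move=> y Ky.
have [f' [p' ->]] : exists f' p', y = code_point f' p'.
  by eexists; eexists; exact: bits_of_point.
move=> A /nbhs_ballP[e /= e0 eA].
have c : (fun N => 2 * 9^-1 ^+ N : R) @ \oo --> (2 * 0 : R).
  apply: cvgM; first exact: cvg_cst.
  by apply: cvg_expr; rewrite ger0_norm // invf_lt1 // ltr1n.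
rewrite mulr0 in c; move/cvgrPdist_lt: c => /(_ _ e0)[N _ /(_ N (leqnn N))/=].
rewrite sub0r normrN ger0_norm ?mulr_ge0 ?exprn_ge0 // => Ne.
have [n nP] := fP (mkseq (fun i => p' (N.-1 - i)%N) N ++ mkseq f' N).
rewrite size_cat !size_mkseq in nP.
exists (code_point (shift_bits (n + N) f) (past_bits (n + N) f (fun=> false))); split.
  by exists (n + N)%N => //; exact: iter_horseshoe_code_point.
apply: eA; split => // i j; rewrite ord1; move: j; apply: ord2P => /=.
  rewrite /ball /= !pair_row0; apply: (le_lt_trans _ Ne); apply: cantor_code_close => k kN.
  rewrite /shift_bits -addnA nP ?ltn_add2l // nth_cat size_mkseq ltnNge leq_addr /=.
  by rewrite addKn nth_mkseq.
rewrite /ball /= !pair_row1 -mulrBr normrM ger0_norm ?invr_ge0 //.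
apply: (le_lt_trans _ Ne); apply: (@le_trans _ _ (1 * (2 * 9^-1 ^+ N))); last by rewrite mul1r.
apply: ler_pM => //; first by rewrite invf_le1 // ler1n.
apply: cantor_code_close => k kN.
rewrite /past_bits ifT; last by lia.
rewrite (_ : (n + N).-1 - k = n + (N.-1 - k))%N; last by lia.
rewrite nP; last by lia.
rewrite nth_cat size_mkseq ifT; last by lia.
by rewrite nth_mkseq; [congr p'; lia|lia].
Qed.

End Horseshoe.

(** * Hyperbolicity of the horseshoe *)

Section Hyperbolicity.
Variable R : realType.
Local Notation T := (horseshoe_diffeo R).
Local Notation K := (@horseshoe_set R).
Implicit Types (x y v : 'rV[R]_2).

Definition diag2 (a b : R) : 'M[R]_2 := diag_mx (pair_row a b).

Lemma mul_diag2 v a b : v *m diag2 a b = pair_row (v 0 0 * a) (v 0 1 * b).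
Proof. by apply: row2P; rewrite mul_mx_diag !mxE. Qed.

Lemma diag2M a b c d : diag2 a b *m diag2 c d = diag2 (a * c) (b * d).
Proof.
by rewrite /diag2 mulmx_diag; congr diag_mx; apply: row2P; rewrite !mxE.
Qed.

Lemma diag2_1 : 1%:M = diag2 1 1.
Proof.
by rewrite /diag2 -diag_const_mx; congr diag_mx; apply: row2P; rewrite !mxE.
Qed.

Lemma det_1_sub_diag2 a b : \det (1%:M - diag2 a b) = (1 - a) * (1 - b).
Proof.
rewrite diag2_1 /diag2 -raddfB /= det_diag !big_ord_recl big_ord0 mulr1.
by rewrite !mxE.
Qed.

Let near_smoothstep (s : 'rV[R]_2 -> R) x : continuous s ->
  s x < 2^-1 \/ 3 / 4 < s x -> \forall y \near x, smoothstep (s y) = smoothstep (s x).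
Proof.
move=> cs [sx|sx]; near=> y.
  rewrite !smoothstep0 //; first exact: ltW.
  by near: y; exact: (cs x _ (lt_le_nbhsl sx)).
rewrite !smoothstep1 //; first exact: ltW.
by near: y; exact: (cs x _ (lt_le_nbhsr sx)).
Unshelve. all: by end_near. Qed.

Lemma near_horseshoe_affine x : K x ->
  \forall y \near x, horseshoe y = horseshoe x + (y - x) *m diag2 9 9^-1.
Proof.
move=> /horseshoe_set_interior [_ _ xs].
have cs : continuous (fun y : 'rV[R]_2 => y 0 0 + y 0 1).
  by apply: (@Ck_continuous R 2 R 0); apply: CkD; exact: Ck_coord.
apply: filterS (near_smoothstep cs xs) => y yE.
by rewrite /horseshoe yE mul_diag2; apply: row2P; rewrite !mxE /=; ring.
Qed.

Lemma near_horseshoe_inv_affine x : K x ->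
  \forall y \near x, horseshoe_inv y = horseshoe_inv x + (y - x) *m diag2 9^-1 9.
Proof.
move=> /horseshoe_set_inv/horseshoe_set_interior [_ _].
rewrite (_ : horseshoe_inv x 0 0 + horseshoe_inv x 0 1 = 9^-1 * x 0 0 + 9 * x 0 1); last first.
  by rewrite pair_row0 pair_row1; ring.
move=> xs.
have cs : continuous (fun y : 'rV[R]_2 => 9^-1 * y 0 0 + 9 * y 0 1).
  by apply: (@Ck_continuous R 2 R 0); apply: CkD; apply: CkZ; exact: Ck_coord.
apply: filterS (near_smoothstep cs xs) => y yE.
by rewrite /horseshoe_inv yE mul_diag2; apply: row2P; rewrite !mxE /=; ring.
Qed.

(** Near each point of K the map is affine with a constant linear part, and orbits stay in K, so
    these germs compose along the orbit. *)
Lemma tangent_iter (F : 'rV[R]_2 -> 'rV[R]_2) a b j x : continuous F ->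
  (forall y, K y -> K (F y)) ->
  (forall y, K y -> \forall z \near y, F z = F y + (z - y) *m diag2 a b) ->
  K x -> @tangent R 2 2 (plane R) (plane R) (iter j F) x = diag2 (a ^+ j) (b ^+ j).
Proof.
move=> cF KF HF Kx; apply: tangent_affine.
have [] : K (iter j F x) /\ {for x, continuous (iter j F)} /\
    \forall y \near x, iter j F y = iter j F x + (y - x) *m diag2 (a ^+ j) (b ^+ j); last by move=> _ [].
elim: j => [|j [Kj [cj Hj]]].
  split => //; split; first exact: cvg_id.
  by near=> y; rewrite !expr0 -diag2_1 mulmx1 /= addrC subrK.
split; first exact: KF.
split.
  by rewrite (_ : iter j.+1 F = F \o iter j F) //; apply: continuous_comp => //; exact: cF.
have := cj _ (HF _ Kj); apply: filterS2 Hj => y Hy /= ->.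
rewrite {1}Hy addrAC subrr add0r -mulmxA diag2M.
by rewrite !exprSr.
Unshelve. all: by end_near. Qed.

Lemma tangent_iter_horseshoe j x : K x ->
  @tangent R 2 2 (plane R) (plane R) (iter j T) x = diag2 (9 ^+ j) (9^-1 ^+ j).
Proof.
apply: tangent_iter.
- exact: (Ck_continuous (@Ck_horseshoe R 0)).
- exact: horseshoe_set_map.
- exact: near_horseshoe_affine.
Qed.

Lemma tangent_iter_horseshoe_inv j x : K x ->
  @tangent R 2 2 (plane R) (plane R) (iter j (Defs.dinv T)) x = diag2 (9^-1 ^+ j) (9 ^+ j).
Proof.
apply: tangent_iter.
- exact: (Ck_continuous (@Ck_horseshoe_inv R 0)).
- exact: horseshoe_set_inv.
- exact: near_horseshoe_inv_affine.
Qed.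

Lemma hyperbolic_horseshoe : hyperbolic T K.
Proof.
pose Eu : 'M[R]_2 := diag2 1 0; pose Es : 'M[R]_2 := diag2 0 1.
have inEu v : (v <= Eu)%MS -> v 0 1 = 0.
  by move=> /submxP[D ->]; rewrite mul_diag2 pair_row1 mulr0.
have inEs v : (v <= Es)%MS -> v 0 0 = 0.
  by move=> /submxP[D ->]; rewrite mul_diag2 pair_row0 mulr0.
have normZ x y (c : R) v : tnorm (M := plane R) (fun=> 1%:M) y (c *: v) =
    `|c| * tnorm (M := plane R) (fun=> 1%:M) x v.
  rewrite /tnorm !mulmx1 -scalemxAl linearZ /= -scalemxAr scalerA mxE -expr2.
  by rewrite sqrtrM ?sqr_ge0 // sqrtr_sqr.
exists setT, (fun=> 1%:M), (fun=> Eu), (fun=> Es), 9, 1; split.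
- by split => //; exact: openT.
- split.
  + by move=> x _; rewrite trmx1.
  + move=> x v _ v0; rewrite mulmx1.
    have -> : (v *m v^T) 0 0 = v 0 0 ^+ 2 + v 0 1 ^+ 2.
      rewrite mxE !big_ord_recl big_ord0 addr0 !mxE !expr2.
      by congr (_ * _ + _ * _); congr (v _ _); apply: val_inj.
    rewrite lt_def addr_ge0 ?sqr_ge0 // andbT paddr_eq0 ?sqr_ge0 // !sqrf_eq0.
    apply/negP => /andP[/eqP v00 /eqP v01].
    by move/eqP: v0; apply; apply: row2P; rewrite mxE.
  + move=> a /= ->; apply: Ck_smooth_on => k /=.
    rewrite (_ : (fun y => _) = cst 1%:M); first exact: Ck_cst.
    apply/funext => y.
    have -> : 'J (id \o id) y = 1%:M :> 'M[R]_2.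
      have := @tangent_affine R id y 1%:M; rewrite /tangent /=; apply.
      by near=> z; rewrite mulmx1 addrC subrK.
    by rewrite !mul1mx trmx1.
- move=> x Kx; rewrite (@tangent_iter_horseshoe 1 x Kx) !expr1; split.
  + rewrite -sub1mx (_ : 1%:M = Eu + Es).
      by rewrite addmx_sub_adds.
    rewrite diag2_1 /Eu /Es /diag2 -raddfD /=; congr diag_mx.
    by apply: row2P; rewrite !mxE /=; ring.
  + apply/eqP; rewrite -submx0; apply/rV_subP => v; rewrite sub_capmx => /andP[vu vs].
    rewrite submx0; apply/eqP; apply: row2P; rewrite mxE.
      exact: inEs.
    exact: inEu.
  + rewrite diag2M mul0r mul1r.
    rewrite (_ : diag2 9 0 = 9 *: Eu); first by apply/eqmxP; exact: eqmx_scale.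
    by rewrite /Eu /diag2 -linearZ /=; congr diag_mx; apply: row2P; rewrite !mxE /=; ring.
  + rewrite diag2M mul0r mul1r.
    rewrite (_ : diag2 0 9^-1 = 9^-1 *: Es); first by apply/eqmxP; apply: eqmx_scale; rewrite invr_eq0.
    by rewrite /Es /diag2 -linearZ /=; congr diag_mx; apply: row2P; rewrite !mxE /=; ring.
- by rewrite ltr1n.
- move=> x Kx j v; rewrite tangent_iter_horseshoe // tangent_iter_horseshoe_inv // mul1r.
  have c0 : 0 <= 9 ^- j :> R by rewrite invr_ge0 exprn_ge0.
  split=> [/inEs v0|/inEu v0].
    rewrite (_ : v *m _ = 9 ^- j *: v); first by rewrite (normZ x) ger0_norm.
    by rewrite mul_diag2; apply: row2P; rewrite !mxE /= ?v0 ?exprVn; ring.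
  rewrite (_ : v *m _ = 9 ^- j *: v); first by rewrite (normZ x) ger0_norm.
  by rewrite mul_diag2; apply: row2P; rewrite !mxE /= ?v0 ?exprVn; ring.
Unshelve. all: by end_near. Qed.

Lemma hyperbolic_basic_horseshoe : hyperbolic_basic_set T K.
Proof.
split.
- exact: compact_horseshoe_set.
- apply/seteqP; split=> [_ [x Kx <-]|x Kx]; first exact: horseshoe_set_map.
  by exists (horseshoe_inv x); [exact: horseshoe_set_inv|exact: horseshoe_invK].
- exact: hyperbolic_horseshoe.
- exists (@horseshoe_interior R); apply: isolating_horseshoe; last exact: horseshoe_interior_sub.
  have /interior_id -> := @open_horseshoe_interior R; exact: horseshoe_set_interior.
- exact: horseshoe_transitive.
Qed.

End Hyperbolicity.

(** * The weight *)

Section Cutoff.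
Variable R : realType.
Local Notation phi := (@smoothstep R).
Implicit Types (x y p : 'rV[R]_2) (A O : set 'rV[R]_2).

Definition plateau (t : R) : R := phi (1 - t) * phi (1 + t).

Lemma smooth1_plateau : smooth1 plateau.
Proof.
move=> k; apply: diffnM.
  rewrite (_ : (fun t => _) = (fun t => phi (-1 * t + 1))).
    by apply: diffn_comp_affine; exact: smooth1_smoothstep.
  by apply/funext => t; rewrite mulN1r addrC.
rewrite (_ : (fun t => _) = (fun t => phi (1 * t + 1))).
  by apply: diffn_comp_affine; exact: smooth1_smoothstep.
by apply/funext => t; rewrite mul1r addrC.
Qed.

Lemma plateau1 t : `|t| <= 4^-1 -> plateau t = 1.
Proof. by rewrite ler_norml => t4; rewrite /plateau !smoothstep1 ?mulr1 //; lra. Qed.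

Lemma plateau0 t : 2^-1 <= `|t| -> plateau t = 0.
Proof.
rewrite /plateau; have [t0|t0] := ger0P t => ht.
  by rewrite smoothstep0 ?mul0r //; lra.
by rewrite [X in _ * X]smoothstep0 ?mulr0 //; lra.
Qed.

(** V accompanies the function because it later serves as the compact isolating neighbourhood that
    contains the support of the weight. *)
Definition has_cutoff O A := exists (V : set 'rV[R]_2) (chi : 'rV[R]_2 -> R),
  [/\ compact V, V `<=` O, A `<=` V°, forall k, Ck k chi &
      (forall x, A x -> chi x = 1) /\ (forall x, chi x != 0 -> V x)].

Lemma has_cutoff0 O : has_cutoff O set0.
Proof.
exists set0, (cst 0); split.
- exact: compact0.
- by [].
- by [].
- by move=> k; exact: Ck_cst.
- by split => // x; rewrite eqxx.
Qed.

Lemma has_cutoffU O A B : has_cutoff O A -> has_cutoff O B -> has_cutoff O (A `|` B).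
Proof.
move=> [V1 [c1 [k1 O1 A1 s1 [e1 n1]]]] [V2 [c2 [k2 O2 A2 s2 [e2 n2]]]].
exists (V1 `|` V2), (fun x => 1 - (1 - c1 x) * (1 - c2 x)); split.
- exact: compactU.
- by rewrite subUset.
- by move=> x [/A1|/A2]; apply: interiorS => y; [left|right].
- by move=> k; apply: CkB; [exact: Ck_cst|apply: CkM; apply: CkB => //; exact: Ck_cst].
split=> x.
  by move=> [/e1 ->|/e2 ->]; rewrite subrr ?mul0r ?mulr0 subr0.
move=> H; have [c10|/n1] := eqVneq (c1 x) 0; last by left.
have [c20|/n2] := eqVneq (c2 x) 0; last by right.
by move: H; rewrite c10 c20 !subr0 mulr1 subrr eqxx.
Qed.

Lemma has_cutoff_sub O A B : A `<=` B -> has_cutoff O B -> has_cutoff O A.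
Proof.
move=> AB [V [c [? ? BV ? [e1 ?]]]]; exists V, c; split => //.
  exact: subset_trans BV.
by split => // x /AB/e1.
Qed.

Let small_box p (r : R) : set 'rV[R]_2 :=
  [set x | `|x 0 0 - p 0 0| < r / 4 /\ `|x 0 1 - p 0 1| < r / 4].

Let continuous_dist p j : continuous (fun x : 'rV[R]_2 => `|x 0 j - p 0 j|).
Proof.
have cs : continuous (fun x : 'rV[R]_2 => x 0 j - p 0 j).
  by apply: (@Ck_continuous R 2 R 0); apply: CkB; [exact: Ck_coord|exact: Ck_cst].
by move=> x; exact: (cvg_norm (cs x)).
Qed.

Let open_small_box p r : open (small_box p r).
Proof.
have -> : small_box p r = (fun x => `|x 0 0 - p 0 0|) @^-1` [set t | t < r / 4] `&`
    (fun x => `|x 0 1 - p 0 1|) @^-1` [set t | t < r / 4] by [].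
by apply: openI; apply: open_comp; try exact: open_lt; move=> x _; exact: continuous_dist.
Qed.

Lemma has_cutoff_box O p : open O -> O p -> exists2 r : R, 0 < r & has_cutoff O (small_box p r).
Proof.
move=> oO Op; have /nbhs_ballP[e /= e0 eO] : nbhs p O by exact: open_nbhs_nbhs.
exists (e / 2); first by rewrite divr_gt0.
set r := e / 2; have r0 : 0 < r by rewrite divr_gt0.
pose V : set 'rV[R]_2 := [set x | `|x 0 0 - p 0 0| <= r /\ `|x 0 1 - p 0 1| <= r].
have sV : small_box p r `<=` V by move=> x [h0 h1]; split; lra.
exists V, (fun x => plateau (r^-1 * x 0 0 - r^-1 * p 0 0) * plateau (r^-1 * x 0 1 - r^-1 * p 0 1)).
split.
- apply: (@compact_box R p r) => //.
  have -> : V = (fun x => `|x 0 0 - p 0 0|) @^-1` [set t | t <= r] `&`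
      (fun x => `|x 0 1 - p 0 1|) @^-1` [set t | t <= r] by [].
  by apply: closedI; apply: closed_comp; try exact: closed_le; move=> x _; exact: continuous_dist.
- move=> x [h0 h1]; apply: eO; split => // i j; rewrite ord1 /ball /= distrC.
  by move: j; apply: ord2P; rewrite /r in h0 h1; lra.
- by rewrite -open_subsetE.
- have ck k j : Ck k (fun x : 'rV[R]_2 => plateau (r^-1 * x 0 j - r^-1 * p 0 j)).
    apply: (@Ck_comp R 2 k plateau (fun x => r^-1 * x 0 j - r^-1 * p 0 j)).
      exact: smooth1_plateau.
    by apply: CkB; [apply: CkZ; exact: Ck_coord|exact: Ck_cst].
  by move=> k; apply: CkM; exact: ck.
have nE a b : `|r^-1 * a - r^-1 * b| = r^-1 * `|a - b|.
  by rewrite -mulrBr normrM ger0_norm // invr_ge0 ltW.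
split=> x.
  move=> [h0 h1]; rewrite !plateau1 ?mulr1 // nE mulrC ler_pdivrMr // mulrC; lra.
rewrite mulf_eq0 negb_or => /andP[n0 n1].
have K a b : plateau (r^-1 * a - r^-1 * b) != 0 -> `|a - b| <= r.
  move=> nz; rewrite leNgt; apply/negP => rab; move/eqP: nz; apply.
  rewrite plateau0 // nE mulrC ler_pdivlMr //; lra.
by split; exact: K.
Qed.

Lemma has_cutoff_compact O A : open O -> compact A -> A `<=` O -> has_cutoff O A.
Proof.
move=> oO cA AO; have cov := cA; rewrite compact_cover in cov.
have H p : exists r : R, A p -> 0 < r /\ has_cutoff O (small_box p r).
  have [Ap|nAp] := pselect (A p); last by exists 0.
  by have [r r0 Hr] := has_cutoff_box oO (AO _ Ap); exists r.
pose r p := sval (cid (H p)); have rP p := svalP (cid (H p)).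
have [|x Ax|D DA AD] := cov _ A (fun p => small_box p (r p)).
- by move=> p _; exact: open_small_box.
- exists x => //; have [r0 _] := rP x Ax.
  by rewrite /small_box /= !subrr normr0 divr_gt0.
apply: (has_cutoff_sub AD); rewrite /cover bigcup_fset.
have : forall p, p \in finmap.enum_fset D -> A p by move=> p pD; apply: set_mem; exact: DA.
elim: (finmap.enum_fset D) => [|p s IH] sA.
  by rewrite big_nil; exact: has_cutoff0.
rewrite big_cons; apply: has_cutoffU.
  by have [] := rP p (sA p (mem_head _ _)).
by apply: IH => q qs; apply: sA; rewrite in_cons qs orbT.
Qed.

End Cutoff.

Section BlockWeight.
Variables (R : realType) (c : nat -> R).
Hypothesis c_superexp : superexp c.
Local Notation phi := (@smoothstep R).

(** Equal to 1 on [3/4, 3/2], hence on the codes s in [1, 9/8], and to 0 at 9 s and at $9^{-i} s$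
    for i > 0: each rescaled code meets exactly one bump. *)
Let beta (t : R) : R := phi t * (1 - phi (t - 1)).

Let diffn_shift k (h : R -> R) : diffn k h -> diffn k (fun t => h (t - 1)).
Proof.
move=> hk; rewrite (_ : (fun t => _) = fun t => h (1 * t + -1)).
  exact: diffn_comp_affine.
by apply/funext => t; rewrite mul1r.
Qed.

Let beta_support : bump_support beta.
Proof.
rewrite /beta => y [y2|y2]; first by rewrite smoothstep0 ?mul0r // ltW.
by rewrite [X in 1 - X]smoothstep1 ?subrr ?mulr0 //; lra.
Qed.

Let diffn_beta k : diffn k beta.
Proof.
apply: diffnM; first exact: smooth1_smoothstep.
by apply: diffnB; [exact: diffn_cst|exact/diffn_shift/smooth1_smoothstep].
Qed.

Let flat_c : flat_seq c.
Proof.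
move=> m; have [C HC] := c_superexp (9 ^ m)%N; exists C => k.
by rewrite exprM -natrX; exact: HC.
Qed.

(* Equal to 1 near the codes starting with 0, and to [c k] near those starting
   with [1 0^(k-1) 1]; it is flat at 1, the code of [1 0 0 ...]. *)
Definition block_weight (t : R) : R := 1 - phi t + flat_series c beta (t - 1).

Lemma smooth1_block_weight : smooth1 block_weight.
Proof.
move=> k; apply: diffnD.
  by apply: diffnB; [exact: diffn_cst|exact: smooth1_smoothstep].
by apply: diffn_shift; apply: diffn_flat_series => //; exact: diffn_beta.
Qed.

Lemma block_weight0 f : f 0%N = false -> block_weight (cantor_code R f) = 1.
Proof.
move=> f0; have f8 := cantor_code0 R f0; rewrite /block_weight smoothstep0; last by lra.
by rewrite flat_series_le0 ?subr0 ?addr0 //; lra.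
Qed.

Lemma block_weight1 f k : f 0%N = true ->
  (forall j, (j < k)%N -> f j.+1 = false) -> f k.+1 = true ->
  block_weight (cantor_code R f) = c k.+1.
Proof.
move=> f0 fz fk; have f1 := cantor_code1 R f0; rewrite /block_weight smoothstep1; last by lra.
rewrite subrr add0r (cantor_codeS R f) f0 mulr1n addrAC subrr add0r.
rewrite (@cantor_code_zeros R _ k) => [|j jk]; last by rewrite /shift_bits add1n fz.
rewrite mulrA -exprS shift_bitsD.
set s := cantor_code R _.
have s1 : 1 <= s by apply: cantor_code1; rewrite /shift_bits addn0 add1n.
have s2 : s <= 9 / 8 by have /andP[] := cantor_code_bounds R (shift_bits (1 + k) f).
have n0 : 9 ^+ k.+1 != 0 :> R by rewrite expf_neq0.
have K1 : 9 ^+ k.+1 * (9^-1 ^+ k.+1 * s) = s by rewrite mulrA -exprMn divff // expr1n mul1r.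
have K2 i : 9 ^+ (k.+1 + i) * (9^-1 ^+ k.+1 * s) = 9 ^+ i * s.
  by rewrite addnC exprD -mulrA K1.
rewrite (@flat_seriesE R c beta k.+2 _ beta_support); last first.
  by have := K2 1%N; rewrite addn1 expr1 => ->; lra.
have bs : beta s = 1 by rewrite /beta smoothstep1 ?smoothstep0 ?subr0 ?mulr1 //; lra.
rewrite big_nat_recr //= K1 bs mulr1.
(* The bumps of index i <= k are evaluated at $9^{i-k-1} s \le s/9 < 1/2$. *)
rewrite big_nat_cond big1 ?add0r // => i /andP[/andP[_ ik] _].
rewrite beta_support ?mulr0 //; left.
set m := (k - i)%N; have -> : k.+1 = (i + m.+1)%N by lia.
rewrite exprD -mulrA [9 ^+ i * _]mulrA -exprMn divff // expr1n mul1r.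
apply: (@le_lt_trans _ _ (9^-1 * s)); last by lra.
rewrite ler_wpM2r //; first by lra.
by rewrite exprS ler_piMr // exprn_ile1 // invf_le1 // ler1n.
Qed.

End BlockWeight.

(** * Periodic points and the determinant *)

Section PeriodicPoints.
Variable R : realType.
Local Notation T := (horseshoe_diffeo R).
Local Notation K := (@horseshoe_set R).
Implicit Types (x : 'rV[R]_2) (w : seq bool) (f p : nat -> bool).

Definition periodic_bits w : nat -> bool := fun j => nth false w (j %% size w).

Definition periodic_point w : 'rV[R]_2 :=
  code_point R (periodic_bits w) (fun j => nth false w ((size w).-1 - j %% size w)).

Lemma shift_periodic_bits w : shift_bits (size w) (periodic_bits w) = periodic_bits w.
Proof. by apply/funext => j; rewrite /shift_bits /periodic_bits modnDl. Qed.

(** A fixed point of the iterate has a periodic future, and its past is forced: after n + 1 shifts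
    the first n + 1 past bits are the future bits reversed. *)
Lemma periodic_point_bij n : set_bij [set` words n.+1]
  [set x | K x /\ iter n.+1 T x = x] periodic_point.
Proof.
split.
- move=> w wn; have /eqP sw : size w == n.+1 by rewrite -mem_words.
  split; first exact: code_point_in.
  rewrite [LHS]iter_horseshoe_code_point -{1}sw shift_periodic_bits; congr code_point.
  apply/funext => i; rewrite /past_bits /periodic_bits sw /=; case: ltnP => ni.
    by rewrite !modn_small //; lia.
  by congr (nth _ _ (_ - _)); rewrite -{2}(subnKC ni) modnDl.
- move=> w w' /set_mem wn /set_mem w'n.
  have /eqP sw : size w == n.+1 by rewrite -mem_words.
  have /eqP sw' : size w' == n.+1 by rewrite -mem_words.
  move=> /code_point_inj[/funeqP E _].
  apply: (@eq_from_nth _ false); first by rewrite sw sw'.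
  by move=> i iw; have := E i; rewrite /periodic_bits sw' -sw !modn_small.
move=> x [Kx xn].
have [f [p xE]] : exists f p, x = code_point R f p.
  by eexists; eexists; exact: bits_of_point.
move: xn; rewrite xE [LHS]iter_horseshoe_code_point => /code_point_inj[/funeqP fn /funeqP pn].
have fmod j : f j = f (j %% n.+1)%N.
  rewrite {1}(divn_eq j n.+1); elim: (j %/ n.+1)%N => [|q IH]; first by rewrite mul0n.
  by rewrite mulSn -addnA -IH -[RHS]fn.
have pmod j : p j = f (n - j %% n.+1)%N.
  have small i : (i < n.+1)%N -> p i = f (n - i)%N by move=> ni; rewrite -pn /past_bits ni.
  rewrite {1}(divn_eq j n.+1); elim: (j %/ n.+1)%N => [|q IH].
    by rewrite mul0n small // ltn_mod.
  by rewrite mulSn -addnA -IH -pn /past_bits ltnNge leq_addr /= addKn.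
have fn1 : mkseq f n.+1 \in words n.+1 by rewrite mem_words size_mkseq.
exists (mkseq f n.+1); first exact: fn1.
rewrite /periodic_point /periodic_bits size_mkseq; congr code_point; apply/funext => j.
  by rewrite nth_mkseq ?ltn_mod // -fmod.
by rewrite nth_mkseq ?pmod //=; lia.
Qed.

Variables (c : nat -> R) (c_superexp : superexp c).

(** Induction on w, shifting f. The next 1 after w is required only when w contains a 1: the zero
    word has weight 1 and its periodic repetition contains no 1 at all. *)
Lemma prod_block_weight w f d : (forall i, (i < size w)%N -> f i = nth false w i) ->
  (true \in w -> (forall i, (i < d)%N -> f (size w + i)%N = false) /\ f (size w + d)%N) ->
  \prod_(0 <= k < size w) block_weight c (cantor_code R (shift_bits k f)) =
    word_weight c w d.
Proof.
elim: w f => [|b w IH] f fw fd; first by rewrite big_nil.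
rewrite big_nat_recl //= -(IH (shift_bits 1 f)); first last.
- move=> wt; have [|d1 d2] := fd; first by rewrite in_cons wt orbT.
  by split; [move=> i /d1|]; rewrite /shift_bits add1n.
- by move=> i iw; rewrite /shift_bits add1n fw.
congr (_ * _).
have -> : shift_bits 0 f = f by [].
have f0 : f 0%N = b by rewrite fw.
case: b f0 fw fd => f0 fw fd; last exact: block_weight0.
have [d1 d2] := fd (mem_head _ _); rewrite /= in d1 d2.
have fwS i : (i < size w)%N -> f i.+1 = nth false w i by move=> iw; rewrite fw.
apply: block_weight1 => //; rewrite /gap; case: ifP => wt.
- move=> j jw; rewrite fwS; last by apply: leq_trans jw _; exact: index_size.
  by have := before_find false jw => /= /negbT; case: nth.
- move=> j jd; have [jw|wj] := ltnP j (size w).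
    rewrite fwS //; apply/negbTE/negP => wj; move/negP: wt; apply.
    by rewrite -wj; exact: mem_nth.
  by rewrite -(subnKC wj) -addSn d1 //; lia.
- by rewrite fwS ?nth_index // index_mem.
- by rewrite -addSn.
Qed.

Lemma prod_periodic_bits w :
  \prod_(0 <= k < size w) block_weight c (cantor_code R (shift_bits k (periodic_bits w))) =
    word_weight c w (index true w).
Proof.
apply: prod_block_weight; first by move=> i iw; rewrite /periodic_bits modn_small.
move=> wt; have iw : (index true w < size w)%N by rewrite index_mem.
split=> [i ii|]; rewrite /periodic_bits modnDl modn_small //.
- by have := before_find false ii => /= /negbT; case: nth.
- exact: ltn_trans ii iw.
- by rewrite nth_index.
Qed.

Lemma dyndet_coef_horseshoe (chi : 'rV[R]_2 -> R) n :
  (forall x, K x -> chi x = 1) ->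
  dyndet_coef T K (fun x => (chi x * block_weight c (x 0 0))%:C%C) n.+1 =
  ((\sum_(w <- words n.+1) word_weight c w (index true w)) /
     (n.+1%:R * ((9 ^+ n.+1 - 1) * (1 - 9^-1 ^+ n.+1))))%:C%C.
Proof.
move=> chi1; rewrite /dyndet_coef.
have D0 : 0 <= (9 ^+ n.+1 - 1) * (1 - 9^-1 ^+ n.+1) :> R.
  apply: mulr_ge0; first by rewrite subr_ge0 exprn_ege1 // ler1n.
  by rewrite subr_ge0 exprn_ile1 // invf_le1 // ler1n.
rewrite (reindex_fsbig periodic_point [set` words n.+1]); last exact: periodic_point_bij.
rewrite -fsbig_seq ?uniq_words //.
rewrite (eq_big_seq (fun w => (word_weight c w (index true w) /
    ((9 ^+ n.+1 - 1) * (1 - 9^-1 ^+ n.+1)))%:C%C)); last first.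
  move=> w; rewrite mem_words => /eqP sw.
  have Kw : K (periodic_point w) by exact: code_point_in.
  (* The factor $1 - 9^{n+1}$ is negative; a change of sign removes the absolute value. *)
  rewrite tangent_iter_horseshoe // det_1_sub_diag2 -normrN -mulNr opprB ger0_norm //.
  rewrite [RHS]rmorphM fmorphV; congr (_ / _).
  rewrite -prod_periodic_bits sw rmorph_prod; apply: eq_bigr => k _.
  rewrite [iter k T _]iter_horseshoe_code_point chi1; last exact: code_point_in.
  by rewrite mul1r pair_row0.
rewrite -rmorph_sum -mulr_suml -(rmorph_nat (real_complex R)) -fmorphV -rmorphM.
by congr (_%:C)%C; rewrite [in RHS]invfM mulrCA.
Qed.

End PeriodicPoints.

Section Realization.
Variable R : realType.
Local Notation T := (horseshoe_diffeo R).
Local Notation K := (@horseshoe_set R).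

Definition det_period (n : nat) : R := (9 ^+ n - 1) * (1 - 9^-1 ^+ n).

Lemma det_period_gt0 n : 0 < det_period n.+1.
Proof.
apply: mulr_gt0; first by rewrite subr_gt0 exprn_egt1 // ltr1n.
by rewrite subr_gt0 exprn_ilt1 // ?invr_ge0 // invf_lt1 // ltr1n.
Qed.

Lemma det_period_bounds n : 0 <= det_period n <= 9 ^+ n.
Proof.
have q0 : 0 <= 9^-1 ^+ n :> R by rewrite exprn_ge0 // invr_ge0.
have q1 : 9^-1 ^+ n <= 1 :> R by rewrite exprn_ile1 ?invr_ge0 // invf_le1 // ler1n.
have p1 : 1 <= 9 ^+ n :> R by rewrite exprn_ege1 // ler1n.
rewrite /det_period mulr_ge0 ?subr_ge0 //=.
apply: (@le_trans _ _ ((9 ^+ n - 1) * 1)); last by lra.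
by apply: ler_wpM2l; lra.
Qed.

(** For $Q = 9^{-(n+1)}$ the right-hand side is the sum of [pair_weight Q], which ties the
    determinants to the power sums of the inverse zeros. *)
Lemma det_periodE n :
  (det_period n.+1)^-1 = 9^-1 ^+ n.+1 / (1 - 9^-1 ^+ n.+1) ^+ 2.
Proof.
have n0 : 9 ^+ n.+1 != 0 :> R by rewrite expf_neq0.
have : det_period n.+1 != 0 by rewrite gt_eqF // det_period_gt0.
rewrite /det_period exprVn mulf_eq0 negb_or => /andP[n1 n2].
by field; rewrite n0 n1.
Qed.

Let a := pair_weight (9^-1 : R).

Let q01 : 0 <= (9^-1 : R) < 1.
Proof. by rewrite invr_ge0 ler0n /= invf_lt1 // ltr1n. Qed.

Let a_ge0 i : 0 <= a i.
Proof. by apply: pair_weight_ge0; case/andP: q01. Qed.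

Let a_le1 i : a i <= 1.
Proof. by apply: pair_weight_le1; case/andP: q01 => -> /ltW ->. Qed.

Let a_pow n : series (fun i => a i ^+ n.+1) @ \oo --> (det_period n.+1)^-1.
Proof.
rewrite det_periodE (_ : (fun i => _) = pair_weight (9^-1 ^+ n.+1)).
  apply: cvg_pair_weight; case/andP: q01 => q0 q1.
  by rewrite exprn_ge0 //= exprn_ilt1.
by apply/funext => i; rewrite pair_weightX.
Qed.

Let a_cvg : cvgn (series a).
Proof.
apply/cvg_ex; exists (det_period 1)^-1; have := @a_pow 0.
by rewrite (_ : (fun i => a i ^+ 1) = a).
Qed.

(* Since [\sum_n z^n / (n det_period n)] is minus the logarithm of the genus 0
   product, [p] only has to account for the factor [exp (tz z)]. *)
Lemma horseshoe_realization (t : nat -> R) (tz : R[i] -> R[i]) :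
  superexp (fun n => det_period n * t n) -> entire tz ->
  (forall z, (fun N => \sum_(0 <= j < N) (t j.+1)%:C%C * z ^+ j.+1) @ \oo --> tz z) ->
  forall W : set (plane R), open W -> K `<=` W ->
  exists g : plane R -> R[i],
    [/\ smooth_cfun g,
        exists V : set (plane R),
          [/\ compact V, isolating T K V, V `<=` W & closure [set x | g x != 0] `<=` V]
      & dynamical_determinant T K g (fun z => genus0_prod a z * cexp (tz z))].
Proof.
move=> sp etz tzE W oW KW.
(* The factor $D_n$ anticipates the division by the determinant in the dynamical coefficients. *)
pose p n := det_period n * t n; pose c := newton_coef p.
have sc : superexp c by exact: superexp_newton_coef.
have oO : open (W `&` @horseshoe_interior R).
  exact: openI oW (@open_horseshoe_interior R).
have KO : K `<=` W `&` @horseshoe_interior R.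
  by move=> x Kx; split; [exact: KW|exact: horseshoe_set_interior].
have [V [chi [cV VO KV ck [chi1 chiV]]]] :=
  has_cutoff_compact oO (@compact_horseshoe_set R) KO.
exists (fun x => (chi x * block_weight c (x 0 0))%:C%C); split.
- apply: smooth_cfun_plane => k; apply: CkM; first exact: ck.
  apply: (@Ck_comp R 2 k (block_weight c) (fun x => x 0 0)); last exact: Ck_coord.
  exact: smooth1_block_weight.
- exists V; split => //.
  + by apply: isolating_horseshoe => // x /VO [_ /horseshoe_interior_sub].
  + by move=> x /VO[].
  + have clV : closed (V : set 'rV[R]_2).
      by apply: compact_closed cV; exact: norm_hausdorff.
    rewrite [X in _ `<=` X](closure_id V).1 //; apply: closure_subset => x /= gx.
    apply: chiV; apply/eqP => cx; move/eqP: gx; apply.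
    by rewrite cx mul0r rmorph0.
- split.
    by apply: entireM; [exact: entire_genus0_prod|exact: entire_cexp_comp].
  (* The logarithms of the factors expand for $|z| < 1$, since $0 \le a_i \le 1$. *)
  exists 1 => // z z1.
  have [S LS SE] := genus0_prod_log a_ge0 a_le1 a_cvg a_pow z1.
  (* The coefficient of $z^n$ is $(1 - n D_n t_n)/(n D_n) = 1/(n D_n) - t_n$. *)
  exists (S - tz z); last by rewrite SE opprB addrC cexpD mulrC.
  rewrite (_ : series _ = fun N =>
      series (fun n => ((det_period n.+1)^-1 / n.+1%:R)%:C%C * z ^+ n.+1) N -
      \sum_(0 <= j < N) (t j.+1)%:C%C * z ^+ j.+1).
    exact: cvgB LS (tzE z).
  apply/funext => N; rewrite /series /= -sumrB; apply: eq_bigr => j _.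
  rewrite dyndet_coef_horseshoe // cyclic_sum_newton -mulrBl -rmorphB; congr (_%:C%C * _).
  have D0 : det_period j.+1 != 0 by rewrite gt_eqF // det_period_gt0.
  have j0 : j.+1%:R != 0 :> R by rewrite pnatr_eq0.
  rewrite -/(det_period j.+1) /p.
  move: (det_period j.+1) (j.+1%:R : R) D0 j0 => X Y X0 Y0.
  by field; rewrite X0 Y0.
Qed.

Let superexp_finite (t : nat -> R) k : (forall n, n != k -> t n = 0) -> superexp t.
Proof.
move=> tk m; exists (`|t k| * m%:R ^+ k) => n; have [->//|nk] := eqVneq n k.
by rewrite tk // normr0 mul0r mulr_ge0 // exprn_ge0.
Qed.

(** From $D_n \le 9^n$, the quantity to bound is at most $(9m)^n/n!$, a term of the series of
    $e^{9m}$. *)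
Let superexp_exp : superexp (fun n => det_period n * ((-1) ^+ n / n`!%:R)).
Proof.
move=> m; exists (expR (9 * m%:R)) => n.
have /andP[D0 D1] := det_period_bounds n.
have f0 : 0 < n`!%:R :> R by rewrite ltr0n fact_gt0.
rewrite normrM (ger0_norm D0) normf_div normrX normrN1 expr1n normr_nat mul1r.
apply: (@le_trans _ _ ((9 * m%:R) ^+ n / n`!%:R)).
  by rewrite mulrAC exprMn !ler_wpM2r ?invr_ge0 ?(ltW f0) ?exprn_ge0.
case: n f0 {D0 D1} => [|n] f0.
  by rewrite expr0 fact0 divr1 -[leLHS](@expR0 R) ler_expR mulr_ge0.
apply: le_trans (@expR_ge1Dxn R _ n _); first by rewrite lerDr.
by rewrite mulr_ge0.
Qed.

Lemma horseshoe_genus (gamma : option nat) (W : set (plane R)) : open W -> K `<=` W ->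
  exists g : plane R -> R[i],
    [/\ smooth_cfun g,
        exists V : set (plane R),
          [/\ compact V, isolating T K V, V `<=` W & closure [set x | g x != 0] `<=` V]
      & exists2 d : R[i] -> R[i], dynamical_determinant T K g d & has_genus d gamma].
Proof.
move=> oW KW; case: gamma => [k|].
  pose t (n : nat) : R := ((0 < k)%N && (n == k))%:R.
  (* The exponential formula forces the value 1 at z = 0, so the exponent has no constant term:
     genus 0 uses Q = 0 and not ['X^0]. *)
  pose Q : {poly R[i]} := if k is 0%N then 0 else 'X^k.
  have sQ : (size Q).-1 = k by rewrite /Q; case: k {t Q} => [|k]; rewrite ?size_poly0 ?size_polyXn.
  have tQ z : (fun N => \sum_(0 <= j < N) (t j.+1)%:C%C * z ^+ j.+1) @ \oo --> Q.[z].
    rewrite /Q /t; case: k {t Q sQ} => [|k].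
      rewrite horner0 (_ : (fun N => _) = cst 0); first exact: cvg_cst.
      by apply/funext => N; rewrite big1 // => j _; rewrite mul0r.
    rewrite hornerXn; apply: cvg_near_cst; near=> N.
    have kN : (k < N)%N by near: N; exists k.+1.
    rewrite (bigD1_seq k) ?mem_index_iota ?iota_uniq //= eqxx mul1r big1 ?addr0 // => j jk.
    by rewrite eqSS (negbTE jk) mul0r.
  have sp : superexp (fun n => det_period n * t n).
    apply: (@superexp_finite _ k) => n nk.
    by rewrite /t (negbTE nk) andbF mulr0.
  have [g [sg Vg dg]] := horseshoe_realization sp (@entire_horner R Q) tQ oW KW.
  exists g; split => //; exists (fun z => genus0_prod a z * cexp Q.[z]) => //.
  by rewrite -sQ; exact: has_genus_finite.
pose t (n : nat) : R := (-1) ^+ n / n`!%:R.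
(* Subtracting 1 removes the term of index 0, for the same normalization at z = 0. *)
have tE z : (fun N => \sum_(0 <= j < N) (t j.+1)%:C%C * z ^+ j.+1) @ \oo --> cexp (- z) - 1.
  have H : (fun N => \sum_(0 <= n < N + 1) (- z) ^+ n / n`!%:R) @ \oo --> cexp (- z).
    rewrite (cvg_shiftn 1 (fun N => \sum_(0 <= n < N) (- z) ^+ n / n`!%:R)).
    exact: cvg_cexp_series.
  rewrite (_ : (fun N => _) = fun N => \sum_(0 <= n < N + 1) (- z) ^+ n / n`!%:R - 1).
    exact: (cvgB H (cvg_cst (1 : R[i]))).
  apply/funext => N; rewrite addn1 big_nat_recl // expr0 fact0 divr1 addrAC subrr add0r.
  apply: eq_bigr => j _; rewrite /t rmorphM rmorphXn rmorphN1 fmorphV rmorph_nat.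
  by rewrite -[in RHS]mulN1r exprMn mulrAC.
have et : entire (fun z : R[i] => cexp (- z) - 1).
  have eN : entire (fun z : R[i] => - z).
    by move=> z; apply: derivableN; exact: derivable_id.
  exact: entireB (entire_cexp_comp eN) (@entire_cst R 1).
have [g [sg Vg dg]] := horseshoe_realization superexp_exp et tE oW KW.
exists g; split => //; exists (fun z => genus0_prod a z * cexp (cexp (- z) - 1)) => //.
exact: has_genus_infinite.
Unshelve. all: by end_near. Qed.

End Realization.

Theorem corollary3p5 (R : realType) (gamma : option nat) :
  exists (n : nat) (M : smoothManifold R n) (T : diffeo M) (K : set M),
    hyperbolic_basic_set T K /\
    forall W : set M, open W -> K `<=` W ->
    exists g : M -> R[i],
      [/\ smooth_cfun g,
          exists V : set M,
            [/\ compact V, isolating T K V, V `<=` W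
              & closure [set x | g x != 0] `<=` V]
        & exists2 d : R[i] -> R[i],
            dynamical_determinant T K g d & has_genus d gamma].
Proof.
exists 2%N, (plane R), (horseshoe_diffeo R), (@horseshoe_set R); split.
  exact: hyperbolic_basic_horseshoe.
by move=> W oW KW; exact: horseshoe_genus.
Qed.
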